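(* Let $\lambda, b\in\mathbb{C}$ and let $T:H(\mathbb{C})\to H(\mathbb{C})$ be the operator defined by $Tf(z)=f'(\lambda z+b)$. Then $T$ is hypercyclic if and only if $|\lambda|\geq 1$. Moreover, if $|\lambda|\ge 1$, then $T$ is strongly mixing with respect to some ($T$-invariant) Borel probability measure of full support on $H(\mathbb{C})$.
   Context: $H(\mathbb{C})$ is the Fréchet space of entire functions on $\mathbb{C}$ with the topology of uniform convergence on compact sets. A continuous linear operator $T$ on a topological vector space $X$ is hypercyclic if there is $x\in X$ whose orbit $\{x,Tx,T^2x,\dots\}$ is dense in $X$. A continuous linear operator $T$ on $X$ is strongly mixing with respect to a Borel probability measure $\mu$ on $X$ if $\mu$ is $T$-invariant and $\lim_{n\to\infty}\mu(A\cap T^{-n}(B))=\mu(A)\mu(B)$ for all measurable sets $A,B\subset X$. The measure $\mu$ has full support if $\mu(U)>0$ for every nonempty open set $U\subset X$. *)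

(* Defs.v *)
From HB Require Import structures.
From mathcomp Require Import all_boot all_order all_algebra.
From mathcomp Require Import complex.
From mathcomp Require Import all_classical all_reals all_analysis.

Set Implicit Arguments.
Unset Strict Implicit.
Unset Printing Implicit Defensive.

Import Order.TTheory GRing.Theory Num.Theory.
Import numFieldNormedType.Exports.

Local Open Scope classical_set_scope.
Local Open Scope ring_scope.

(* Only used with K := R[i] for R : realType: [derivable f z 1] is then complex
   differentiability at z, and [entire R[i]] is the space H(C). The structures
   are built over an abstract K because unification is slow on R[i]. *)
Definition entire_fun (K : numFieldType) : {pred K^o -> K^o} :=
  mem [set f : K^o -> K^o | forall z, derivable f z 1].

Section entire.
Context (K : numFieldType).

Fact entire_submod_closed : submod_closed (@entire_fun K).
Proof.
split=> [|a f g /set_mem df /set_mem dg]; apply/mem_set => z.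
  exact: (@derivable_cst K K^o K^o 0).
by apply: derivableD => //; exact: derivableZ.
Qed.

HB.instance Definition _ :=
  GRing.isSubmodClosed.Build K (K^o -> K^o) (@entire_fun K)
    entire_submod_closed.

Record entire := Entire {
  entire_val :> K^o -> K^o;
  entireP : entire_val \in @entire_fun K }.

HB.instance Definition _ := [isSub for entire_val].
HB.instance Definition _ := [Choice of entire by <:].
HB.instance Definition _ := [SubChoice_isSubLmodule of entire by <:].

(* Topology of uniform convergence on compact sets, see [entire_nbhs] and
   [entire_cvg]. *)
Definition entire_topology :=
  initial_topology (entire_val : entire -> {family compact, K^o -> K^o}).
HB.instance Definition _ := Uniform.copy entire entire_topology.


Lemma entire_continuous (f : entire) : continuous f.
Proof.
move=> z; apply: differentiable_continuous; apply/derivable1_diffP.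
exact: (set_mem (entireP f)).
Qed.

Lemma entire_nbhs (f : entire) (A : set K^o) (e : K) :
  compact A -> 0 < e ->
  \forall g \near nbhs f, forall z, A z -> `|f z - (g : entire) z| < e.
Proof.
move=> cA e0.
have : nbhs (entire_val f : {family compact, K^o -> K^o})
  [set g | forall z, A z -> ball (f z) e (g z)].
  apply: (@fam_nbhs K^o K^o compact A [set xy | ball xy.1 e xy.2]) => //.
  by exists e.
exact: (@initial_continuous entire {family compact, K^o -> K^o} entire_val f).
Qed.

Lemma entire_cvg (T : Type) (F : set_system T) (h : T -> entire) (f : entire) :
  Filter F ->
  (forall (A : set K^o) (e : K), compact A -> 0 < e ->
    \forall t \near F, forall z, A z -> `|f z - h t z| < e) -> h @ F --> f.
Proof.
move=> FF Ff U [_ /= [[W oW <-] Wf /filterS]]; apply.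
suff : {family compact, (fun t => entire_val (h t)) @ F --> entire_val f}.
  by apply; exact: open_nbhs_nbhs.
apply/fam_cvgP => A cA P /uniform_nbhs[E [[e /= e0 eE] EP]].
apply: filterS (Ff A e cA e0) => t fht; apply: EP => z Az /=.
by apply: eE; exact: fht.
Qed.

Fact entire_add_continuous : continuous (fun x : entire * entire => x.1 + x.2).
Proof.
move=> [f g]; apply: entire_cvg => A e cA e0.
have e20 : 0 < e / 2 by rewrite divr_gt0.
near=> x => z Az /=.
have -> : (f + g) z - (x.1 + x.2) z = (f z - x.1 z) + (g z - x.2 z).
  rewrite [(f + g) z]/(f z + g z) [(x.1 + x.2) z]/(x.1 z + x.2 z).
  by rewrite addrACA opprD.
rewrite (splitr e) (le_lt_trans (ler_normD _ _))// ltrD//.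
  move: z Az; near: x; exact: (cvg_fst (G := nbhs g) (entire_nbhs f cA e20)).
move: z Az; near: x; exact: (cvg_snd (F := nbhs f) (entire_nbhs g cA e20)).
Unshelve. all: by end_near. Qed.

Fact entire_scale_continuous :
  continuous (fun x : K^o * entire => x.1 *: x.2).
Proof.
move=> [a f]; apply: entire_cvg => A e cA e0.
have [M M0 fM] : exists2 M : K, 0 < M & forall z, A z -> `|f z| <= M.
  have /compact_near_coveringP cov := cA.
  have /pinfty_ex_gt0[M M0 fM] :
      \forall M \near +oo, forall z, A z -> `|f z| <= M.
    apply: (cov K +oo (fun M z => `|f z| <= M)) => z Az.
    exists ([set w | `|f z - f w| < 1], [set M | `|f z| + 1 < M]).
    - split; last first.
        by exists (`|f z| + 1); split => //; rewrite realE ltW// ltr_wpDl.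
      have Bf : nbhs (f z) [set y | `|f z - y| < 1] by exists 1 => /=.
      exact: entire_continuous Bf.
    - move=> [w M] [/= zw zM]; rewrite (le_trans _ (ltW zM))//.
      rewrite -[f w](subKr (f z)) (le_trans (ler_normB _ _))// lerD2l.
      exact: ltW.
  by exists M.
have a1 : 0 < `|a| + 1 by rewrite ltr_wpDl.
have d0 : 0 < e / 2 / (`|a| + 1) by rewrite !divr_gt0.
have m0 : 0 < e / 2 / M by rewrite !divr_gt0.
have na (r : K) : 0 < r -> \forall b \near nbhs (a : K^o), `|a - b| < r.
  by move=> r0; exists r.
near=> x => z Az /=.
have -> : (a *: f) z - (x.1 *: x.2) z =
          (a - x.1) * f z + x.1 * (f z - x.2 z).
  rewrite [(a *: f) z]/(a * f z) [(x.1 *: x.2) z]/(x.1 * x.2 z).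
  by rewrite mulrBl mulrBr addrA subrK.
have xa1 : `|a - x.1| < 1.
  near: x; exact: (cvg_fst (G := nbhs f) (na _ ltr01)).
have xaM : `|a - x.1| < e / 2 / M.
  near: x; exact: (cvg_fst (G := nbhs f) (na _ m0)).
have x1 : `|x.1| <= `|a| + 1.
  rewrite -[x.1](subKr a) (le_trans (ler_normB _ _))// lerD2l.
  exact: ltW.
have fx : `|f z - x.2 z| < e / 2 / (`|a| + 1).
  move: z Az; near: x; exact: (cvg_snd (F := nbhs a) (entire_nbhs f cA d0)).
rewrite (splitr e) (le_lt_trans (ler_normD _ _))// ltr_leD// normrM.
  rewrite (le_lt_trans (ler_wpM2l _ (fM _ Az)))//.
  by rewrite -ltr_pdivlMr.
rewrite (le_trans (ler_wpM2r _ x1))//.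
by rewrite mulrC -ler_pdivlMr// ltW.
Unshelve. all: by end_near. Qed.

HB.instance Definition _ :=
  PreTopologicalNmodule_isTopologicalNmodule.Build entire
    entire_add_continuous.
HB.instance Definition _ :=
  TopologicalNmodule_isTopologicalLmodule.Build K entire
    entire_scale_continuous.
(* measurable types are pointed in the library *)
HB.instance Definition _ := isPointed.Build entire 0.

End entire.

Definition hypercyclic (X : topologicalType) (T : X -> X) :=
  exists x : X, dense (range (fun n => iter n T x)).

Notation borel X := (g_sigma_algebraType (@open X)).

Section borel_measure.
Context (X : ptopologicalType) (R : realType).
Implicit Types mu : probability (borel X) R.

Definition invariant_measure (T : X -> X) mu :=
  forall A : set (borel X), measurable A -> mu (T @^-1` A) = mu A.

Definition strongly_mixing (T : X -> X) mu :=
  invariant_measure T mu /\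
  forall A B : set (borel X), measurable A -> measurable B ->
    mu (A `&` iter n T @^-1` B) @[n --> \oo] --> (mu A * mu B)%E.

Definition full_support mu :=
  forall U : set X, open U -> U !=set0 -> (0 < mu U)%E.

End borel_measure.

(* Main.v *)
Require Import Defs.
From HB Require Import structures.
From mathcomp Require Import all_boot all_order all_algebra.
From mathcomp Require Import complex.
From mathcomp Require Import all_classical all_reals all_analysis.
From mathcomp Require Import ring lra zify.

(* Goursat's theorem on rectangles, applied to w |-> f(z + e^w) e^(-w), whose
   values on vertical segments are the Cauchy integrals of f on circles, makes
   f' satisfy Cauchy's estimate. If |lambda| < 1, the affine map
   z |-> lambda z + b sends a disc of large radius r into one of radius r - 1,
   so T does not increase suprema over that disc and every orbit is bounded
   there.
   If |lambda| >= 1, let x be a two-sided sequence of independent rows of fair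
   coins and L_k the number of heads before the first tail in row k. For a
   countable family Z_l of bi-orbits of T, i.e. T Z_l(k) = Z_l(k - 1), with
   Z_l(k) -> 0 fast enough compared to l, the random entire function
   sum_k Z_(L_k)(k) converges almost surely and intertwines the Bernoulli shift
   with T, so its law is strongly mixing; it has full support as soon as the
   Z_l(0) are dense, and almost every point then has a dense orbit. The Z_l are
   combinations with rational coefficients of the bi-orbits of the functions
   (z - z0)^i when z0 is a fixed point of the affine map, where T acts as a
   weighted backward shift, and of rescalings of z^i exp(-z^2) when lambda = 1
   and b <> 0; there the backward orbit consists of primitives vanishing at
   -oo, and the forward orbit is small by Cauchy's estimate. *)

Import Order.TTheory GRing.Theory Num.Theory.
Import numFieldNormedType.Exports.

Local Open Scope classical_set_scope.
Local Open Scope ring_scope.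

Set Implicit Arguments.
Unset Strict Implicit.
Unset Printing Implicit Defensive.

(** * Complex derivatives *)

(** The random series rests on a balance of rates. Row [k] starts with more than [|k| + K] heads
    with probability [2^-(|k|+K+1)], which is summable, so almost surely [L_k <= |k| + K] for some
    [K]; a bi-orbit bounded by [(3/2)^l 2^-|k|] then contributes at most a multiple of [(3/4)^|k|].
    Any base strictly between 1 and 2 could replace 3/2. As [L_k] takes every value, one row of
    coins selects among countably many bi-orbits. Full support: since [Z_0 = 0], prescribing
    finitely many rows makes a partial sum equal to [Z_l(0)]; this has positive probability and is
    independent of the rows that control the tail. Dense orbits: the functions whose orbit avoids an
    open [V] form a set disjoint from every [T^-n V], so mixing forces its measure to vanish. For
    translations the Gaussian works in both directions: it decays at -oo faster than any
    exponential, so iterated primitives shrink at any prescribed geometric rate, and [T^n] evaluates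
    an [n]-th derivative near [n], where the square in the exponent beats the cost of [n] Cauchy
    estimates. *)

Section field_derivative.
Context (K : numFieldType).
Implicit Types (f g : K -> K) (z d e : K).

(** The order of [K] is only partial; the product over the sum is a common lower bound found without
    comparing [a] and [b]. *)
Lemma pos_lower (a b : K) : 0 < a -> 0 < b ->
  exists2 c, 0 < c & c <= a /\ c <= b.
Proof.
move=> a0 b0; have ab0 : 0 < a + b by rewrite addr_gt0.
exists (a * b / (a + b)); first by rewrite divr_gt0 ?mulr_gt0.
by split; rewrite ler_pdivrMr//; [rewrite ler_pM2l// lerDr|
  rewrite mulrC ler_pM2l// lerDl]; exact: ltW.
Qed.

(** One notion for both [K := R] and [K := R[i]]; fixing the direction 1 and the [K^o] annotations
    here keeps them out of later statements. *)
Definition fderiv f z d := @is_derive K K^o K^o z 1 f d.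

Lemma fderivP f z d : fderiv f z d <->
  forall e, 0 < e -> exists2 dl, 0 < dl &
    forall h, `|h| < dl -> `|f (z + h) - f z - d * h| <= e * `|h|.
Proof.
have key (e h : K) : h != 0 -> `|h^-1 *: (f (z + h) - f z) - d| <= e <->
    `|f (z + h) - f z - d * h| <= e * `|h|.
  move=> h0; have -> : h^-1 *: (f (z + h) - f z) - d =
      (f (z + h) - f z - d * h) / h.
    by rewrite mulrBl mulfK// mulrC.
  by rewrite normrM normfV ler_pdivrMr ?normr_gt0.
split=> [[df dE] e e0|H].
- have : h^-1 *: (f (h *: 1 + z) - f z) @[h --> 0^'] --> (d : K^o).
    by rewrite -dE; exact: df.
  move=> /cvgrPdist_lt/(_ e e0)[dl /= dl0 dlP]; exists dl => // h hd.
  have [->|h0] := eqVneq h 0; first by rewrite addr0 subrr mulr0 subrr !normr0 mulr0.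
  apply/key => //; rewrite distrC (addrC z) -[h in f (h + z)]mulr1.
  apply/ltW/dlP => //=.
  by rewrite sub0r normrN.
- have cv : h^-1 *: (f (h *: 1 + z) - f z) @[h --> 0^'] --> (d : K^o).
    apply/cvgrPdist_le => e e0; have [dl dl0 dlP] := H e e0.
    exists dl => // h /=; rewrite sub0r normrN => hd h0.
    by rewrite distrC [_%:A]mulr1 (addrC h); apply/key => //; exact: dlP.
  split; first by apply/cvg_ex; exists d.
  exact: cvg_lim.
Qed.

Lemma fderiv_eq f z d d' : fderiv f z d -> d = d' -> fderiv f z d'.
Proof. by move=> ? <-. Qed.

Lemma fderiv_uniq f z d d' : fderiv f z d -> fderiv f z d' -> d = d'.
Proof. by move=> [_ <-] [_ <-]. Qed.

Lemma fderiv_derive1 f z d :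
  fderiv f z d -> ((f : K^o -> K^o)^`())%classic z = d.
Proof. by move=> [_ <-]; rewrite derive1E. Qed.

Lemma derivable_fderiv f z : @derivable K K^o K^o f z 1 ->
  fderiv f z (((f : K^o -> K^o)^`())%classic z).
Proof. by move=> df; rewrite derive1E; exact: derivableP. Qed.

Lemma fderiv_cst c z : fderiv (fun=> c) z 0.
Proof. exact: is_derive_cst. Qed.

Lemma fderiv_id z : fderiv id z 1.
Proof. exact: is_derive_id. Qed.

Lemma fderivD f g z d d' : fderiv f z d -> fderiv g z d' ->
  fderiv (fun w => f w + g w) z (d + d').
Proof. by move=> df dg; exact: (@is_deriveD K K^o K^o f g z 1). Qed.

Lemma fderivN f z d : fderiv f z d -> fderiv (fun w => - f w) z (- d).
Proof. by move=> df; exact: (@is_deriveN K K^o K^o f z 1). Qed.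

Lemma fderivB f g z d d' : fderiv f z d -> fderiv g z d' ->
  fderiv (fun w => f w - g w) z (d - d').
Proof. by move=> df dg; exact: (@is_deriveB K K^o K^o f g z 1). Qed.

Lemma fderivM f g z d d' : fderiv f z d -> fderiv g z d' ->
  fderiv (fun w => f w * g w) z (d * g z + f z * d').
Proof.
move=> df dg; have := @is_deriveM K K^o f g z 1 d d' df dg.
by move/fderiv_eq; apply; rewrite addrC mulrC.
Qed.

Lemma fderivZ a f z d : fderiv f z d -> fderiv (fun w => a * f w) z (a * d).
Proof. by move=> df; exact: (@is_deriveZ K K^o K^o f a z 1). Qed.

Lemma fderiv_cont f z d : fderiv f z d -> forall e, 0 < e ->
  exists2 dl, 0 < dl & forall h, `|h| < dl -> `|f (z + h) - f z| < e.
Proof.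
move=> [df _] e e0.
have : {for (z : K^o), continuous (f : K^o -> K^o)}.
  by apply: differentiable_continuous; exact/derivable1_diffP.
move=> /cvgrPdist_lt/(_ e e0)[dl /= dl0 dlP]; exists dl => // h hd.
by rewrite distrC; apply: dlP => /=; rewrite opprD addNKr normrN.
Qed.

Lemma fderiv_comp f g z d d' : fderiv f (g z) d -> fderiv g z d' ->
  fderiv (fun w => f (g w)) z (d * d').
Proof.
move=> df dg; apply/fderivP => e e0.
have M0 : 0 < `|d'| + 1 by rewrite ltr_wpDl.
have D0 : 0 < `|d| + 1 by rewrite ltr_wpDl.
have e1 : 0 < e / 2 / (`|d'| + 1) by rewrite !divr_gt0.
have e2 : 0 < e / 2 / (`|d| + 1) by rewrite !divr_gt0.
have [l1 l10 H1] := (fderivP f (g z) d).1 df _ e1.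
have [l2 l20 H2] := (fderivP g z d').1 dg _ e2.
have [l3 l30 H3] := fderiv_cont dg l10.
have [l4 l40 H4] := (fderivP g z d').1 dg _ ltr01.
have [l5 l50 [l52 l53]] := pos_lower l20 l30.
have [l6 l60 [l65 l64]] := pos_lower l50 l40.
exists l6 => // h h6; have h4 := lt_le_trans h6 l64.
have h5 := lt_le_trans h6 l65.
have h2 := lt_le_trans h5 l52; have h3 := lt_le_trans h5 l53.
have gh : `|g (z + h) - g z| <= (`|d'| + 1) * `|h|.
  rewrite -[X in `|X|](subrK (d' * h)) (le_trans (ler_normD _ _))//.
  by rewrite normrM addrC mulrDl lerD2l; exact: H4.
have := H1 _ (H3 _ h3); rewrite subrKC => {}H1.
(* The error of the composite is the error of [f] at the increment of [g] plus [d] times the error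
   of [g]. Each takes half of [e]; the [+ 1] in the denominators avoids dividing by 0. *)
have -> : f (g (z + h)) - f (g z) - d * d' * h =
  (f (g (z + h)) - f (g z) - d * (g (z + h) - g z)) +
  d * (g (z + h) - g z - d' * h) by ring.
rewrite (le_trans (ler_normD _ _))// [e]splitr mulrDl lerD//.
  apply: (le_trans H1); apply: le_trans (ler_wpM2l (ltW e1) gh) _.
  by rewrite mulrA divfK ?gt_eqF.
have q0 : 0 <= e / 2 / (`|d| + 1) * `|h| by rewrite mulr_ge0// ltW.
rewrite normrM (le_trans (ler_wpM2l _ (H2 _ h2)))//.
have dd : `|d| <= `|d| + 1 by rewrite lerDl.
apply: le_trans (ler_wpM2r q0 dd) _.
by rewrite mulrA [_ * (_ / _)]mulrC divfK ?gt_eqF.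
Qed.

Lemma fderiv_mem_entire f : (forall z, exists d, fderiv f z d) ->
  (f : K^o -> K^o) \in @entire_fun K.
Proof. by move=> H; apply/mem_set => z; have [d []] := H z. Qed.

End field_derivative.

(** * The real-valued modulus and coordinates of complex numbers *)

Section modulus.
Context (R : realType).
Implicit Types (z w : R[i]) (r : R).

(** The norm on [R[i]] takes its values in [R[i]], whose order is partial. A modulus in [R] gives a
    total order and makes [lra] and [nra] applicable. *)
Definition cabs z : R := ComplexField.Normc.normc z.

Lemma normr_cabs z : `|z| = (cabs z)%:C%C.
Proof. by []. Qed.

Lemma cabs_ge0 z : 0 <= cabs z.
Proof. by case: z => a b; exact: sqrtr_ge0. Qed.

Lemma cabs0 : cabs 0 = 0. Proof. exact: ComplexField.Normc.normc0. Qed.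

Lemma cabs1 : cabs 1 = 1. Proof. exact: ComplexField.Normc.normc1. Qed.

Lemma cabs_eq0 z : cabs z = 0 -> z = 0.
Proof. exact: ComplexField.Normc.eq0_normc. Qed.

Lemma cabs_gt0 z : (0 < cabs z) = (z != 0).
Proof.
rewrite lt_def cabs_ge0 andbT; congr (~~ _).
apply/eqP/eqP => [/cabs_eq0|->]; first by []. exact: cabs0.
Qed.

Lemma cabsM z w : cabs (z * w) = cabs z * cabs w.
Proof. exact: ComplexField.Normc.normcM. Qed.

Lemma cabsV z : cabs z^-1 = (cabs z)^-1.
Proof. exact: ComplexField.Normc.normcV. Qed.

Lemma cabsX z n : cabs (z ^+ n) = cabs z ^+ n.
Proof.
by elim: n => [|n IH]; rewrite ?expr0 ?cabs1// !exprS cabsM IH.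
Qed.

Lemma cabsD z w : cabs (z + w) <= cabs z + cabs w.
Proof. exact: le_normcD. Qed.

Lemma cabsN z : cabs (- z) = cabs z.
Proof. exact: normcN. Qed.

Lemma cabsB z w : cabs (z - w) <= cabs z + cabs w.
Proof. by rewrite (le_trans (cabsD _ _))// cabsN. Qed.

Lemma cabsC z w : cabs (z - w) = cabs (w - z).
Proof. by rewrite -cabsN opprB. Qed.

Lemma cabs_sum (I : Type) (s : seq I) (P : pred I) (F : I -> R[i]) :
  cabs (\sum_(i <- s | P i) F i) <= \sum_(i <- s | P i) cabs (F i).
Proof.
elim/big_rec2 : _ => [|i y1 y2 _ h]; first by rewrite cabs0.
by rewrite (le_trans (cabsD _ _))// lerD2l.
Qed.

Lemma cabs_real r : cabs r%:C%C = `|r|.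
Proof. by rewrite /cabs /= expr0n addr0 sqrtr_sqr. Qed.

Lemma cabs_nat n : cabs n%:R = n%:R.
Proof. by rewrite -(rmorph_nat (@real_complex R)) cabs_real normr_nat. Qed.

Lemma cabsi : cabs 'i%C = 1.
Proof. by rewrite /cabs /= expr0n add0r expr1n sqrtr1. Qed.

Lemma Re_le_cabs z : `|complex.Re z| <= cabs z.
Proof.
case: z => a b /=; rewrite -(sqrtr_sqr a) ler_wsqrtr//.
by rewrite lerDl sqr_ge0.
Qed.

Lemma Im_le_cabs z : `|complex.Im z| <= cabs z.
Proof.
case: z => a b /=; rewrite -(sqrtr_sqr b) ler_wsqrtr//.
by rewrite lerDr sqr_ge0.
Qed.

Lemma cabs_le_ReIm z : cabs z <= `|complex.Re z| + `|complex.Im z|.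
Proof.
rewrite {1}[z]complexE (le_trans (cabsD _ _))// cabsM cabsi mul1r.
by rewrite !cabs_real.
Qed.

Lemma cReM z w : complex.Re (z * w) =
  complex.Re z * complex.Re w - complex.Im z * complex.Im w.
Proof. by case: z; case: w. Qed.

Lemma cImM z w : complex.Im (z * w) =
  complex.Re z * complex.Im w + complex.Im z * complex.Re w.
Proof. by case: z; case: w. Qed.

Lemma cReD z w : complex.Re (z + w) = complex.Re z + complex.Re w.
Proof. by case: z; case: w. Qed.

Lemma cImD z w : complex.Im (z + w) = complex.Im z + complex.Im w.
Proof. by case: z; case: w. Qed.

Lemma cReN z : complex.Re (- z) = - complex.Re z. Proof. by case: z. Qed.

Lemma cImN z : complex.Im (- z) = - complex.Im z. Proof. by case: z. Qed.

Lemma cReB z w : complex.Re (z - w) = complex.Re z - complex.Re w.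
Proof. by rewrite cReD cReN. Qed.

Lemma cImB z w : complex.Im (z - w) = complex.Im z - complex.Im w.
Proof. by rewrite cImD cImN. Qed.

Lemma complex_eq z w : complex.Re z = complex.Re w ->
  complex.Im z = complex.Im w -> z = w.
Proof. by case: z => a b; case: w => c d /= -> ->. Qed.

Lemma cderivP (f : R[i] -> R[i]) z d : fderiv f z d <->
  forall e : R, 0 < e -> exists2 dl : R, 0 < dl &
    forall h, cabs h < dl -> cabs (f (z + h) - f z - d * h) <= e * cabs h.
Proof.
split=> [/fderivP H e e0|H].
- have [|dl dl0 dlP] := H (e%:C)%C; first by rewrite ltcR.
  (* A positive element of [R[i]] has zero imaginary part, so a complex radius is a real one. *)
  have dE : dl = ((complex.Re dl)%:C)%C.
    by case: dl dl0 {dlP} => a b; rewrite ltcE /= => /andP[/eqP -> _].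
  rewrite dE ltcR in dl0; exists (complex.Re dl) => // h hd.
  have := dlP h; rewrite {1}dE normr_cabs ltcR => /(_ hd).
  by rewrite normr_cabs -rmorphM lecR.
- apply/fderivP => e e0.
  have eE : e = ((complex.Re e)%:C)%C.
    by case: e e0 => a b; rewrite ltcE /= => /andP[/eqP -> _].
  rewrite eE ltcR in e0; have [dl dl0 dlP] := H _ e0.
  exists (dl%:C)%C; first by rewrite ltcR.
  move=> h; rewrite normr_cabs ltcR => /dlP.
  by rewrite {2}eE !normr_cabs -rmorphM lecR.
Qed.

End modulus.

(** * Complex-valued paths and the mean value inequality *)

Section path_derivative.
Context (R : realType).
Implicit Types (g F : R -> R[i]) (t a b : R) (d c : R[i]).

(** Differentiation by coordinates reduces paths to real calculus: monotonicity and the fundamental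
    theorem apply to each coordinate. *)
Definition rderiv g t d :=
  fderiv (fun s => complex.Re (g s)) t (complex.Re d) /\
  fderiv (fun s => complex.Im (g s)) t (complex.Im d).

Lemma rderiv_eq g t d d' : rderiv g t d -> d = d' -> rderiv g t d'.
Proof. by move=> ? <-. Qed.

Lemma rderivB g F t d c : rderiv g t d -> rderiv F t c ->
  rderiv (fun s => g s - F s) t (d - c).
Proof.
move=> [g1 g2] [F1 F2]; split.
  by under [X in fderiv X]eq_fun do rewrite cReB; rewrite cReB; exact: fderivB.
by under [X in fderiv X]eq_fun do rewrite cImB; rewrite cImB; exact: fderivB.
Qed.

Lemma rderivD g F t d c : rderiv g t d -> rderiv F t c ->
  rderiv (fun s => g s + F s) t (d + c).
Proof.
move=> [g1 g2] [F1 F2]; split.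
  by under [X in fderiv X]eq_fun do rewrite cReD; rewrite cReD; exact: fderivD.
by under [X in fderiv X]eq_fun do rewrite cImD; rewrite cImD; exact: fderivD.
Qed.

Lemma rderivZ c g t d : rderiv g t d -> rderiv (fun s => c * g s) t (c * d).
Proof.
move=> [g1 g2]; split.
  under [X in fderiv X]eq_fun do rewrite cReM; rewrite cReM.
  by apply: fderivB; exact: fderivZ.
under [X in fderiv X]eq_fun do rewrite cImM; rewrite cImM.
by apply: fderivD; exact: fderivZ.
Qed.

Lemma rderiv_epsP g t d :
  (forall e : R, 0 < e -> exists2 dl : R, 0 < dl &
    forall h : R, `|h| < dl -> cabs (g (t + h) - g t - d * (h%:C)%C) <= e * `|h|) ->
  rderiv g t d.
Proof.
move=> H; split; apply/fderivP => e e0; have [dl dl0 dlP] := H e e0;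
  exists dl => // h /dlP.
  apply: le_trans; apply: le_trans (Re_le_cabs _).
  by rewrite !cReB cReM/= mulr0 subr0.
apply: le_trans; apply: le_trans (Im_le_cabs _).
by rewrite !cImB cImM/= mulr0 add0r.
Qed.

Lemma rderiv_line (f : R[i] -> R[i]) z u t d : fderiv f (z + (t%:C)%C * u) d ->
  rderiv (fun s => f (z + (s%:C)%C * u)) t (d * u).
Proof.
move=> /cderivP H; apply: rderiv_epsP => e e0.
have u0 : 0 < cabs u + 1 by rewrite ltr_wpDl// cabs_ge0.
have [dl dl0 dlP] := H _ (divr_gt0 e0 u0).
exists (dl / (cabs u + 1)); first by rewrite divr_gt0.
move=> h; rewrite ltr_pdivlMr// => hd.
have hu : `|h| * cabs u <= `|h| * (cabs u + 1).
  by rewrite ler_wpM2l// lerDl.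
have := dlP ((h%:C)%C * u); rewrite cabsM cabs_real => /(_ (le_lt_trans hu hd)).
have -> : z + (t%:C)%C * u + (h%:C)%C * u = z + ((t + h)%:C)%C * u.
  by rewrite -addrA -mulrDl -rmorphD.
rewrite -[d * u * _]mulrA [u * _]mulrC => /le_trans; apply.
rewrite (le_trans (ler_wpM2l _ hu))//; first by rewrite divr_ge0// ltW.
by rewrite mulrCA mulrC divfK ?gt_eqF.
Qed.

Lemma rderiv_horizontal (f : R[i] -> R[i]) y t d : fderiv f (t +i* y)%C d ->
  rderiv (fun s => f (s +i* y)%C) t d.
Proof.
have E s : (s +i* y)%C = (0 +i* y)%C + (s%:C)%C * 1.
  by rewrite mulr1; apply: complex_eq; rewrite ?cReD ?cImD/= ?add0r ?addr0.
have -> : (fun s => f (s +i* y)%C) = fun s => f ((0 +i* y)%C + (s%:C)%C * 1).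
  by apply/funext => s; rewrite -E.
by rewrite E => H; apply: rderiv_eq (rderiv_line H) _; rewrite mulr1.
Qed.

Lemma rderiv_vertical (f : R[i] -> R[i]) x t d : fderiv f (x +i* t)%C d ->
  rderiv (fun s => f (x +i* s)%C) t ('i%C * d).
Proof.
have E s : (x +i* s)%C = (x%:C)%C + (s%:C)%C * 'i%C.
  by apply: complex_eq; rewrite ?cReD ?cImD ?cReM ?cImM/=; ring.
have -> : (fun s => f (x +i* s)%C) = fun s => f ((x%:C)%C + (s%:C)%C * 'i%C).
  by apply/funext => s; rewrite -E.
by rewrite E => H; apply: rderiv_eq (rderiv_line H) _; rewrite mulrC.
Qed.

Lemma fderiv_continuous (G : R -> R) (t d : R) : fderiv G t d -> {for t, continuous G}.
Proof.
by move=> [dG _]; apply: differentiable_continuous; exact/derivable1_diffP.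
Qed.

Lemma fderiv_nonincreasing (G dG : R -> R) a b : a <= b ->
  (forall t, a <= t <= b -> fderiv G t (dG t)) ->
  (forall t, a <= t <= b -> dG t <= 0) -> G b <= G a.
Proof.
move=> ab GdG dG0.
have in_cc t : t \in `]a, b[ -> a <= t <= b.
  by rewrite in_itv/= => /andP[/ltW-> /ltW].
apply: (@ler0_derive1_le_cc _ G a b); rewrite ?in_itv/= ?lexx ?ab//.
- by move=> t /in_cc/GdG[].
- by move=> t /in_cc tab; rewrite (fderiv_derive1 (GdG _ tab)); exact: dG0.
- apply: derivable_within_continuous => t; rewrite in_itv/= => /GdG.
  by case.
Qed.

(** There is no mean value equality for complex paths, so the increment [w] is projected on its own
    direction: the real part of [conj w] times [F], minus [cabs w] times [G], is nonincreasing, and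
    comparing end points gives [|w|^2 <= |w| (G b - G a)]. *)
Lemma rderiv_mvt F (dF : R -> R[i]) (G dG : R -> R) a b : a <= b ->
  (forall t, a <= t <= b -> rderiv F t (dF t)) ->
  (forall t, a <= t <= b -> fderiv G t (dG t)) ->
  (forall t, a <= t <= b -> cabs (dF t) <= dG t) ->
  cabs (F b - F a) <= G b - G a.
Proof.
move=> ab FdF GdG dFG; set w := F b - F a.
have G0 : 0 <= G b - G a.
  rewrite subr_ge0 -lerN2.
  apply: (@fderiv_nonincreasing (fun t => - G t) (fun t => - dG t)) => //.
    by move=> t tab; exact/fderivN/GdG.
  by move=> t tab; rewrite oppr_le0 (le_trans (cabs_ge0 _) (dFG _ tab)).
have [->|w0] := eqVneq (cabs w) 0; first by [].
have {}w0 : 0 < cabs w by rewrite lt_def w0 cabs_ge0.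
pose H t := complex.Re (w^*%C * F t) - cabs w * G t.
have : H b <= H a.
  apply: (@fderiv_nonincreasing H
    (fun t => complex.Re (w^*%C * dF t) - cabs w * dG t)) => // t tab.
    apply: fderivB; first exact: (rderivZ _ (FdF _ tab)).1.
    exact/fderivZ/GdG.
  rewrite subr_le0 (le_trans (ler_norm _))// (le_trans (Re_le_cabs _))//.
  rewrite cabsM; have -> : cabs w^*%C = cabs w.
    by case: (w) => x y; rewrite /cabs /= sqrrN.
  by rewrite ler_wpM2l ?cabs_ge0 ?dFG.
rewrite /H => h.
have : complex.Re (w^*%C * w) =
    complex.Re (w^*%C * F b) - complex.Re (w^*%C * F a).
  by rewrite -cReB -mulrBr.
have -> : complex.Re (w^*%C * w) = cabs w ^+ 2.
  case: (w) => x y; rewrite /cabs cReM /= sqr_sqrtr ?addr_ge0 ?sqr_ge0//.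
  by rewrite mulNr opprK.
by move=> E; rewrite -(ler_pM2l w0) -expr2 E; lra.
Qed.

Lemma rderiv_lip F (dF : R -> R[i]) M a b : a <= b ->
  (forall t, a <= t <= b -> rderiv F t (dF t)) ->
  (forall t, a <= t <= b -> cabs (dF t) <= M) ->
  cabs (F b - F a) <= M * (b - a).
Proof.
move=> ab FdF dFM; rewrite mulrBr.
apply: (@rderiv_mvt F dF (fun t => M * t) (fun=> M)) => // t _.
by rewrite -{2}[M]mulr1; exact/fderivZ/fderiv_id.
Qed.

Lemma fderiv_lip (f df : R[i] -> R[i]) z w M :
  (forall t : R, 0 <= t <= 1 -> fderiv f (z + (t%:C)%C * w) (df (z + (t%:C)%C * w))) ->
  (forall t : R, 0 <= t <= 1 -> cabs (df (z + (t%:C)%C * w)) <= M) ->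
  cabs (f (z + w) - f z) <= M * cabs w.
Proof.
move=> fdf dfM.
have := @rderiv_lip (fun s => f (z + (s%:C)%C * w))
  (fun t => df (z + (t%:C)%C * w) * w) (M * cabs w) 0 1 ler01.
rewrite subr0 mulr1 mul1r mul0r addr0; apply => t t01.
  by apply: rderiv_line; exact: fdf.
by rewrite cabsM ler_wpM2r ?cabs_ge0 ?dfM.
Qed.

End path_derivative.

(** * Goursat's theorem and Cauchy's estimate *)

Section path_integral.
Context (R : realType).
Implicit Types (g : R -> R[i]) (t a b M : R) (c : R[i]).

Definition rcont g := continuous (fun t => complex.Re (g t) : R^o) /\
  continuous (fun t => complex.Im (g t) : R^o).

Lemma rcont_rderiv g (dg : R -> R[i]) :
  (forall t, rderiv g t (dg t)) -> rcont g.
Proof.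
by move=> H; split=> t; [exact: fderiv_continuous (H t).1|
  exact: fderiv_continuous (H t).2].
Qed.

Lemma rcont_eps g : (forall t (e : R), 0 < e -> exists2 dl : R, 0 < dl &
    forall h : R, `|h| < dl -> cabs (g (t + h) - g t) < e) -> rcont g.
Proof.
move=> H; split=> t; apply/cvgrPdist_lt => e e0; have [dl dl0 dlP] := H t e e0;
    exists dl => // s /= ts; rewrite distrC.
  rewrite -cReB (le_lt_trans (Re_le_cabs _))// -[s](subrKC t).
  by apply: dlP; rewrite distrC.
rewrite -cImB (le_lt_trans (Im_le_cabs _))// -[s](subrKC t).
by apply: dlP; rewrite distrC.
Qed.

Lemma rcontD g g' : rcont g -> rcont g' -> rcont (fun t => g t + g' t).
Proof.
move=> [g1 g2] [h1 h2]; split => t.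
  rewrite (_ : (fun _ => _) = fun t => complex.Re (g t) + complex.Re (g' t)).
    by apply: continuousD; [exact: g1|exact: h1].
  by apply/funext => s; rewrite cReD.
rewrite (_ : (fun _ => _) = fun t => complex.Im (g t) + complex.Im (g' t)).
  by apply: continuousD; [exact: g2|exact: h2].
by apply/funext => s; rewrite cImD.
Qed.

Lemma rcontM g g' : rcont g -> rcont g' -> rcont (fun t => g t * g' t).
Proof.
move=> [g1 g2] [h1 h2]; split => t.
  rewrite (_ : (fun _ => _) = fun t => complex.Re (g t) * complex.Re (g' t) -
    complex.Im (g t) * complex.Im (g' t)).
    by apply: cvgB; apply: cvgM;
      [exact: g1|exact: h1|exact: g2|exact: h2].
  by apply/funext => s; rewrite cReM.
rewrite (_ : (fun _ => _) = fun t => complex.Re (g t) * complex.Im (g' t) +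
  complex.Im (g t) * complex.Re (g' t)).
  by apply: cvgD; apply: cvgM;
    [exact: g1|exact: h2|exact: g2|exact: h1].
by apply/funext => s; rewrite cImM.
Qed.

Lemma rcont_cst c : rcont (fun=> c).
Proof. by split=> t; exact: cst_continuous. Qed.

Lemma rcontZ c g : rcont g -> rcont (fun t => c * g t).
Proof. exact/rcontM/rcont_cst. Qed.

Lemma rcontB g g' : rcont g -> rcont g' -> rcont (fun t => g t - g' t).
Proof.
move=> hg hg'; have := rcontD hg (rcontZ (-1) hg').
by rewrite (_ : (fun _ => _ + _) = fun t => g t - g' t)//;
  apply/funext => t; rewrite mulN1r.
Qed.

Lemma continuous_primitive (G : R -> R) a : continuous (G : R -> R^o) ->
  exists P : R -> R, forall t, a <= t -> fderiv P t (G t).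
Proof.
(* Integration starts at [a - 1] so that [t = a] is an interior point for the fundamental
   theorem. *)
move=> cG; exists (fun x => \int[lebesgue_measure]_(t in `[a - 1, x]) G t).
move=> t at_; have tt : t < t + 1 by rewrite ltrDl.
have at1 : a - 1 < t by rewrite (lt_le_trans _ at_)// ltrBlDr ltrDl.
have [|//||d dE] := @continuous_FTC1_closed R G (a - 1) t (t + 1) tt.
- apply: continuous_compact_integrable; first exact: segment_compact.
  exact: continuous_subspaceT.
- exact: cG.
- by rewrite -dE derive1E; exact: derivableP.
Qed.

Lemma path_primitive g a : rcont g ->
  exists P : R -> R[i], forall t, a <= t -> rderiv P t (g t).
Proof.
move=> [g1 g2]; have [P HP] := continuous_primitive a g1.
have [Q HQ] := continuous_primitive a g2.
by exists (fun t => P t +i* Q t)%C => t at_; split; [exact: HP|exact: HQ].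
Qed.

(** The integral is the increment of a chosen primitive, with default 0 when there is none.
    Continuous paths have a primitive, and [pint_primitive] removes the dependence on the choice, so
    linearity and bounds are read off from primitives. *)
Definition pint a b g : R[i] :=
  if pselect (exists P : R -> R[i], forall t, a <= t -> rderiv P t (g t))
    is left ex then projT1 (cid ex) b - projT1 (cid ex) a else 0.

(** Two primitives differ by a path of zero derivative, which is constant by [rderiv_lip] with bound
    0. *)
Lemma pint_primitive g (P : R -> R[i]) a b : rcont g -> a <= b ->
  (forall t, a <= t <= b -> rderiv P t (g t)) -> pint a b g = P b - P a.
Proof.
move=> cg ab HP; rewrite /pint; case: pselect => [ex|]; last first.
  by move=> []; exact: path_primitive.
case: cid => Q /= HQ.
have := @rderiv_lip _ (fun t => Q t - P t) (fun t => g t - g t) 0 a b ab.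
rewrite mul0r => H; apply/eqP; rewrite -subr_eq0; apply/eqP/cabs_eq0/le_anti.
rewrite cabs_ge0 andbT (_ : Q b - Q a - _ = Q b - P b - (Q a - P a)); last by ring.
apply: H => t /[dup] tab /andP[at_ _]; last by rewrite subrr cabs0.
by apply: rderivB; [exact: HQ|exact: HP].
Qed.

Lemma pintD g g' a b : rcont g -> rcont g' -> a <= b ->
  pint a b (fun t => g t + g' t) = pint a b g + pint a b g'.
Proof.
move=> cg cg' ab; have [P HP] := path_primitive a cg.
have [Q HQ] := path_primitive a cg'.
have in_ab t : a <= t <= b -> a <= t by case/andP.
rewrite (@pint_primitive g P)// => [|t /in_ab/HP//].
rewrite (@pint_primitive g' Q)// => [|t /in_ab/HQ//].
rewrite (@pint_primitive _ (fun t => P t + Q t))//; first by ring.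
  exact: rcontD.
by move=> t /in_ab at_; apply: rderivD; [exact: HP|exact: HQ].
Qed.

Lemma pintZ c g a b : rcont g -> a <= b ->
  pint a b (fun t => c * g t) = c * pint a b g.
Proof.
move=> cg ab; have [P HP] := path_primitive a cg.
have in_ab t : a <= t <= b -> a <= t by case/andP.
rewrite (@pint_primitive g P)// => [|t /in_ab/HP//].
rewrite (@pint_primitive _ (fun t => c * P t))//; first by rewrite mulrBr.
  exact: rcontZ.
by move=> t /in_ab at_; apply: rderivZ; exact: HP.
Qed.

Lemma pintB g g' a b : rcont g -> rcont g' -> a <= b ->
  pint a b (fun t => g t - g' t) = pint a b g - pint a b g'.
Proof.
move=> cg cg' ab; rewrite -mulN1r -pintZ// -pintD//; last exact: rcontZ.
by congr pint; apply/funext => t; rewrite mulN1r.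
Qed.

Lemma pint_cst c a b : a <= b -> pint a b (fun=> c) = c * ((b - a)%:C)%C.
Proof.
move=> ab; rewrite (@pint_primitive _ (fun t => c * (t%:C)%C))//.
- by rewrite -mulrBr -rmorphB.
- exact: rcont_cst.
move=> t _; rewrite -{2}[c]mulr1; apply: rderivZ.
by split; [exact: fderiv_id|exact: fderiv_cst].
Qed.

Lemma pint_split g a b (c : R) : rcont g -> a <= b -> b <= c ->
  pint a c g = pint a b g + pint b c g.
Proof.
move=> cg ab bc; have [P HP] := path_primitive a cg.
rewrite !(@pint_primitive _ P)//; first by ring.
- by move=> t /andP[bt _]; apply: HP; exact: le_trans bt.
- by move=> t /andP[at_ _]; exact: HP.
- exact: le_trans bc.
- by move=> t /andP[at_ _]; exact: HP.
Qed.

Lemma pint_le g a b M : rcont g -> a <= b ->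
  (forall t, a <= t <= b -> cabs (g t) <= M) ->
  cabs (pint a b g) <= M * (b - a).
Proof.
move=> cg ab gM; have [P HP] := path_primitive a cg.
have in_ab t : a <= t <= b -> a <= t by case/andP.
rewrite (@pint_primitive g P)// => [|t /in_ab/HP//].
by apply: (@rderiv_lip _ _ g) => // t /in_ab/HP.
Qed.

End path_integral.

(** * Goursat's theorem on rectangles *)

Section goursat.
Context (R : realType).
Implicit Types (f g : R[i] -> R[i]) (x y w h M : R).

(** Counterclockwise contour integral over the rectangle with lower left corner [(x, y)]; the factor
    ['i] is [dz/ds] on the vertical sides. *)
Definition boundary_pint f x y w h : R[i] :=
  pint x (x + w) (fun s => f (s +i* y)%C) -
  pint x (x + w) (fun s => f (s +i* (y + h))%C) +
  'i%C * (pint y (y + h) (fun s => f ((x + w) +i* s)%C) -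
          pint y (y + h) (fun s => f (x +i* s)%C)).

Definition hderiv f (df : R[i] -> R[i]) := forall z, fderiv f z (df z).

Lemma rcont_horizontal f df y : hderiv f df -> rcont (fun s => f (s +i* y)%C).
Proof.
by move=> fdf; apply: rcont_rderiv => t; apply: rderiv_horizontal; exact: fdf.
Qed.

Lemma rcont_vertical f df x : hderiv f df -> rcont (fun s => f (x +i* s)%C).
Proof.
by move=> fdf; apply: rcont_rderiv => t; apply: rderiv_vertical; exact: fdf.
Qed.

Lemma boundary_pint_primitive f df A x y w h : hderiv f df -> hderiv A f ->
  0 <= w -> 0 <= h -> boundary_pint f x y w h = 0.
Proof.
move=> fdf Af w0 h0.
have H y' : pint x (x + w) (fun s => f (s +i* y')%C) =
    A ((x + w) +i* y')%C - A (x +i* y')%C.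
  rewrite (@pint_primitive _ _ (fun s => A (s +i* y')%C))//.
  - exact: rcont_horizontal fdf.
  - by rewrite lerDl.
  by move=> t _; exact: rderiv_horizontal.
have V x' : pint y (y + h) (fun s => f (x' +i* s)%C) =
    'i%C^-1 * (A (x' +i* (y + h))%C - A (x' +i* y)%C).
  rewrite mulrBr (@pint_primitive _ _ (fun s => 'i%C^-1 * A (x' +i* s)%C))//.
  - exact: rcont_vertical fdf.
  - by rewrite lerDl.
  move=> t _; apply: rderiv_eq (rderivZ _ (rderiv_vertical (Af _))) _.
  by rewrite mulrA mulVf ?mul1r// -cabs_gt0 cabsi.
rewrite /boundary_pint !H !V -mulrBr mulrA mulfV ?mul1r -?cabs_gt0 ?cabsi//.
by ring.
Qed.

Lemma boundary_pintB f df g dg x y w h : hderiv f df -> hderiv g dg ->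
  0 <= w -> 0 <= h ->
  boundary_pint (fun z => f z - g z) x y w h =
  boundary_pint f x y w h - boundary_pint g x y w h.
Proof.
move=> fdf gdg w0 h0; rewrite /boundary_pint.
have xw : x <= x + w by rewrite lerDl.
have yh : y <= y + h by rewrite lerDl.
rewrite !pintB//; try exact: (rcont_horizontal _ fdf);
  try exact: (rcont_horizontal _ gdg); try exact: (rcont_vertical _ fdf);
  try exact: (rcont_vertical _ gdg).
by ring.
Qed.

Lemma boundary_pint_le f df x y w h M : hderiv f df -> 0 <= w -> 0 <= h ->
  (forall s t, x <= s <= x + w -> y <= t <= y + h -> cabs (f (s +i* t)%C) <= M) ->
  cabs (boundary_pint f x y w h) <= 2 * M * (w + h).
Proof.
move=> fdf w0 h0 fM; rewrite /boundary_pint.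
have xw : x <= x + w by rewrite lerDl.
have yh : y <= y + h by rewrite lerDl.
have H y' : y <= y' <= y + h ->
    cabs (pint x (x + w) (fun s => f (s +i* y')%C)) <= M * w.
  move=> y'h; rewrite (_ : M * w = M * (x + w - x)); last by ring.
  apply: pint_le => //; first exact: rcont_horizontal fdf.
  by move=> t tx; exact: fM.
have V x' : x <= x' <= x + w ->
    cabs (pint y (y + h) (fun s => f (x' +i* s)%C)) <= M * h.
  move=> x'w; rewrite (_ : M * h = M * (y + h - y)); last by ring.
  apply: pint_le => //; first exact: rcont_vertical fdf.
  by move=> t tx; exact: fM.
rewrite (le_trans (cabsD _ _))// cabsM cabsi mul1r.
have := cabsB (pint x (x + w) (fun s => f (s +i* y)%C))
  (pint x (x + w) (fun s => f (s +i* (y + h))%C)).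
have := cabsB (pint y (y + h) (fun s => f ((x + w) +i* s)%C))
  (pint y (y + h) (fun s => f (x +i* s)%C)).
have := H y; have := H (y + h); have := V x; have := V (x + w).
by rewrite !lexx xw yh => /(_ isT) ? /(_ isT) ? /(_ isT) ? /(_ isT) ? ? ?; lra.
Qed.

(** Each inner side is run in opposite directions by two neighbouring quarters and cancels. *)
Lemma boundary_pint_split f df x y w h : hderiv f df -> 0 <= w -> 0 <= h ->
  boundary_pint f x y (w + w) (h + h) =
  boundary_pint f x y w h + boundary_pint f (x + w) y w h +
  boundary_pint f x (y + h) w h + boundary_pint f (x + w) (y + h) w h.
Proof.
move=> fdf w0 h0; rewrite /boundary_pint !addrA.
have H y' : pint x (x + w + w) (fun s => f (s +i* y')%C) =
    pint x (x + w) (fun s => f (s +i* y')%C) +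
    pint (x + w) (x + w + w) (fun s => f (s +i* y')%C).
  by apply: pint_split; rewrite ?lerDl//; exact: rcont_horizontal fdf.
have V x' : pint y (y + h + h) (fun s => f (x' +i* s)%C) =
    pint y (y + h) (fun s => f (x' +i* s)%C) +
    pint (y + h) (y + h + h) (fun s => f (x' +i* s)%C).
  by apply: pint_split; rewrite ?lerDl//; exact: rcont_vertical fdf.
by rewrite !H !V; ring.
Qed.

Lemma fderiv_affine (c d z : R[i]) : fderiv (fun v => c + d * v) z d.
Proof.
have := fderivD (fderiv_cst c z) (fderivZ d (fderiv_id z)).
by move/fderiv_eq; apply; rewrite add0r mulr1.
Qed.

Lemma fderiv_affine_primitive (c d z : R[i]) :
  fderiv (fun v => c * v + d / 2 * (v * v)) z (c + d * z).
Proof.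
have := fderivD (fderivZ c (fderiv_id z))
  (fderivZ (d / 2) (fderivM (fderiv_id z) (fderiv_id z))).
by move/fderiv_eq; apply; rewrite mulr1 mul1r mulr1; field.
Qed.

Lemma nested_intervals (a e : nat -> R) :
  (forall n, a n <= a n.+1) -> (forall n, a n.+1 + e n.+1 <= a n + e n) ->
  (forall n, 0 <= e n) -> exists s, forall n, a n <= s <= a n + e n.
Proof.
move=> a1 ae e0.
have an n m : (n <= m)%N -> a n <= a m.
  move=> /subnK <-; elim: (m - n)%N => // k IH.
  by rewrite addSn (le_trans IH).
have aen n m : (n <= m)%N -> a m + e m <= a n + e n.
  move=> /subnK <-; elim: (m - n)%N => // k IH.
  by rewrite addSn (le_trans _ IH).
have am n m : a n <= a m + e m.
  have [nm|/ltnW mn] := leqP n m.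
    by rewrite (le_trans (an _ _ nm))// lerDl.
  by rewrite (le_trans _ (aen _ _ mn))// lerDl.
exists (sup (range a)) => n; apply/andP; split.
  apply: ub_le_sup; last by exists n.
  by exists (a 0%N + e 0%N) => _ [k _ <-].
by apply: ge_sup; [exists (a 0%N); exists 0%N|move=> _ [k _ <-]].
Qed.

Section bisection.
Context (f df : R[i] -> R[i]) (w h c : R).
Hypotheses (fdf : hderiv f df) (w0 : 0 <= w) (h0 : 0 <= h) (c0 : 0 < c).

Let side a n : R := a / 2 ^+ n.

Let sideS a n : side a n = side a n.+1 + side a n.+1.
Proof. by rewrite /side exprS; field. Qed.

Let side_ge0 a n : 0 <= a -> 0 <= side a n.
Proof. by move=> a0; rewrite divr_ge0// exprn_ge0. Qed.

(** The threshold is quadratic in the side length, so it divides by 4 at each halving; as the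
    integral splits into four, at least one quarter of a bad rectangle is bad. *)
Let bad n (p : R * R) := c * side (w + h) n ^+ 2 <
  cabs (boundary_pint f p.1 p.2 (side w n) (side h n)).

Let next n (p q : R * R) :=
  [/\ p.1 <= q.1, q.1 + side w n.+1 <= p.1 + side w n,
      p.2 <= q.2 & q.2 + side h n.+1 <= p.2 + side h n].

Let bad_next n p : bad n p -> exists q, bad n.+1 q /\ next n p q.
Proof.
case: p => x y; rewrite /bad /= => bp; apply: contrapT => no.
have {}no q : next n (x, y) q -> cabs (boundary_pint f q.1 q.2
    (side w n.+1) (side h n.+1)) <= c * side (w + h) n.+1 ^+ 2.
  move=> nq; rewrite leNgt; apply/negP => bq; apply: no.
  by exists q; split.
have ws := side_ge0 n.+1 w0; have hs := side_ge0 n.+1 h0.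
move: bp; rewrite (sideS w n) (sideS h n) (boundary_pint_split _ _ fdf)//.
apply/negP; rewrite -leNgt.
have sE : c * side (w + h) n ^+ 2 = 4 * (c * side (w + h) n.+1 ^+ 2).
  by rewrite (sideS _ n); ring.
have wS := sideS w n; have hS := sideS h n.
have H1 : next n (x, y) (x, y) by split => /=; lra.
have H2 : next n (x, y) (x + side w n.+1, y) by split => /=; lra.
have H3 : next n (x, y) (x, y + side h n.+1) by split => /=; lra.
have H4 : next n (x, y) (x + side w n.+1, y + side h n.+1).
  by split => /=; lra.
move/no : H1 => /= H1; move/no : H2 => /= H2.
move/no : H3 => /= H3; move/no : H4 => /= H4.
rewrite sE (le_trans (cabsD _ _))//.
have := cabsD (boundary_pint f x y (side w n.+1) (side h n.+1))
  (boundary_pint f (x + side w n.+1) y (side w n.+1) (side h n.+1)).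
have := cabsD (boundary_pint f x y (side w n.+1) (side h n.+1) +
  boundary_pint f (x + side w n.+1) y (side w n.+1) (side h n.+1))
  (boundary_pint f x (y + side h n.+1) (side w n.+1) (side h n.+1)).
by lra.
Qed.

Lemma boundary_pint_bisection x y :
  cabs (boundary_pint f x y w h) <= c * (w + h) ^+ 2.
Proof.
rewrite leNgt; apply/negP => b0.
(* The default [p] is never taken along the sequence, because every rectangle in it is bad. *)
pose nx n p := if pselect (exists q, bad n.+1 q /\ next n p q) is left ex
  then projT1 (cid ex) else p.
pose fix P n := if n is m.+1 then nx m (P m) else (x, y).
have badP n : bad n (P n).
  elim: n => [|n IH]; first by rewrite /bad /side expr0 !divr1.
  rewrite /= /nx; case: pselect => [ex|]; last by case; exact: bad_next.
  by case: cid => q [].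
have nextP n : next n (P n) (P n.+1).
  rewrite /= /nx; case: pselect => [ex|]; last by case; exact: bad_next.
  by case: cid => q [].
have [s sP] : exists s, forall n, (P n).1 <= s <= (P n).1 + side w n.
  apply: nested_intervals => n; [by case: (nextP n)|by case: (nextP n)|].
  exact: side_ge0.
have [t tP] : exists t, forall n, (P n).2 <= t <= (P n).2 + side h n.
  apply: nested_intervals => n; [by case: (nextP n)|by case: (nextP n)|].
  exact: side_ge0.
pose z0 := (s +i* t)%C.
(* On a rectangle of half-perimeter [D] the remainder of [f] is at most [(c / 4) D], so its contour
   integral is at most [2 (c / 4) D D], below the threshold [c D^2]. *)
have c4 : 0 < c / 4 by rewrite divr_gt0.
have [dl dl0 dlP] := (cderivP f z0 (df z0)).1 (fdf z0) _ c4.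
have [n nP] : exists n, side (w + h) n < dl.
  have [N _ NP] : \forall n \near \oo, (w + h) / dl < n%:R.
    exact: nbhs_infty_gtr.
  exists N; rewrite /side ltr_pdivrMr ?exprn_gt0// mulrC -ltr_pdivrMr//.
  rewrite (lt_le_trans (NP N _))//= -natrX ler_nat ltnW//.
  exact: ltn_expl.
have := badP n; apply/negP; rewrite -leNgt.
pose L z := (f z0 - df z0 * z0) + df z0 * z.
have dL : hderiv L (fun=> df z0) by move=> z; exact: fderiv_affine.
have dA : hderiv (fun v => (f z0 - df z0 * z0) * v + df z0 / 2 * (v * v)) L.
  by move=> z; exact: fderiv_affine_primitive.
have ws := side_ge0 n w0; have hs := side_ge0 n h0.
(* The affine part [L] of [f] at the limit point has a primitive and integrates to 0, so only the
   first-order remainder counts. *)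
rewrite (_ : boundary_pint f _ _ _ _ =
  boundary_pint (fun z => f z - L z) (P n).1 (P n).2 (side w n) (side h n)); last first.
  rewrite (boundary_pintB _ _ fdf dL)//.
  by rewrite (boundary_pint_primitive _ _ dL dA)// subr0.
set D := side (w + h) n in nP *.
have DE : D = side w n + side h n by rewrite /D /side mulrDl.
have fL : hderiv (fun z => f z - L z) (fun z => df z - df z0).
  by move=> z; exact: fderivB.
apply: le_trans (@boundary_pint_le _ _ _ _ _ _ (c / 4 * D) fL ws hs _) _.
  move=> u v /andP[u1 u2] /andP[v1 v2].
  have /andP[s1 s2] := sP n; have /andP[t1 t2] := tP n.
  set z := (u +i* v)%C.
  have zD : cabs (z - z0) <= D.
    rewrite (le_trans (cabs_le_ReIm _))// DE.
    by rewrite lerD// /z /z0 ?cReB ?cImB /= ler_norml; lra.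
  have := dlP _ (le_lt_trans zD nP); rewrite subrKC.
  have -> : f z - f z0 - df z0 * (z - z0) = f z - L z by rewrite /L; ring.
  by move=> /le_trans; apply; rewrite ler_pM2l.
by rewrite -DE; nra.
Qed.

End bisection.

Lemma goursat f df x y w h : hderiv f df -> 0 <= w -> 0 <= h ->
  boundary_pint f x y w h = 0.
Proof.
move=> fdf w0 h0; apply: cabs_eq0; apply/le_anti.
rewrite cabs_ge0 andbT; apply/ler_addgt0Pl => e e0; rewrite addr0.
have p0 : 0 < (w + h) ^+ 2 + 1 by rewrite ltr_wpDl// sqr_ge0.
have := @boundary_pint_bisection f df w h _ fdf w0 h0 (divr_gt0 e0 p0) x y.
move=> /le_trans; apply; rewrite mulrAC ler_pdivrMr// ler_pM2l//.
by rewrite lerDl.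
Qed.

End goursat.

(** * The complex exponential *)

Section complex_exponential.
Context (R : realType).
Implicit Types (z w h : R[i]) (t : R).

Definition cexp z : R[i] :=
  ((expR (complex.Re z))%:C)%C * (cos (complex.Im z) +i* sin (complex.Im z))%C.

Lemma cexp0 : cexp 0 = 1.
Proof. by rewrite /cexp /= expR0 cos0 sin0 mul1r. Qed.

Lemma cexpD z w : cexp (z + w) = cexp z * cexp w.
Proof.
rewrite /cexp cReD cImD expRD cosD sinD rmorphM mulrACA; congr (_ * _).
by apply: complex_eq; rewrite ?cReM ?cImM/=; ring.
Qed.

Lemma cexpNM z : cexp (- z) * cexp z = 1.
Proof. by rewrite -cexpD addNr cexp0. Qed.

Lemma cabs_cexp z : cabs (cexp z) = expR (complex.Re z).
Proof.
rewrite /cexp cabsM cabs_real ger0_norm ?expR_ge0// /cabs /= cos2Dsin2.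
by rewrite sqrtr1 mulr1.
Qed.

Lemma cexp_vertical t (s : R) : cexp (s +i* (t + 2 * pi))%C = cexp (s +i* t)%C.
Proof. by rewrite /cexp /= mulr_natl cosD2pi sinD2pi. Qed.

(** The functional equation reduces the claim to the origin, where the real derivatives of [expR],
    [cos] and [sin] at 0 give it. *)
Lemma fderiv_cexp z : fderiv cexp z (cexp z).
Proof.
suff H : forall e : R, 0 < e -> exists2 dl : R, 0 < dl &
    forall h, cabs h < dl -> cabs (cexp h - 1 - h) <= e * cabs h.
  apply/cderivP => e e0.
  have c0 : 0 < cabs (cexp z) by rewrite cabs_cexp expR_gt0.
  have [dl dl0 dlP] := H _ (divr_gt0 e0 c0).
  exists dl => // h /dlP; rewrite cexpD.
  have -> : cexp z * cexp h - cexp z - cexp z * h = cexp z * (cexp h - 1 - h).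
    by ring.
  by rewrite cabsM mulrAC ler_pdivlMr// mulrC.
move=> e e0; have e8 : 0 < Num.min e 1 / 8.
  by rewrite divr_gt0// lt_min e0 ltr01.
(* The errors below add up to [4 a + 3 a] times [cabs h], within [8 a <= e]; the cap at 1 keeps
   [expR x] below 2. *)
set a := Num.min e 1 / 8 in e8.
have ae : a * 8 <= e by rewrite /a divfK// ge_min lexx.
have a1 : a * 8 <= 1 by rewrite /a divfK// ge_min lexx orbT.
have [l1 l10 H1] := (fderivP _ _ _).1 (is_derive_cos (0 : R)) _ e8.
have [l2 l20 H2] := (fderivP _ _ _).1 (is_derive_sin (0 : R)) _ e8.
have [l3 l30 H3] := (fderivP _ _ _).1 (is_derive_expR (0 : R)) _ e8.
exists (Num.min (Num.min l1 l2) (Num.min l3 a)); first by rewrite !lt_min l10 l20 l30.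
move=> h; rewrite !lt_min => /andP[/andP[h1 h2] /andP[h3 h4]].
have hx := Re_le_cabs h; have hy := Im_le_cabs h.
have := H1 _ (le_lt_trans hy h1); have := H2 _ (le_lt_trans hy h2).
have := H3 _ (le_lt_trans hx h3).
rewrite !add0r sin0 cos0 expR0 !oppr0 mul0r !addr0 !subr0 !mul1r.
set x := complex.Re h in hx *; set y := complex.Im h in hy *.
move=> E3 E2 E1.
have xa : `|expR x - 1| <= 2 * cabs h.
  rewrite -[X in `|X|](subrK x) (le_trans (ler_normD _ _))//.
  rewrite mulr_natl mulr2n lerD// (le_trans E3)//.
  by rewrite (le_trans _ hx)// ler_piMl//; lra.
have xe : expR x <= 2.
  by move: (ler_norm (expR x - 1)); lra.
have -> : cexp h - 1 - h = ((expR x)%:C)%C * ((cos y - 1) +i* (sin y - y))%C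
   + ((expR x - 1 - x) +i* (y * (expR x - 1)))%C.
  by apply: complex_eq; rewrite /cexp ?cReB ?cImB ?cReD ?cImD ?cReM ?cImM/=; ring.
rewrite (le_trans (cabsD _ _))// cabsM cabs_real ger0_norm ?expR_ge0//.
have q1 : cabs ((cos y - 1) +i* (sin y - y))%C <= 2 * a * cabs h.
  rewrite (le_trans (cabs_le_ReIm _))//= (le_trans (lerD E1 E2))//.
  by move: hy e8; nra.
have q2 : cabs ((expR x - 1 - x) +i* (y * (expR x - 1)))%C <= 3 * a * cabs h.
  rewrite (le_trans (cabs_le_ReIm _))//= normrM.
  have : `|y| * `|expR x - 1| <= 2 * a * cabs h.
    rewrite (le_trans (ler_pM _ _ hy xa))// ?normr_ge0//.
    by move: (cabs_ge0 h) h4; nra.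
  have : a * `|x| <= a * cabs h by rewrite ler_pM2l.
  by move: E3; lra.
have q3 : expR x * cabs ((cos y - 1) +i* (sin y - y))%C <= 2 * (2 * a * cabs h).
  by rewrite ler_pM ?expR_ge0 ?cabs_ge0.
by move: (cabs_ge0 h) ae; nra.
Qed.

End complex_exponential.

(** * Cauchy's formula and estimate for the derivative *)

Section cauchy.
Context (R : realType).
Implicit Types (f df : R[i] -> R[i]) (z w h : R[i]) (s t r M : R).

Lemma fderiv_cexpN z : fderiv (fun v => cexp (- v)) z (- cexp (- z)).
Proof.
have := fderiv_comp (fderiv_cexp (- z)) (fderivN (fderiv_id z)).
by move/fderiv_eq; apply; rewrite mulrN1.
Qed.

Lemma hderiv_cexpN : hderiv (fun v : R[i] => cexp (- v)) (fun z => - cexp (- z)).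
Proof. exact: fderiv_cexpN. Qed.

(** In the coordinate [v] with [u = z + e^v], the form [f(u) du / (u - z)^2] becomes
    [pull f z v dv]; a vertical segment of length [2 pi] covers a circle about [z] once. *)
Let pull f z v := f (z + cexp v) * cexp (- v).

Let hderiv_pull f df z : hderiv f df -> exists dg, hderiv (pull f z) dg.
Proof.
move=> fdf; eexists => v; rewrite /pull.
apply: fderivM; last exact: fderiv_cexpN.
apply: fderiv_comp; first exact: fdf.
by apply: fderivD; [exact: fderiv_cst|exact: fderiv_cexp].
Qed.

Let pi2_ge0 : 0 <= 2 * pi :> R.
Proof. by rewrite mulr_ge0// pi_ge0. Qed.

(** By periodicity the two horizontal sides of the rectangle cancel, so Goursat equates the two
    vertical ones: the circle integral does not depend on the radius. *)
Let pull_const f df z s t : hderiv f df -> s <= t ->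
  pint 0 (2 * pi) (fun th => pull f z (s +i* th)%C) =
  pint 0 (2 * pi) (fun th => pull f z (t +i* th)%C).
Proof.
move=> fdf st; have [dg gdg] := hderiv_pull z fdf.
have ts : 0 <= t - s by rewrite subr_ge0.
have := goursat s 0 gdg ts pi2_ge0; rewrite /boundary_pint subrKC.
have -> : pint s t (fun u => pull f z (u +i* (0 + 2 * pi))%C) =
    pint s t (fun u => pull f z (u +i* 0)%C).
  congr pint; apply/funext => u; rewrite /pull.
  have -> : - (u +i* (0 + 2 * pi))%C = ((- u) +i* (- (2 * pi)))%C :> R[i].
    by apply: complex_eq; rewrite ?cReN ?cImN/= ?add0r.
  rewrite -[cexp ((- u) +i* (- _))%C]cexp_vertical addNr cexp_vertical.
  by congr (_ * cexp _); apply: complex_eq; rewrite ?cReN ?cImN/= ?oppr0.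
rewrite subrr !add0r => /eqP; rewrite mulf_eq0 => /orP[/eqP i0|].
  by have := cabsi R; rewrite i0 cabs0 => /esym/eqP; rewrite oner_eq0.
by rewrite subr_eq0 => /eqP ->.
Qed.

(** On a tiny circle [pull f z v] is close to [f z e^(-v) + df z]. The first term integrates to 0
    over a period, the second to [2 pi] times [df z], and the radius does not matter. *)
Lemma cauchy_derivative f df z s : hderiv f df ->
  pint 0 (2 * pi) (fun th =>
    f (z + cexp (s +i* th)%C) * cexp (- (s +i* th)%C)) =
  df z * ((2 * pi)%:C)%C.
Proof.
move=> fdf; rewrite -[LHS]/(pint 0 (2 * pi) (fun th => pull f z (s +i* th)%C)).
apply/eqP; rewrite -subr_eq0; apply/eqP/cabs_eq0/le_anti.
rewrite cabs_ge0 andbT; apply/ler_addgt0Pl => e e0; rewrite addr0.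
have e1 : 0 < e / (2 * pi) by rewrite divr_gt0// mulr_gt0// pi_gt0.
have [dl dl0 dlP] := (cderivP _ _ _).1 (fdf z) _ e1.
(* The circle of radius [expR s0 <= dl / 2] lies where the first-order expansion of [f] at [z] is
   accurate, and [s0 <= s] allows comparison with the given circle. *)
pose s0 := Num.min s (ln (dl / 2)).
have s0s : s0 <= s by rewrite ge_min lexx.
have es0 : expR s0 < dl.
  rewrite (@le_lt_trans _ _ (dl / 2))//; last by rewrite ltr_pdivrMr// ltr_pMr// ltr1n.
  by rewrite -[leRHS]lnK ?posrE ?divr_gt0// ler_expR ge_min lexx orbT.
rewrite -(pull_const z fdf s0s).
have [dg gdg] := hderiv_pull z fdf.
have cg : rcont (fun th => pull f z (s0 +i* th)%C) := rcont_vertical s0 gdg.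
have ce : rcont (fun th => f z * cexp (- (s0 +i* th)%C)).
  by apply: rcontZ; exact: (rcont_vertical s0 hderiv_cexpN).
have E0 : pint 0 (2 * pi) (fun th => f z * cexp (- (s0 +i* th)%C)) = 0.
  rewrite (@pint_primitive _ _
      (fun th => f z * ('i%C * cexp (- (s0 +i* th)%C))))//; last first.
    move=> t _; apply: rderivZ.
    apply: rderiv_eq (rderivZ _ (rderiv_vertical (hderiv_cexpN _))) _.
    by rewrite mulrA -expr2 sqr_i mulN1r opprK.
  apply/eqP; rewrite subr_eq0; apply/eqP; congr (_ * (_ * _)).
  have -> : - (s0 +i* (2 * pi))%C = ((- s0) +i* (- (2 * pi)))%C :> R[i].
    by apply: complex_eq; rewrite ?cReN ?cImN/=.
  rewrite -cexp_vertical addNr.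
  by congr cexp; apply: complex_eq; rewrite ?cReN ?cImN/= ?oppr0.
rewrite -[pint _ _ _]subr0 -{1}E0 -pintB//.
have -> : df z * ((2 * pi)%:C)%C = pint 0 (2 * pi) (fun=> df z).
  by rewrite pint_cst// subr0.
rewrite -pintB//; [|exact: rcontB|exact: rcont_cst].
have -> : e = e / (2 * pi) * (2 * pi - 0).
  by rewrite subr0 divfK// gt_eqF// mulr_gt0// pi_gt0.
apply: pint_le => //.
  by apply: rcontB; [exact: rcontB|exact: rcont_cst].
move=> t _; set v := (s0 +i* t)%C; have cv : cabs (cexp v) < dl.
  by rewrite cabs_cexp.
have -> : pull f z v - f z * cexp (- v) - df z =
    (f (z + cexp v) - f z - df z * cexp v) * cexp (- v).
  by rewrite !mulrBl -mulrA [cexp v * _]mulrC cexpNM mulr1.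
have c0 : 0 < cabs (cexp v) by rewrite cabs_cexp expR_gt0.
have cN : cabs (cexp (- v)) = (cabs (cexp v))^-1.
  by rewrite !cabs_cexp cReN expRN.
by rewrite cabsM cN ler_pdivrMr// dlP.
Qed.

Lemma cauchy_estimate f df z r M : hderiv f df -> 0 < r ->
  (forall w, cabs (w - z) <= r -> cabs (f w) <= M) -> cabs (df z) <= M / r.
Proof.
move=> fdf r0 fM.
have p0 : 0 < 2 * pi :> R by rewrite mulr_gt0// pi_gt0.
rewrite -(ler_pM2r p0) -[X in _ * X <= _]gtr0_norm// -cabs_real -cabsM.
rewrite -(cauchy_derivative z (ln r) fdf).
have [dg gdg] := hderiv_pull z fdf.
have -> : M / r * (2 * pi) = M / r * (2 * pi - 0) by rewrite subr0.
apply: pint_le => //; first exact: (rcont_vertical (ln r) gdg).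
move=> t _; rewrite cabsM [cabs (cexp (- _))]cabs_cexp cReN /= expRN lnK//.
rewrite ler_pM2r ?invr_gt0//; apply: fM.
by rewrite addrC addKr cabs_cexp /= lnK.
Qed.

End cauchy.

(** * Entire functions *)

Section complex_topology.
Context (R : realType).
Implicit Types (f df : R[i] -> R[i]) (z w : R[i]) (r M : R).

Lemma nbhs_disc z (A : set (R[i])^o) :
  nbhs (z : (R[i])^o) A <->
  exists2 dl : R, 0 < dl & forall w, cabs (w - z) < dl -> A w.
Proof.
split=> [/nbhs_ballP[e /= e0 eA]|[dl dl0 dlA]].
- have eE : e = ((complex.Re e)%:C)%C.
    by case: e e0 {eA} => a b; rewrite ltcE /= => /andP[/eqP -> _].
  rewrite eE ltcR in e0; exists (complex.Re e) => // w wz; apply: eA.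
  by rewrite /ball /= normr_cabs eE ltcR cabsC.
- apply/nbhs_ballP; exists ((dl%:C)%C); first by rewrite /= ltcR.
  by move=> w; rewrite /ball /= normr_cabs ltcR cabsC => /dlA.
Qed.

(** The compact set is a square, an image of a product of segments; a superset of the disc is enough
    to transfer bounds. *)
Lemma disc_sub_compact r : exists2 A : set (R[i])^o, compact A &
  forall z, cabs z <= r -> A z.
Proof.
pose phi (p : R^o * R^o) : (R[i])^o := (p.1 +i* p.2)%C.
exists (phi @` (`[- r, r] `*` `[- r, r])).
  apply: continuous_compact; last by apply: compact_setX; exact: segment_compact.
  apply: continuous_subspaceT => -[x y] A /nbhs_disc[dl dl0 dlA].
  have d2 : 0 < dl / 2 by rewrite divr_gt0.
  exists ([set s | `|x - s| < dl / 2], [set s | `|y - s| < dl / 2]).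
    by split; [exists (dl / 2)|exists (dl / 2)].
  move=> [s t] [/= xs yt]; apply: dlA; rewrite (le_lt_trans (cabs_le_ReIm _))//.
  by rewrite cReB cImB /= [dl]splitr distrC [`|t - y|]distrC ltrD.
move=> z zr; exists (complex.Re z, complex.Im z); last by case: (z).
have hx := le_trans (Re_le_cabs z) zr; have hy := le_trans (Im_le_cabs z) zr.
by split; rewrite /= in_itv /= -ler_norml.
Qed.

Lemma compact_real_bound (A : set (R[i])^o) (u : R[i] -> R) : compact A ->
  (forall z e, 0 < e -> exists2 dl : R, 0 < dl &
    forall w, cabs (w - z) < dl -> `|u w - u z| < e) ->
  exists M, forall z, A z -> u z <= M.
Proof.
move=> cA cu.
have : compact ((u : (R[i])^o -> R^o) @` A).
  apply: continuous_compact => //; apply: continuous_subspaceT => z.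
  move=> B /nbhs_ballP[e /= e0 eB]; have [dl dl0 dlP] := cu z e e0.
  apply: ((nbhs_disc z (u @^-1` B)).2); exists dl => // w /dlP wz.
  by apply: eB; rewrite /ball /= distrC.
move=> /compact_bounded/pinfty_ex_gt0[M M0 MP]; exists M => z Az.
by rewrite (le_trans (ler_norm _))//; apply: MP; exists z.
Qed.

Lemma compact_cabs_bound (A : set (R[i])^o) : compact A ->
  exists2 r, 0 < r & forall z, A z -> cabs z <= r.
Proof.
move=> cA; have [|r rP] := compact_real_bound (u := @cabs R) cA.
  move=> z e e0; exists e => // w; apply: le_lt_trans.
  rewrite ler_norml; have := cabsD (w - z) z; have := cabsD (z - w) w.
  by rewrite !subrK [cabs (z - w)]cabsC; lra.
exists (`|r| + 1); first by rewrite ltr_wpDl.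
by move=> z /rP zr; rewrite (le_trans zr)// (le_trans (ler_norm _))// lerDl.
Qed.

(** [M] is any bound, not the supremum. All estimates and, through [entire_nbhsP], the topology of
    [H(C)] are expressed by this predicate. *)
Definition bounded_disc f r M := forall z, cabs z <= r -> cabs (f z) <= M.

Lemma bounded_discW f r M s N : s <= r -> M <= N ->
  bounded_disc f r M -> bounded_disc f s N.
Proof. by move=> sr MN fM z zs; rewrite (le_trans (fM _ _))// (le_trans zs). Qed.

Lemma hderiv_bounded_disc f df r : hderiv f df ->
  exists2 M, 0 <= M & bounded_disc f r M.
Proof.
move=> fdf; have [A cA rA] := disc_sub_compact r.
have [z e e0|M MP] := compact_real_bound (u := fun z => cabs (f z)) cA.
  have [dl dl0 dlP] := fderiv_cont (fdf z) (e := (e%:C)%C) ltac:(by rewrite ltcR).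
  have dE : dl = ((complex.Re dl)%:C)%C.
    by case: dl dl0 {dlP} => a b; rewrite ltcE /= => /andP[/eqP -> _].
  rewrite dE ltcR in dl0; exists (complex.Re dl) => // w wz.
  have := dlP (w - z); rewrite {1}dE !normr_cabs !ltcR subrKC => /(_ wz).
  apply: le_lt_trans.
  rewrite ler_norml; have := cabsD (f w - f z) (f z).
  have := cabsD (f z - f w) (f w).
  by rewrite !subrK [cabs (f z - f w)]cabsC; lra.
exists `|M| => // z zr; rewrite (le_trans (MP _ _))//; first exact: rA.
exact: ler_norm.
Qed.

Lemma cauchy_disc f df r d M : hderiv f df -> 0 < d ->
  bounded_disc f (r + d) M -> bounded_disc df r (M / d).
Proof.
move=> fdf d0 fM z zr; apply: (cauchy_estimate fdf d0) => w wz.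
by apply: fM; rewrite -[w](subrK z) addrC (le_trans (cabsD _ _))// lerD.
Qed.

Lemma hderivB f df g dg : hderiv f df -> hderiv g dg ->
  hderiv (fun z => f z - g z) (fun z => df z - dg z).
Proof. by move=> fdf gdg z; exact: fderivB. Qed.

Lemma hderiv_shift f df c : hderiv f df ->
  hderiv (fun z => f (z + c)) (fun z => df (z + c)).
Proof.
move=> fdf z; have := fderiv_comp (g := fun v => v + c) (fdf (z + c))
  (fderivD (fderiv_id z) (fderiv_cst c z)).
by move/fderiv_eq; apply; rewrite addr0 mulr1.
Qed.

Lemma cabs_segment z h t r : 0 <= t <= 1 -> cabs z <= r ->
  cabs (z + (t%:C)%C * h) <= r + cabs h.
Proof.
move=> /andP[t0 t1] zr; rewrite (le_trans (cabsD _ _))// lerD//.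
by rewrite cabsM cabs_real ger0_norm// ler_piMl// cabs_ge0.
Qed.

Section second_order.
Context f df r M.
Hypotheses (fdf : hderiv f df) (M0 : 0 <= M) (fM : bounded_disc f (r + 3) M).

Let dfM : bounded_disc df (r + 2) M.
Proof.
rewrite -[M]divr1; apply: (cauchy_disc fdf ltr01).
by apply: bounded_discW fM => //; lra.
Qed.

Let f_lip z h : cabs z <= r + 1 -> cabs h <= 1 ->
  cabs (f (z + h) - f z) <= M * cabs h.
Proof.
move=> zr h1; apply: (@fderiv_lip _ _ df) => [t _|t t01]; first exact: fdf.
by apply: dfM; rewrite (le_trans (cabs_segment h t01 zr))//; lra.
Qed.

(** Cauchy's estimate is applied to the increment [f (z + h) - f z], whose derivative is the
    increment of [df]; differentiability of [df] is not presupposed. *)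
Lemma df_lip z h : cabs z <= r -> cabs h <= 1 ->
  cabs (df (z + h) - df z) <= M * cabs h.
Proof.
move=> zr h1; rewrite -[_ * _]divr1.
apply: (cauchy_disc (hderivB (hderiv_shift h fdf) fdf) ltr01 (r := r)) => //.
by move=> w wr; exact: f_lip.
Qed.

(** The mean value inequality for [f v - df z * v], whose derivative [df v - df z] is controlled by
    [df_lip]. *)
Lemma taylor1 z h : cabs z <= r -> cabs h <= 1 ->
  cabs (f (z + h) - f z - df z * h) <= M * cabs h ^+ 2.
Proof.
move=> zr h1.
have g' t : fderiv (fun v => f v - df z * v) t (df t - df z).
  apply: fderivB; first exact: fdf.
  by rewrite -[X in fderiv _ _ X]mulr1; exact/fderivZ/fderiv_id.
have -> : f (z + h) - f z - df z * h =
    (f (z + h) - df z * (z + h)) - (f z - df z * z) by ring.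
rewrite expr2 mulrA; apply: (@fderiv_lip _ (fun v => f v - df z * v)
  (fun v => df v - df z)) => [t _|t /andP[t0 t1]]; first exact: g'.
have th : cabs ((t%:C)%C * h) <= cabs h.
  by rewrite cabsM cabs_real ger0_norm// ler_piMl// cabs_ge0.
by rewrite (le_trans (df_lip zr _)) ?ler_wpM2l// (le_trans th).
Qed.

End second_order.

(** Cauchy's formula for the increment of [f] writes the difference quotient of [df] as an integral
    of difference quotients of [f] on the unit circle; [taylor1] bounds their error uniformly
    there. *)
Lemma hderiv_hderiv f df : hderiv f df -> exists ddf, hderiv df ddf.
Proof.
move=> fdf.
suff H z : exists d, fderiv df z d.
  by exists (fun z => projT1 (cid (H z))) => z; case: cid.
have [M M0 fM] := hderiv_bounded_disc (cabs z + 1 + 3) fdf.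
have p0 : 0 < 2 * pi :> R by rewrite mulr_gt0// pi_gt0.
have ce : rcont (fun t => cexp (- (0 +i* t)%C) : R[i]).
  exact: (@rcont_vertical R (fun v => cexp (- v)) _ 0 (@hderiv_cexpN R)).
(* Continuity of [df] on the circle is drawn from its Lipschitz bound, since its differentiability
   is the goal. *)
have cg : rcont (fun t => df (z + cexp (0 +i* t)%C)).
  apply: rcont_eps => t e e0.
  have Me : 0 < e / (M + 1) by rewrite divr_gt0// ltr_wpDl.
  have := rderiv_vertical (fderiv_cexp (0 +i* t)%C : fderiv (@cexp R) _ _).
  have m0 : 0 < Num.min 1 (e / (M + 1)) by rewrite lt_min ltr01.
  move=> [/fderiv_cont H1 /fderiv_cont H2].
  have [d1 d10 {}H1] := H1 _ (divr_gt0 m0 (ltr0n _ 2)).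
  have [d2 d20 {}H2] := H2 _ (divr_gt0 m0 (ltr0n _ 2)).
  exists (Num.min d1 d2); first by rewrite lt_min d10.
  move=> h; rewrite lt_min => /andP[/H1 {}H1 /H2 {}H2].
  set w := cexp (0 +i* t)%C; set v := cexp (0 +i* (t + h))%C.
  have vw : cabs (v - w) < Num.min 1 (e / (M + 1)).
    rewrite (le_lt_trans (cabs_le_ReIm _))// cReB cImB.
    by rewrite [ltRHS]splitr ltrD.
  move: vw; rewrite lt_min => /andP[vw1 vw2].
  have -> : z + v = (z + w) + (v - w) by ring.
  have zw : cabs (z + w) <= cabs z + 1.
    by rewrite (le_trans (cabsD _ _))// lerD2l cabs_cexp /= expR0.
  apply: (le_lt_trans (df_lip fdf fM zw (ltW vw1))).
  rewrite (@le_lt_trans _ _ ((M + 1) * cabs (v - w)))//.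
    by rewrite ler_wpM2r ?cabs_ge0// lerDl.
  by rewrite mulrC -ltr_pdivlMr// ltr_wpDl.
(* The candidate is Cauchy's formula applied formally to [df], on the circle of radius 1. *)
exists (pint 0 (2 * pi)
   (fun t => df (z + cexp (0 +i* t)%C) * cexp (- (0 +i* t)%C)) / ((2 * pi)%:C)%C).
apply/cderivP => e e0.
have Me : 0 < e / (M + 1) by rewrite divr_gt0// ltr_wpDl.
exists (Num.min 1 (e / (M + 1))); first by rewrite lt_min ltr01.
move=> h; rewrite lt_min => /andP[h1 hM].
set D := pint _ _ _.
have F := hderivB (hderiv_shift h fdf) fdf.
have cF : rcont (fun t => (f (z + cexp (0 +i* t)%C + h) - f (z + cexp (0 +i* t)%C)) *
   cexp (- (0 +i* t)%C)).
  apply: rcontM ce; have [dg gdg] : exists dg,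
     hderiv (fun v => f (z + cexp v + h) - f (z + cexp v)) dg.
    eexists => v; apply: (fderiv_comp (g := fun v => z + cexp v) (F _)).
    by apply: fderivD; [exact: fderiv_cst|exact: fderiv_cexp].
  exact: (rcont_vertical 0 gdg).
have cD := rcontM cg ce.
have pC : ((2 * pi)%:C)%C != 0 :> R[i].
  by rewrite -cabs_gt0 cabs_real gtr0_norm.
have E : (df (z + h) - df z - D / ((2 * pi)%:C)%C * h) * ((2 * pi)%:C)%C =
  pint 0 (2 * pi) (fun t =>
   (f (z + cexp (0 +i* t)%C + h) - f (z + cexp (0 +i* t)%C)) *
   cexp (- (0 +i* t)%C) - h * (df (z + cexp (0 +i* t)%C) * cexp (- (0 +i* t)%C))).
  rewrite pintB//; [|exact: rcontZ|exact: ltW].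
  rewrite pintZ//; last exact: ltW.
  rewrite (cauchy_derivative z 0 F) mulrBl; congr (_ - _).
  by rewrite mulrAC divfK// mulrC.
have : cabs ((df (z + h) - df z - D / ((2 * pi)%:C)%C * h) * ((2 * pi)%:C)%C) <=
    M * cabs h ^+ 2 * (2 * pi - 0).
  rewrite E; apply: pint_le; [|exact: ltW|].
    by apply: rcontB cF _; exact: rcontZ.
  move=> t _; set w := z + cexp _; set u := cexp _.
  have -> : (f (w + h) - f w) * u - h * (df w * u) =
      (f (w + h) - f w - df w * h) * u by ring.
  rewrite cabsM [cabs u]cabs_cexp cReN /= oppr0 expR0 mulr1.
  apply: (taylor1 fdf M0 fM); last exact: ltW.
  by rewrite (le_trans (cabsD _ _))// lerD2l cabs_cexp /= expR0.
rewrite subr0 cabsM cabs_real (gtr0_norm p0) ler_pM2r//.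
move=> /le_trans; apply; rewrite expr2 mulrA ler_wpM2r ?cabs_ge0//.
rewrite (@le_trans _ _ ((M + 1) * cabs h))//.
  by rewrite ler_wpM2r ?cabs_ge0// lerDl.
by rewrite mulrC -ler_pdivlMr ?ltW// ltr_wpDl.
Qed.

End complex_topology.

(** * Higher derivatives and polynomial approximation *)

Section taylor.
Context (R : realType).
Implicit Types (f df : R[i] -> R[i]) (F : nat -> R[i] -> R[i]) (z : R[i]).
Implicit Types (r d M : R).

Definition derivatives F := forall n, hderiv (F n) (F n.+1).

Lemma ex_derivatives f df : hderiv f df ->
  exists2 F, derivatives F & F 0%N = f.
Proof.
move=> fdf.
pose S := {f : R[i] -> R[i] | exists df, hderiv f df}.
have nxt (g : S) : exists g' : S, hderiv (sval g) (sval g').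
  case: g => g /= [dg gdg]; have [ddg dgddg] := hderiv_hderiv gdg.
  by exists (exist _ dg (ex_intro _ ddg dgddg)).
pose next (g : S) := projT1 (cid (nxt g)).
have nextP g : hderiv (sval g) (sval (next g)).
  exact: projT2 (cid (nxt g)).
pose P n := iter n next (exist _ f (ex_intro _ df fdf) : S).
by exists (fun n => sval (P n)) => // n; exact: nextP.
Qed.

Lemma derivativesS F : derivatives F -> derivatives (F \o S).
Proof. by move=> dF n; exact: dF. Qed.

(** Each of the [n] Cauchy estimates costs a margin [d] and a factor [d^-1]. There is no [n!] here;
    the choice of [d] as a multiple of [1 / n] makes up for it. *)
Lemma cauchy_iter F r d M n : derivatives F -> 0 < d ->
  bounded_disc (F 0%N) (r + n%:R * d) M -> bounded_disc (F n) r (M / d ^+ n).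
Proof.
move=> dF d0; elim: n r => [|n IH] r H.
  by rewrite expr0 divr1; move: H; rewrite mul0r addr0.
rewrite exprSr invfM mulrA; apply: (cauchy_disc (dF n) d0); apply: IH.
by have -> : r + d + n%:R * d = r + n.+1%:R * d by rewrite -natr1; ring.
Qed.

Lemma fderivX (K : numFieldType) (z : K) n : fderiv (fun v => v ^+ n) z (n%:R * z ^+ n.-1).
Proof.
elim: n => [|n IH]; first by rewrite mul0r; exact: fderiv_cst.
have := fderivM (fderiv_id z) IH.
rewrite (_ : (fun w => id w * w ^+ n) = fun w => w ^+ n.+1); last first.
  by apply/funext => w; rewrite exprS.
move/fderiv_eq; apply; rewrite mul1r /= -natr1 mulrDl mul1r addrC.
by case: n {IH} => [|n]; rewrite ?mul0r ?mulr0// mulrCA -exprS.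
Qed.

Lemma fderiv_sum (I : Type) (s : seq I) (f df : I -> R[i] -> R[i]) z :
  (forall i, fderiv (f i) z (df i z)) ->
  fderiv (fun v => \sum_(i <- s) f i v) z (\sum_(i <- s) df i z).
Proof.
move=> fdf; elim: s => [|i s IH].
  rewrite big_nil (_ : (fun _ => _) = fun=> 0); first exact: fderiv_cst.
  by apply/funext => v; rewrite big_nil.
rewrite big_cons (_ : (fun _ => _) = fun v => f i v + \sum_(j <- s) f j v).
  exact: fderivD.
by apply/funext => v; rewrite big_cons.
Qed.

Definition taylor_poly F n z := \sum_(0 <= k < n) F k 0 / k`!%:R * z ^+ k.

Lemma taylor_poly_deriv F n z :
  fderiv (taylor_poly F n.+1) z (taylor_poly (F \o S) n z).
Proof.
have -> : taylor_poly F n.+1 =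
    fun v => F 0%N 0 + \sum_(0 <= k < n) F k.+1 0 / k.+1`!%:R * v ^+ k.+1.
  apply/funext => v; rewrite /taylor_poly big_nat_recl//.
  by rewrite fact0 divr1 expr0 mulr1.
rewrite -[taylor_poly _ _ _]add0r; apply: fderivD; first exact: fderiv_cst.
rewrite /taylor_poly.
apply: (@fderiv_sum _ _ (fun k v => F k.+1 0 / k.+1`!%:R * v ^+ k.+1)
  (fun k v => (F \o S) k 0 / k`!%:R * v ^+ k)) => k.
apply: fderiv_eq (fderivZ _ (fderivX _ _)) _.
rewrite /= factS natrM; have k0 : k`!%:R != 0 :> R[i].
  by rewrite pnatr_eq0 -lt0n fact_gt0.
have k1 : k.+1%:R != 0 :> R[i] by rewrite pnatr_eq0.
by move: k0 k1; move: (k`!%:R) (k.+1%:R) => a c a0 c0; field; rewrite a0 c0.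
Qed.

(** Induction on the order along the segment from 0 to [z]: the derivative of the remainder of [F 0]
    is the remainder of [F 1] of order one less. *)
Lemma taylor_bound F n r M : derivatives F -> 0 <= M ->
  bounded_disc (F n) r M -> forall z, cabs z <= r ->
  cabs (F 0%N z - taylor_poly F n z) <= M * cabs z ^+ n / n`!%:R.
Proof.
move=> dF M0; elim: n F dF => [|n IH] F dF FM z zr.
  rewrite /taylor_poly big_geq// subr0 expr0 mulr1 fact0 divr1.
  exact: FM.
pose rem v := F 0%N v - taylor_poly F n.+1 v.
pose drem v := F 1%N v - taylor_poly (F \o S) n v.
have rem0 : rem 0 = 0.
  rewrite /rem /taylor_poly big_nat_recl// big1 ?addr0.
    by rewrite fact0 divr1 expr0 mulr1 subrr.
  by move=> i _; rewrite expr0n mulr0.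
have dP t : fderiv rem t (drem t).
  by apply: fderivB; [exact: dF|exact: taylor_poly_deriv].
have := @rderiv_mvt _ (fun t => rem (0 + (t%:C)%C * z))
  (fun t => drem (0 + (t%:C)%C * z) * z)
  (fun t => M * cabs z ^+ n.+1 / n.+1`!%:R * t ^+ n.+1)
  (fun t => M * cabs z ^+ n.+1 / n.+1`!%:R * (n.+1%:R * t ^+ n)) 0 1 ler01.
rewrite mul0r !add0r mul1r rem0 subr0 expr1n mulr1 expr0n /= mulr0 subr0.
apply=> t t01.
- by apply: rderiv_line; exact: dP.
- by apply: fderivZ; exact: fderivX.
- have tz : cabs ((t%:C)%C * z) = t * cabs z.
    by rewrite cabsM cabs_real ger0_norm//; case/andP: t01.
  have := IH _ (derivativesS dF) FM ((t%:C)%C * z); rewrite tz.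
  case/andP: t01 => t0 t1.
  move=> /(_ (le_trans (ler_piMl (cabs_ge0 _) t1) zr)) H.
  rewrite add0r cabsM (le_trans (ler_wpM2r (cabs_ge0 _) H))//.
  rewrite factS natrM exprMn exprS le_eqVlt; apply/orP; left; apply/eqP.
  have k0 : n`!%:R != 0 :> R by rewrite pnatr_eq0 -lt0n fact_gt0.
  have k1 : n.+1%:R != 0 :> R by rewrite pnatr_eq0.
  by move: k0 k1; move: (n`!%:R) (n.+1%:R) => a c a0 c0; field; rewrite a0 c0.
Qed.

(** The left side is a single term of the exponential series at [n]. *)
Lemma expn_le_fact n : n%:R ^+ n / n`!%:R <= expR 1 ^+ n :> R.
Proof.
case: n => [|n]; first by rewrite !expr0 fact0 divr1.
rewrite -expRM_natl mulr1 -[leLHS]add0r (le_trans _ (expR_ge1Dxn n _))//.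
by rewrite lerD2r.
Qed.

Lemma entire_poly_approx f df r e : hderiv f df -> 0 < e ->
  exists n (a : nat -> R[i]), forall z, cabs z <= r ->
    cabs (f z - \sum_(0 <= k < n) a k * z ^+ k) <= e.
Proof.
move=> fdf e0; wlog r0 : r / 0 < r.
  move=> H; have [|n [a aP]] := H (Num.max r 1); first by rewrite lt_max ltr01 orbT.
  by exists n, a => z zr; apply: aP; rewrite le_max zr.
have [F dF F0] := ex_derivatives fdf.
(* With steps [d / n] the remainder is at most [M (r / d)^n n^n / n!], and [n^n / n! <= e^n] brings
   this down to [M 2^-n]. *)
pose d : R := 2 * expR 1 * r.
have d0 : 0 < d by rewrite !mulr_gt0// expR_gt0.
have [M M0 fM] := hderiv_bounded_disc (r + d) fdf.
have [N _ NP] : \forall n \near \oo, M / e < n%:R by exact: nbhs_infty_gtr.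
pose n := N.+1; have n0 : 0 < n%:R :> R by rewrite ltr0n.
exists n, (fun k => F k 0 / k`!%:R) => z zr; rewrite -F0.
have FnM : bounded_disc (F n) r (M / (d / n%:R) ^+ n).
  apply: (cauchy_iter dF); first by rewrite divr_gt0.
  by rewrite F0 mulrC divfK// gt_eqF.
have Mn0 : 0 <= M / (d / n%:R) ^+ n by rewrite divr_ge0// exprn_ge0// divr_ge0// ltW.
apply: (le_trans (taylor_bound dF Mn0 FnM zr)).
have zn : cabs z ^+ n <= r ^+ n by rewrite lerXn2r ?nnegrE ?cabs_ge0// ltW.
have n1 : 0 < n`!%:R :> R by rewrite ltr0n fact_gt0.
rewrite (@le_trans _ _ (M / (d / n%:R) ^+ n * r ^+ n / n`!%:R))//.
  by rewrite ler_wpM2r ?invr_ge0 ?(ltW n1)// ler_wpM2l.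
have -> : M / (d / n%:R) ^+ n * r ^+ n / n`!%:R =
    M / (2 * expR 1) ^+ n * (n%:R ^+ n / n`!%:R).
  rewrite /d expr_div_n !exprMn.
  have : (expR 1 : R) ^+ n != 0 by rewrite expf_neq0// gt_eqF// expR_gt0.
  have : r ^+ n != 0 by rewrite expf_neq0// gt_eqF.
  have : (n%:R : R) ^+ n != 0 by rewrite expf_neq0// gt_eqF.
  have : (2 : R) ^+ n != 0 by rewrite expf_neq0.
  have : n`!%:R != 0 :> R by rewrite gt_eqF.
  move: (n`!%:R) ((2 : R) ^+ n) ((n%:R : R) ^+ n) (r ^+ n) (expR 1 ^+ n).
  move=> a1 a2 a3 a4 a5 h1 h2 h3 h4 h5.
  by field; rewrite h1 h2 h3 h4 h5.
have e1 : 0 < expR 1 :> R := expR_gt0 1.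
rewrite (@le_trans _ _ (M / (2 * expR 1) ^+ n * expR 1 ^+ n))//.
  apply: ler_wpM2l (expn_le_fact n).
  by apply: divr_ge0 M0 _; apply/exprn_ge0/mulr_ge0 => //; exact: ltW.
rewrite exprMn invfM mulrA divfK ?expf_neq0 ?gt_eqF// ler_pdivrMr ?exprn_gt0//.
rewrite mulrC -ler_pdivrMr// ltW// (lt_le_trans (NP N _))//= -natrX ler_nat.
by rewrite ltnW// /n expnS (leq_trans (ltn_expl N (ltnSn 1)))// leq_pmull.
Qed.

End taylor.

(** * Neighbourhoods and geometric series in the space of entire functions *)

Section entire_complex.
Context (R : realType).
Notation E := (entire R[i]).
Implicit Types (f g : E) (z w : R[i]) (r M C q e : R).

Lemma entire_hderiv f : hderiv f (((f : (R[i])^o -> (R[i])^o)^`())%classic).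
Proof. by move=> z; apply: derivable_fderiv; exact: (set_mem (entireP f)). Qed.

Lemma hderiv_entire (f df : R[i] -> R[i]) : hderiv f df ->
  exists g : E, forall z, g z = f z.
Proof.
move=> fdf; have fE : (f : (R[i])^o -> (R[i])^o) \in @entire_fun R[i].
  by apply: fderiv_mem_entire => z; exists (df z).
by exists (Entire fE).
Qed.

Lemma entire_eq f g : (forall z, f z = g z) -> f = g.
Proof. by move=> fg; apply/val_inj/funext. Qed.

Lemma entire_addE f g z : (f + g) z = f z + g z. Proof. by []. Qed.

Lemma entire_oppE f z : (- f) z = - f z. Proof. by []. Qed.

Lemma entire_subE f g z : (f - g) z = f z - g z. Proof. by []. Qed.

Lemma entire_scaleE (a : R[i]) f z : (a *: f) z = a * f z. Proof. by []. Qed.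

Lemma entire_zeroE z : (0 : E) z = 0. Proof. by []. Qed.

Lemma entire_sumE (I : Type) (s : seq I) (P : pred I) (F : I -> E) z :
  (\sum_(i <- s | P i) F i) z = \sum_(i <- s | P i) F i z.
Proof. by elim/big_rec2 : _ => // i y1 y2 _ <-. Qed.

Lemma bounded_discD f g r M C : bounded_disc f r M -> bounded_disc g r C ->
  bounded_disc (f + g) r (M + C).
Proof.
by move=> fM gC z zr; rewrite entire_addE (le_trans (cabsD _ _))// lerD// ?fM ?gC.
Qed.

Lemma bounded_discN f r M : bounded_disc f r M -> bounded_disc (- f) r M.
Proof. by move=> fM z zr; rewrite entire_oppE cabsN fM. Qed.

Lemma bounded_discB f g r M C : bounded_disc f r M -> bounded_disc g r C ->
  bounded_disc (f - g) r (M + C).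
Proof. by move=> fM gC; apply: bounded_discD => //; exact: bounded_discN. Qed.

Lemma bounded_discZ (a : R[i]) f r M : bounded_disc f r M ->
  bounded_disc (a *: f) r (cabs a * M).
Proof.
by move=> fM z zr; rewrite entire_scaleE cabsM ler_wpM2l ?cabs_ge0 ?fM.
Qed.

Lemma bounded_disc_sum (I : Type) (s : seq I) (F : I -> E) r (M : I -> R) :
  (forall i, bounded_disc (F i) r (M i)) ->
  bounded_disc (\sum_(i <- s) F i) r (\sum_(i <- s) M i).
Proof.
move=> FM z zr; rewrite entire_sumE (le_trans (cabs_sum _ _ _))//.
by apply: ler_sum => i _; exact: FM.
Qed.

Lemma entire_bounded f r : exists2 M, 0 <= M & bounded_disc f r M.
Proof. exact: hderiv_bounded_disc (entire_hderiv f). Qed.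

Lemma entire_nbhsP f (U : set E) : nbhs f U <->
  exists r, exists2 e, 0 < e & forall g, bounded_disc (f - g) r e -> U g.
Proof.
split; last first.
- move=> [r [e e0 eU]]; have [A cA rA] := disc_sub_compact r.
  have ce : 0 < ((e%:C)%C : R[i]) by rewrite ltcR.
  apply: filterS (entire_nbhs f cA ce) => g fg; apply: eU => z /rA Az.
  by have := fg z Az; rewrite normr_cabs ltcR => /ltW.
(* The sets containing a disc neighbourhood form a filter; the identity converges to [f] along it by
   [entire_cvg], so it contains every neighbourhood of [f]. *)
pose F : set_system E := fun V =>
  exists r, exists2 e, 0 < e & forall g, bounded_disc (f - g) r e -> V g.
have FF : Filter F.
  split.
  - by exists 0, 1.
  - move=> P Q [r [e e0 eP]] [s [d d0 dQ]]; exists (Num.max r s).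
    exists (Num.min e d); first by rewrite lt_min e0.
    move=> g fg; split; [apply: eP|apply: dQ]; move: fg; apply: bounded_discW.
    + by rewrite le_max lexx.
    + by rewrite ge_min lexx.
    + by rewrite le_max lexx orbT.
    + by rewrite ge_min lexx orbT.
  - by move=> P Q PQ [r [e e0 eP]]; exists r, e => // g /eP /PQ.
have : (id : E -> E) @ F --> f.
  apply: entire_cvg => A e cA e0.
  have eE : e = ((complex.Re e)%:C)%C.
    by case: e e0 => a b; rewrite ltcE /= => /andP[/eqP -> _].
  rewrite eE ltcR in e0; have [r r0 Ar] := compact_cabs_bound cA.
  exists r, (complex.Re e / 2); first by rewrite divr_gt0.
  move=> g fg z /Ar zr; rewrite eE normr_cabs ltcR.
  rewrite (le_lt_trans (fg z zr))// ltr_pdivrMr// ltr_pMr// ltr1n//.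
by move=> /(_ U) H /H.
Qed.

Lemma ge0_expr_lt (C q e : R) : 0 <= q < 1 -> 0 < e ->
  exists n : nat, C * q ^+ n <= e.
Proof.
move=> /andP[q0 q1] e0.
have : (C * q ^+ n) @[n --> \oo] --> (C * 0 : R^o).
  by apply: cvgMr; apply: cvg_expr; rewrite ger0_norm.
rewrite mulr0 => /cvgr_dist_le/(_ e e0)[N _ NP]; exists N.
by have := NP N (leqnn N); rewrite /= sub0r normrN => /(le_trans (ler_norm _)).
Qed.

(** The sum is a common point of the nested intervals centred at the partial sums whose half-length
    is the tail of the majorant. *)
Lemma geometric_series_real (a : nat -> R) C q : 0 <= q < 1 ->
  (forall n, `|a n| <= C * q ^+ n) -> exists s, forall n,
  `|s - \sum_(0 <= k < n) a k| <= C * q ^+ n / (1 - q).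
Proof.
move=> /andP[q0 q1] aC; have q1' : 0 < 1 - q by rewrite subr_gt0.
pose t n := C * q ^+ n / (1 - q).
have tS n : t n = t n.+1 + C * q ^+ n.
  by rewrite /t exprS; field; rewrite gt_eqF.
have C0 : 0 <= C by have := aC 0%N; rewrite expr0 mulr1; apply: le_trans.
have t0 n : 0 <= t n by rewrite divr_ge0 ?mulr_ge0 ?exprn_ge0// ltW.
have [||n|s sP] := @nested_intervals R
    (fun n => \sum_(0 <= k < n) a k - t n) (fun n => 2 * t n).
- move=> n; rewrite big_nat_recr//=; have := aC n; rewrite ler_norml (tS n).
  by move=> /andP[? ?]; lra.
- move=> n; rewrite big_nat_recr//=; have := aC n; rewrite ler_norml (tS n).
  by move=> /andP[? ?]; lra.
- by rewrite mulr_ge0.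
exists s => n; have /andP[h1 h2] := sP n.
by rewrite -/(t n) ler_norml; lra.
Qed.

Lemma cRe_sum (I : Type) (s : seq I) (F : I -> R[i]) :
  complex.Re (\sum_(i <- s) F i) = \sum_(i <- s) complex.Re (F i).
Proof. by elim/big_rec2 : _ => // i x y _ <-; rewrite cReD. Qed.

Lemma cIm_sum (I : Type) (s : seq I) (F : I -> R[i]) :
  complex.Im (\sum_(i <- s) F i) = \sum_(i <- s) complex.Im (F i).
Proof. by elim/big_rec2 : _ => // i x y _ <-; rewrite cImD. Qed.

Lemma geometric_series_complex (a : nat -> R[i]) C q : 0 <= q < 1 ->
  (forall n, cabs (a n) <= C * q ^+ n) -> exists s, forall n,
  cabs (s - \sum_(0 <= k < n) a k) <= 2 * C / (1 - q) * q ^+ n.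
Proof.
move=> q01 aC.
have [x xP] := geometric_series_real q01
  (fun n => le_trans (Re_le_cabs (a n)) (aC n)).
have [y yP] := geometric_series_real q01
  (fun n => le_trans (Im_le_cabs (a n)) (aC n)).
exists (x +i* y)%C => n; rewrite (le_trans (cabs_le_ReIm _))//.
rewrite cReB cImB cRe_sum cIm_sum /=.
rewrite (le_trans (lerD (xP n) (yP n)))// le_eqVlt; apply/orP; left.
by apply/eqP; field; rewrite gt_eqF// subr_gt0; case/andP: q01.
Qed.

Lemma geometric_limit_uniq (S : nat -> R[i]) A B q s s' : 0 <= q < 1 ->
  (forall n, cabs (s - S n) <= A * q ^+ n) ->
  (forall n, cabs (s' - S n) <= B * q ^+ n) -> s = s'.
Proof.
move=> q01 sA sB; apply/eqP; rewrite -subr_eq0; apply/eqP/cabs_eq0/le_anti.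
rewrite cabs_ge0 andbT; apply/ler_addgt0Pl => e e0; rewrite addr0.
have [n nP] := ge0_expr_lt (A + B) q01 e0.
have -> : s - s' = (s - S n) - (s' - S n) by ring.
rewrite (le_trans (cabsB _ _))// (le_trans _ nP)// mulrDl lerD//.
Qed.

Lemma sum_expr_le q n : 0 <= q < 1 -> \sum_(0 <= k < n) q ^+ k <= 1 / (1 - q).
Proof.
move=> /andP[q0 q1]; rewrite ler_pdivlMr ?subr_gt0//.
have -> : (\sum_(0 <= k < n) q ^+ k) * (1 - q) = 1 - q ^+ n.
  elim: n => [|n IH]; first by rewrite big_geq// expr0 mul0r subrr.
  by rewrite big_nat_recr//= mulrDl IH exprS; ring.
by rewrite lerBlDr lerDl exprn_ge0.
Qed.

Definition geometric (u : nat -> E) q :=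
  forall r, exists C, forall n, bounded_disc (u n) r (C * q ^+ n).

Lemma bounded_disc_ge0 f r M : 0 <= r -> bounded_disc f r M -> 0 <= M.
Proof.
by move=> r0 fM; apply: le_trans (fM 0 _); [exact: cabs_ge0|rewrite cabs0].
Qed.

Lemma geometric_partial_sum (u : nat -> E) r C q n : 0 <= q < 1 ->
  (forall n, bounded_disc (u n) r (C * q ^+ n)) -> 0 <= r ->
  bounded_disc (\sum_(0 <= k < n) u k) r (C / (1 - q)).
Proof.
move=> q01 uC r0.
have C0 : 0 <= C.
  by have := bounded_disc_ge0 r0 (uC 0%N); rewrite expr0 mulr1.
apply: (bounded_discW (lexx r) _ (bounded_disc_sum (index_iota 0 n) uC)).
by rewrite -mulr_sumr ler_wpM2l// -div1r sum_expr_le.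
Qed.

(** The sum is built pointwise, so one [F] serves all radii [r] and constants [C]. It is
    differentiable because all partial sums share one second-order bound, which survives the
    limit. *)
Lemma geometric_series_entire (u : nat -> E) q : 0 <= q < 1 ->
  geometric u q -> exists F : E, forall r C,
    (forall n, bounded_disc (u n) r (C * q ^+ n)) ->
    forall n, bounded_disc (F - \sum_(0 <= k < n) u k) r (2 * C / (1 - q) * q ^+ n).
Proof.
move=> q01 gu.
(* The limit is fixed before [C] is chosen; [geometric_limit_uniq] makes it satisfy the tail bound
   for every admissible [C]. *)
have lim (a : nat -> R[i]) : (exists C, forall n, cabs (a n) <= C * q ^+ n) ->
    exists s : R[i], forall C, (forall n, cabs (a n) <= C * q ^+ n) -> forall n,
    cabs (s - \sum_(0 <= k < n) a k) <= 2 * C / (1 - q) * q ^+ n.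
  move=> [C /(geometric_series_complex q01)[s sP]]; exists s => B aB.
  have [s' s'P] := geometric_series_complex q01 aB.
  by rewrite (geometric_limit_uniq q01 sP s'P).
have bu z : exists C, forall n, cabs (u n z) <= C * q ^+ n.
  by have [C uC] := gu (cabs z); exists C => n; exact: uC.
pose F z : R[i] := projT1 (cid (lim _ (bu z))).
have FP z C : (forall n, cabs (u n z) <= C * q ^+ n) -> forall n,
    cabs (F z - \sum_(0 <= k < n) u k z) <= 2 * C / (1 - q) * q ^+ n.
  by rewrite /F; case: cid => s /= sP; exact: sP.
pose du n : R[i] -> R[i] := ((u n : (R[i])^o -> (R[i])^o)^`())%classic.
have dF z : exists d : R[i], fderiv F z d.
  pose r := cabs z; have r3 : 0 <= r + 3 by rewrite addr_ge0// cabs_ge0.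
  have [C uC] := gu (r + 3).
  have duC n : bounded_disc (du n) (r + 2) (C * q ^+ n).
    rewrite -[_ * _]divr1; apply: (cauchy_disc (entire_hderiv (u n)) ltr01).
    by have -> : r + 2 + 1 = r + 3 by ring.
  have [d dP] : exists s : R[i], forall C, (forall n, cabs (du n z) <= C * q ^+ n) ->
      forall n, cabs (s - \sum_(0 <= k < n) du k z) <= 2 * C / (1 - q) * q ^+ n.
    by apply: (lim _); exists C => n; apply: duC; rewrite -/r lerDl.
  have {}dP := dP C (fun n => duC n z ltac:(by rewrite -/r lerDl)).
  exists d; set B := 2 * C / (1 - q) in dP; set L := C / (1 - q).
  have L0 : 0 <= L := bounded_disc_ge0 r3 (geometric_partial_sum 0 q01 uC r3).
  have B0 : 0 <= B by rewrite /B -mulrA mulr_ge0.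
  have FB v : cabs v <= r + 3 -> forall n,
      cabs (F v - \sum_(0 <= k < n) u k v) <= B * q ^+ n.
    by move=> vr; apply: FP => n; exact: uC.
  (* [F (z + h)], [F z] and [d h] are each replaced by the partial sum's value up to [B q^n], hence
     [3 * B]; [L] does not depend on [n]. *)
  have main h : cabs h <= 1 -> cabs (F (z + h) - F z - d * h) <= L * cabs h ^+ 2.
    move=> h1; apply/ler_addgt0Pl => e e0.
    have [n nP] := ge0_expr_lt (3 * B) q01 e0.
    pose S := \sum_(0 <= k < n) u k.
    have SL : bounded_disc S (r + 3) L := geometric_partial_sum n q01 uC r3.
    have dS : fderiv S z (\sum_(0 <= k < n) du k z).
      have -> : (S : R[i] -> R[i]) = fun v => \sum_(0 <= k < n) u k v.
        by apply/funext => v; rewrite /S entire_sumE.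
      apply: (@fderiv_sum R _ (index_iota 0 n) (fun k => u k) du) => k.
      exact: entire_hderiv.
    have := taylor1 (entire_hderiv S) L0 SL (lexx r) h1.
    rewrite (fderiv_derive1 dS) => T.
    have zh : cabs (z + h) <= r + 3.
      by rewrite (le_trans (cabsD _ _))// lerD2l (le_trans h1)// ler1n.
    have z3 : cabs z <= r + 3 by rewrite lerDl.
    have := FB _ zh n; have := FB _ z3 n; have := dP n.
    rewrite -!entire_sumE -/S; set D := \sum_(0 <= k < n) du k z in T *.
    move=> H1 H2 H3.
    have -> : F (z + h) - F z - d * h = (F (z + h) - S (z + h)) - (F z - S z)
      - (d - D) * h + (S (z + h) - S z - D * h) by ring.
    rewrite (le_trans (cabsD _ _))// lerD//.
    rewrite (le_trans (cabsB _ _))//.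
    have q4 := cabsB (F (z + h) - S (z + h)) (F z - S z).
    have q5 : cabs ((d - D) * h) <= B * q ^+ n.
      by rewrite cabsM (le_trans _ H1)// ler_piMr// cabs_ge0.
    by move: nP; rewrite -mulrA; lra.
  apply/cderivP => e e0.
  have Le : 0 < e / (L + 1) by rewrite divr_gt0// ltr_wpDl.
  exists (Num.min 1 (e / (L + 1))); first by rewrite lt_min ltr01.
  move=> h; rewrite lt_min => /andP[/ltW h1 h2].
  rewrite (le_trans (main _ h1))// expr2 mulrA ler_wpM2r ?cabs_ge0//.
  rewrite (@le_trans _ _ ((L + 1) * cabs h))//.
    by rewrite ler_wpM2r ?cabs_ge0// lerDl.
  by rewrite mulrC -ler_pdivlMr ?ltW// ltr_wpDl.
have [G GF] := hderiv_entire (df := fun z => projT1 (cid (dF z)))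
  (fun z => projT2 (cid (dF z))).
exists G => r C uC n z zr; rewrite entire_subE entire_sumE GF.
by apply: FP => k; exact: uC.
Qed.

End entire_complex.

(** * The operator *)

Section operator.
Context (R : realType) (lambda b : R[i]).
Notation E := (entire R[i]).
Implicit Types (f g : E) (z w : R[i]) (r M : R).

Fact compderiv_entire f :
  (fun z : (R[i])^o =>
    ((f : (R[i])^o -> (R[i])^o)^`())%classic (lambda * z + b)) \in
  @entire_fun R[i].
Proof.
apply: fderiv_mem_entire => z.
have [ddf dfddf] := hderiv_hderiv (entire_hderiv f).
exists (ddf (lambda * z + b) * lambda).
apply: (fderiv_comp (g := fun z => lambda * z + b) (dfddf _)).
have := fderivD (fderivZ lambda (fderiv_id z)) (fderiv_cst b z).
by move/fderiv_eq; apply; rewrite mulr1 addr0.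
Qed.

Definition compderiv f : E := Entire (compderiv_entire f).

Lemma compderivE f z d : fderiv f (lambda * z + b) d -> compderiv f z = d.
Proof. exact: fderiv_derive1. Qed.

Fact compderiv_is_linear : linear compderiv.
Proof.
move=> a f g; apply: entire_eq => z; apply: compderivE.
have E : entire_val (a *: f + g) = fun w => a * f w + g w.
  by apply/funext => w; rewrite entire_addE entire_scaleE.
rewrite E entire_addE entire_scaleE.
exact: fderivD (fderivZ a (entire_hderiv f _)) (entire_hderiv g _).
Qed.

HB.instance Definition _ :=
  GRing.isLinear.Build R[i] E E _ compderiv compderiv_is_linear.

Lemma compderiv_bounded_disc f r (d : R) M : 0 < d ->
  bounded_disc f (cabs lambda * r + cabs b + d) M ->
  bounded_disc (compderiv f) r (M / d).
Proof.
move=> d0 fM z zr; apply: (cauchy_disc (entire_hderiv f) d0 fM).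
by rewrite (le_trans (cabsD _ _))// lerD2r cabsM ler_wpM2l ?cabs_ge0.
Qed.

Lemma compderiv_continuous : continuous compderiv.
Proof.
move=> f U /entire_nbhsP[r [e e0 eU]].
apply: ((entire_nbhsP f (compderiv @^-1` U)).2).
exists (cabs lambda * r + cabs b + 1), e => // g fg; apply: eU.
by rewrite -linearB -[e]divr1; exact: compderiv_bounded_disc.
Qed.

Lemma compderiv_bounded_orbits f : cabs lambda < 1 ->
  exists2 r, 0 <= r & exists M, forall n, bounded_disc (iter n compderiv f) r M.
Proof.
move=> l1; have l0 : 0 < 1 - cabs lambda by rewrite subr_gt0.
(* [r] solves [|lambda| r + |b| + 1 = r]: the affine map leaves a margin 1, with which Cauchy's
   estimate loses no factor. *)
pose r := (cabs b + 1) / (1 - cabs lambda).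
have r0 : 0 <= r by apply: divr_ge0 (ltW l0); rewrite addr_ge0 ?cabs_ge0.
exists r => //; have [M M0 fM] := entire_bounded f r.
exists M; elim=> [//|n IH]; rewrite iterS -[M]divr1.
apply: compderiv_bounded_disc => //.
suff -> : cabs lambda * r + cabs b + 1 = r by [].
by rewrite /r; field; rewrite gt_eqF.
Qed.

Lemma compderiv_not_hypercyclic : cabs lambda < 1 -> ~ hypercyclic compderiv.
Proof.
move=> l1 [f df]; have [r r0 [M fM]] := compderiv_bounded_orbits f l1.
(* The orbit is bounded by [M] at 0, hence at distance at least 2 from the constant [M + 2] there,
   and never enters its unit neighbourhood. *)
have [k kE] := hderiv_entire (fun z => fderiv_cst ((M + 2)%:C)%C z).
have kN : nbhs k [set g | bounded_disc (k - g) r 1].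
  by apply/entire_nbhsP; exists r, 1.
have [|g [kg [n _ gE]]] := df _ _ (open_interior [set g | bounded_disc (k - g) r 1]).
  by exists k.
have := interior_subset kg 0; rewrite cabs0 => /(_ r0).
have := fM n 0; rewrite cabs0 gE => /(_ r0) gM.
rewrite entire_subE kE; have := cabsD (((M + 2)%:C)%C - g 0) (g 0).
rewrite subrK cabs_real; have := ler_norm (M + 2); lra.
Qed.

End operator.

(** * The Bernoulli shift on fair coins *)

Lemma image_probability d d' (T : measurableType d) (T' : measurableType d')
    (R : realType) (P : probability T R) (f : T -> T') :
  measurable_fun setT f ->
  exists Q : probability T' R, forall A, Q A = P (f @^-1` A).
Proof.
move=> mf; pose X : {mfun T >-> T'} := HB.pack f (isMeasurableFun.Build _ _ _ _ f mf).
by exists (distribution P X).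
Qed.

Section cylinders.
Context (I : choiceType).
Implicit Types (F : seq (I * bool)) (x : I -> bool).

Definition cyl F : set (I -> bool) :=
  [set x | forall ib, ib \in F -> x ib.1 = ib.2].

Definition keys F : seq I := map fst F.

(** The empty set is included because contradictory cylinders must intersect within the class;
    distinct keys make the length of [F] determine the probability. *)
Definition cylinders : set (set (I -> bool)) :=
  [set A | A = set0 \/ exists2 F, uniq (keys F) & A = cyl F].

Definition coins := g_sigma_algebraType cylinders.

Lemma cyl_nil : cyl [::] = setT.
Proof. by apply/seteqP; split. Qed.

Lemma cyl_cons i b F : cyl ((i, b) :: F) = [set x | x i = b] `&` cyl F.
Proof.
apply/seteqP; split=> [x xF|x [xi xF] ib]; last first.
  by rewrite inE => /orP[/eqP ->//|/xF].
split; first by apply: (xF (i, b)); rewrite mem_head.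
by move=> ib ibF; apply: xF; rewrite inE ibF orbT.
Qed.

Lemma cyl_cat F F' : cyl (F ++ F') = cyl F `&` cyl F'.
Proof.
elim: F => [|[i b] F IH]; first by rewrite cyl_nil setTI.
by rewrite cat_cons !cyl_cons IH setIA.
Qed.

(** A repeated coordinate is either redundant or contradictory. *)
Lemma cyl_normalize F : cyl F = set0 \/
  exists F', [/\ uniq (keys F'), cyl F = cyl F' & {subset keys F' <= keys F}].
Proof.
elim: F => [|[i b] F IH]; first by right; exists [::].
rewrite cyl_cons; case: IH => [->|[F' [uF' -> sF']]]; first by left; rewrite setI0.
have sF i' : i' \in keys F' -> i' \in keys ((i, b) :: F).
  by move=> /sF'; rewrite inE => ->; rewrite orbT.
have [iF|iF] := boolP (i \in keys F'); last first.
  right; exists ((i, b) :: F'); split; [by rewrite /= iF|by rewrite cyl_cons|].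
  by move=> j; rewrite inE => /orP[/eqP ->|/sF//]; rewrite mem_head.
have [ibF|ibF] := boolP ((i, b) \in F').
  right; exists F'; split => //; rewrite setIidr// => x xF'.
  exact: (xF' (i, b)).
left; rewrite -subset0 => x [xi xF']; move: iF => /mapP[[j c] jc /= ij].
move: jc (xF' _ jc); rewrite -ij /= xi => jc bc.
by move: ibF; rewrite bc jc.
Qed.

Lemma cylinders_cyl F : cylinders (cyl F).
Proof.
by have [->|[F' [uF' -> _]]] := cyl_normalize F; [left|right; exists F'].
Qed.

Lemma cyl_point F : uniq (keys F) -> exists w, cyl F w.
Proof.
elim: F => [|[i b] F IH] /=; first by exists (fun=> true).
move=> /andP[iF /IH[w wF]]; exists (fun j => if j == i then b else w j).
move=> [j c]; rewrite inE => /orP[/eqP[-> ->]|jF] /=; first by rewrite eqxx.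
case: eqP => [ji|_]; last exact: (wF (j, c)).
by move: iF; rewrite -ji (map_f fst jF).
Qed.

Lemma cylE F w : cyl F w -> cyl F = [set x | forall i, i \in keys F -> x i = w i].
Proof.
move=> wF; apply/seteqP; split => x xF.
  by move=> i /mapP[ib ibF ->]; rewrite xF// wF.
by move=> ib ibF; rewrite xF ?wF//; exact: map_f.
Qed.

Lemma cylinders_setI : setI_closed cylinders.
Proof.
move=> A B [->|[F _ ->]] [->|[F' _ ->]]; rewrite ?(set0I, setI0);
  [by left|by left|by left|].
by rewrite -cyl_cat; exact: cylinders_cyl.
Qed.

End cylinders.

Section coins_measurable.
Context (I J : choiceType).

Lemma measurable_cyl (F : seq (I * bool)) :
  measurable (cyl F : set (coins I)).
Proof. by apply: sub_sigma_algebra; exact: cylinders_cyl. Qed.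

Definition reindex (p : I -> J) (x : coins J) : coins I := fun i => x (p i).

Lemma reindex_cyl (p : I -> J) F :
  reindex p @^-1` cyl F = cyl (map (fun ib => (p ib.1, ib.2)) F).
Proof.
elim: F => [|[i b] F IH]; first by rewrite !cyl_nil preimage_setT.
by rewrite /= !cyl_cons preimage_setI IH.
Qed.

Lemma measurable_coins d (T : measurableType d) (f : T -> coins I) :
  (forall i b, measurable [set t | f t i = b]) -> measurable_fun setT f.
Proof.
move=> mf; refine (@measurability _ _ _ (coins I) _ _ (@cylinders I) _ _) => //.
move=> _ [_ [->|[F _ ->]] <-]; rewrite setTI ?preimage_set0//.
elim: F => [|[i b] F IH]; first by rewrite cyl_nil preimage_setT.
rewrite cyl_cons preimage_setI; apply: measurableI => //.
exact: mf.
Qed.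

End coins_measurable.

Lemma measurable_reindex (I J : choiceType) (p : I -> J) :
  measurable_fun setT (reindex p).
Proof.
apply: measurable_coins => i b.
have := measurable_cyl [:: (p i, b)]; rewrite cyl_cons cyl_nil setIT.
by [].
Qed.

(** * Fair coins from the binary digits of a uniform number *)

Section binary_digits.
Context (R : realType).
Implicit Types (x : R) (n N m : nat).

Definition digit n x := odd (Num.truncn (2 ^+ n.+1 * x)).

Lemma truncn_double x : 0 <= x ->
  Num.truncn (2 * x) = (odd (Num.truncn (2 * x)) + (Num.truncn x).*2)%N.
Proof.
move=> x0; rewrite -[LHS]odd_double_half; congr (_ + _.*2)%N.
apply/esym/eqP; rewrite truncn_eq//.
have := truncn_itv (mulr_ge0 (ler0n R 2) x0).
rewrite -{1 2}[Num.truncn (2 * x)]odd_double_half.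
set k := _./2; rewrite -addSn -natr1 !natrD -!muln2 !natrM.
move=> /andP[h1 h2]; rewrite -natr1.
have : (odd (Num.truncn (2 * x)))%:R <= 1 :> R by rewrite lern1; case: odd.
have : 0 <= (odd (Num.truncn (2 * x)))%:R :> R by [].
by move=> ? ?; apply/andP; split; lra.
Qed.

(** The integer with binary digits [w 0, ..., w (N - 1)], most significant first. *)
Definition digit_val (w : nat -> bool) N :=
  iteri N (fun n m => (w n + m.*2)%N) 0%N.

(** Fixing the first [N] digits thus confines [x] to one dyadic interval of length [2^-N]. *)
Lemma digit_valP (w : nat -> bool) N x : 0 <= x < 1 ->
  (forall n, (n < N)%N -> digit n x = w n) <->
  Num.truncn (2 ^+ N * x) = digit_val w N.
Proof.
move=> /andP[x0 x1]; elim: N => [|N IH].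
  split=> // _; rewrite expr0 mul1r /=; apply/eqP.
  by rewrite truncn_eq// x0.
rewrite exprS -mulrA truncn_double ?mulr_ge0 ?exprn_ge0// mulrA -exprS.
rewrite -/(digit N x) [digit_val _ _]/=; split=> [H|H].
  rewrite H// (IH.1 _)// => n nN; apply: H.
  exact: ltnW.
have dN : digit N x = w N.
  by have := congr1 odd H; rewrite !oddD !odd_double !addbF; case: (digit N x); case: (w N).
move: H; rewrite dN => /addnI/double_inj/IH H n.
by rewrite ltnS leq_eqVlt => /orP[/eqP ->//|]; exact: H.
Qed.

Lemma digit_val_lt w N : (digit_val w N < 2 ^ N)%N.
Proof.
elim: N => [|N IH] //=; rewrite expnS mul2n.
have : (w N <= 1)%N by case: (w N).
by move: IH; rewrite /digit_val; move: (iteri _ _ _) (2 ^ N)%N => u v ? ?; lia.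
Qed.

Lemma measurable_digit n b : measurable [set x | digit n x = b].
Proof.
have c0 : 0 < 2 ^+ n.+1 :> R by rewrite exprn_gt0.
pose t x := Num.truncn (2 ^+ n.+1 * x).
have mt k : measurable [set x | (k < t x)%N].
  rewrite (_ : mkset _ = `[k.+1%:R / 2 ^+ n.+1, +oo[%classic).
    exact: measurable_itv.
  apply/seteqP; split => x /=; rewrite in_itv/= andbT ler_pdivrMr// mulrC /t;
    by rewrite truncn_gt_nat.
have mk k : measurable [set x | t x = k].
  case: k => [|k].
    rewrite (_ : mkset _ = ~` [set x | (0 < t x)%N]); first exact: measurableC.
    by apply/seteqP; split => x /=; case: (t x).
  rewrite (_ : mkset _ = [set x | (k < t x)%N] `\` [set x | (k.+1 < t x)%N]).
    exact: measurableD.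
  apply/seteqP; split => x /=; first by move=> ->; split=> //; rewrite ltnn.
  by move=> [h1 /negP]; rewrite -leqNgt => h2; apply/eqP; rewrite eqn_leq h1 h2.
rewrite (_ : mkset _ = \bigcup_(k in [set k | odd k = b]) [set x | t x = k]).
  exact: bigcup_measurable.
apply/seteqP; split => x /=; first by move=> <-; exists (t x).
by move=> [k /= <- <-].
Qed.

Definition digits x : coins nat := fun n => digit n x.

Lemma measurable_digits : measurable_fun setT digits.
Proof. by apply: measurable_coins => i b; exact: measurable_digit. Qed.

Let D : set R := `[0, 1[%classic.

Let mD : measurable D.
Proof. exact: measurable_itv. Qed.

Let mu : {measure set (measurableTypeR R) -> \bar R} :=
  mrestr (@lebesgue_measure R) mD.

Let ex_fair : exists fair : probability (coins nat) R,
  forall A, fair A = lebesgue_measure (digits @^-1` A `&` D).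
Proof.
have mu1 : mu setT = 1%E.
  rewrite /mu /= /mrestr setTI.
  by rewrite lebesgue_measure_itv/= lte_fin ltr01 sube0.
pose M := Measure_isProbability.Build _ _ _ mu mu1.
pose U : probability (measurableTypeR R) R := HB.pack (mu : set _ -> _) mu M.
have [P PE] := image_probability U (measurable_digits : measurable_fun
  [set: measurableTypeR R] _).
by exists P => A; rewrite PE.
Qed.

Section fair_cylinders.
Context (fair : probability (coins nat) R).
Hypothesis fairE : forall A, fair A = lebesgue_measure (digits @^-1` A `&` D).

Lemma fair_full (w : nat -> bool) N :
  fair [set x | forall n, (n < N)%N -> x n = w n] = ((2^-1) ^+ N)%:E.
Proof.
set m := digit_val w N; have p0 : 0 < 2 ^+ N :> R by rewrite exprn_gt0.
rewrite fairE.
have -> : digits @^-1` [set x | forall n, (n < N)%N -> x n = w n] `&` D =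
    `[m%:R / 2 ^+ N, m.+1%:R / 2 ^+ N[%classic.
  apply/seteqP; split => x.
    move=> [/= xw]; rewrite /D /= !in_itv/= => x01.
    move: xw => /(digit_valP w N x01).1 /eqP; rewrite -/m.
    case/andP: x01 => x0 _; rewrite truncn_eq ?mulr_ge0 ?(ltW p0)//.
    by rewrite ler_pdivrMr// ltr_pdivlMr// mulrC.
  rewrite /= in_itv/= => /andP[]; rewrite ler_pdivrMr// ltr_pdivlMr// => h1 h2.
  have x0 : 0 <= x by rewrite -(pmulr_lge0 _ p0) (le_trans _ h1).
  have x1 : x < 1.
    rewrite -(ltr_pM2r p0) mul1r (lt_le_trans h2)// -natrX ler_nat.
    exact: digit_val_lt.
  split; last by rewrite /D /= in_itv/= x0.
  apply: (digit_valP w N _).2; first by rewrite x0.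
  by apply/truncn_def; rewrite mulrC h1 h2.
rewrite lebesgue_measure_itv/= lte_fin ltr_pM2r ?invr_gt0// ltr_nat ltnSn.
by rewrite -EFinD -mulrBl -natr1 addrAC subrr add0r mul1r exprVn.
Qed.

Lemma fair_cyl N k (F : seq (nat * bool)) : (size F + k)%N = N ->
  uniq (keys F) -> {subset keys F <= iota 0 N} ->
  fair (cyl F) = ((2^-1) ^+ size F)%:E.
Proof.
elim: k F => [|k IH] F sF uF FN.
  have [w wF] := cyl_point uF; rewrite (cylE wF) -(fair_full w).
  congr (fair _); apply/seteqP; split => x /= H i iF; apply: H.
    have sz : (size (iota 0 N) <= size (keys F))%N.
      by rewrite size_iota size_map -sF addn0.
    have [_ ->] := uniq_min_size uF FN sz.
    by rewrite mem_iota add0n -[X in (_ < X)%N]sF addn0.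
  by have := FN _ iF; rewrite mem_iota add0n -[X in (_ < X)%N]sF addn0.
have [n nN nF] : exists2 n, n \in iota 0 N & n \notin keys F.
  apply: contrapT => H.
  have : (size (iota 0 N) <= size (keys F))%N.
    apply: uniq_leq_size; first exact: iota_uniq.
    by move=> n nN; apply: contrapT => /negP nF; apply: H; exists n.
  by rewrite size_iota size_map -sF -[leqRHS]addn0 leq_add2l.
have IHb b : fair (cyl ((n, b) :: F)) = ((2^-1) ^+ (size F).+1)%:E.
  apply: (IH ((n, b) :: F)); first by rewrite /= -sF addnS addSn.
    by rewrite /= nF.
  by move=> i; rewrite inE => /orP[/eqP ->//|/FN].
have -> : cyl F = cyl ((n, true) :: F) `|` cyl ((n, false) :: F).
  rewrite !cyl_cons -setIUl setIidr// => x _ /=.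
  by case: (x n); [left|right].
transitivity (fair (cyl ((n, true) :: F)) + fair (cyl ((n, false) :: F)))%E.
  apply: measureU; [exact: measurable_cyl|exact: measurable_cyl|].
  by rewrite -subset0 => x; rewrite !cyl_cons => -[[/= -> _] []].
by rewrite !IHb -EFinD exprS; congr (_%:E); field.
Qed.

End fair_cylinders.

Lemma ex_fair_coins_nat : exists P : probability (coins nat) R,
  forall F, uniq (keys F) -> P (cyl F) = ((2^-1) ^+ size F)%:E.
Proof.
have [P PE] := ex_fair; exists P => F uF.
have [N NP] : exists N, {subset keys F <= iota 0 N}.
  elim: (keys F) => [|k s [N IH]]; first by exists 0%N.
  exists (maxn N k.+1) => i; rewrite inE mem_iota add0n leq_max.
  move=> /orP[/eqP ->|/IH]; first by rewrite ltnSn orbT.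
  by rewrite mem_iota add0n => /andP[_ ->].
have sN : (size F <= N)%N.
  by rewrite -(size_map fst) -(size_iota 0 N) uniq_leq_size.
exact: (@fair_cyl P PE N (N - size F)%N F (subnKC sN) uF NP).
Qed.

End binary_digits.

(** [pickle] embeds [I] into [nat]; being injective, it keeps keys distinct and cylinder
    probabilities unchanged. *)
Lemma ex_fair_coins (R : realType) (I : countType) :
  exists P : probability (coins I) R,
  forall F, uniq (keys F) -> P (cyl F) = ((2^-1) ^+ size F)%:E.
Proof.
have [Q QP] := ex_fair_coins_nat R.
have [P PE] := image_probability Q (measurable_reindex (@pickle I)).
exists P => F uF; rewrite PE reindex_cyl QP ?size_map//.
rewrite /keys -map_comp (map_comp (@pickle I) fst) map_inj_uniq//.
Qed.

(** * Real-valued probabilities and a Dynkin class argument *)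

Section real_probability.
Context d (T : measurableType d) (R : realType) (P : probability T R).
Implicit Types (A B : set T).

Definition prob A : R := fine (P A).

Lemma probE A : measurable A -> P A = (prob A)%:E.
Proof. by move=> mA; rewrite fineK// fin_num_measure. Qed.

Lemma prob_ge0 A : 0 <= prob A.
Proof. by rewrite fine_ge0. Qed.

Lemma prob_le A B : measurable A -> measurable B -> A `<=` B -> prob A <= prob B.
Proof.
by move=> mA mB AB; rewrite -lee_fin -!probE// le_measure ?inE.
Qed.

Lemma probU A B : measurable A -> measurable B -> A `&` B = set0 ->
  prob (A `|` B) = prob A + prob B.
Proof.
move=> mA mB AB; apply: EFin_inj; rewrite EFinD -!probE//.
  exact: measureU.
exact: measurableU.
Qed.

Lemma prob_setT : prob setT = 1.
Proof. by rewrite /prob probability_setT. Qed.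

Lemma prob_set0 : prob set0 = 0.
Proof. by rewrite /prob measure0. Qed.

Lemma prob_le1 A : measurable A -> prob A <= 1.
Proof. by move=> mA; rewrite -prob_setT prob_le. Qed.

Lemma prob_bigcup_tail (F : (set T)^nat) (e : R) :
  (forall n, measurable (F n)) -> 0 < e -> exists m,
  prob (\bigcup_n F n) - e <= prob (\big[setU/set0]_(i < m) F i).
Proof.
move=> mF e0.
have mS n : measurable (\big[setU/set0]_(i < n) F i).
  by apply: bigsetU_measurable => i _.
have : (P \o (fun n => \big[setU/set0]_(i < n) F i)) @ \oo -->
    P (\bigcup_n \big[setU/set0]_(i < n) F i).
  apply: nondecreasing_cvg_mu => //.
    exact: bigcupT_measurable.
  by apply/nondecreasing_seqP => n; apply/subsetPset; rewrite big_ord_recr /=;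
    exact: subsetUl.
rewrite (_ : \bigcup_n \big[setU/set0]_(i < n) F i = \bigcup_n F n); last first.
  apply/seteqP; split=> [x [n _]|x [n _ Fx]].
    by rewrite -bigcup_mkord => -[k _ Fx]; exists k.
  by exists n.+1 => //; rewrite -bigcup_mkord; exists n => //=.
rewrite probE; last exact: bigcupT_measurable.
move=> /fine_cvg/cvgrPdist_le/(_ e e0)[m _ mP]; exists m.
by have := mP m (leqnn m); rewrite /= ler_norml => /andP[_]; rewrite lerBlDr addrC -lerBlDr.
Qed.

Lemma prob_bigcup_geometric (G : nat -> set T) (C q : R) : 0 <= q < 1 ->
  (forall n, measurable (G n)) -> (forall n, prob (G n) <= C * q ^+ n) ->
  prob (\bigcup_n G n) <= C / (1 - q).
Proof.
move=> q01 mG GC; apply/ler_addgt0Pl => e e0.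
have [m mP] := prob_bigcup_tail mG e0.
rewrite -lerBlDl (le_trans mP)//.
have C0 : 0 <= C.
  by have := GC 0%N; rewrite expr0 mulr1; apply: le_trans; exact: prob_ge0.
rewrite (@le_trans _ _ (\sum_(0 <= k < m) C * q ^+ k))//; last first.
  by rewrite -mulr_sumr ler_wpM2l// -div1r sum_expr_le.
elim: m {mP} => [|m IH]; first by rewrite big_ord0 big_geq// prob_set0.
have mS : measurable (\big[setU/set0]_(i < m) G i).
  by apply: bigsetU_measurable.
rewrite big_ord_recr big_nat_recr//= -(setDUK (@subsetUl _ _ (G m))).
have mD : measurable ((\big[setU/set0]_(i < m) G i `|` G m) `\`
    \big[setU/set0]_(i < m) G i).
  by apply: measurableD => //; exact: measurableU.
rewrite probU//; last exact: setDIK.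
rewrite lerD// (le_trans _ (GC m))// prob_le//.
by move=> x [[]].
Qed.

(** The sets on which [q n] converges to [c] times the probability form a Dynkin class;
    [q n A <= prob A] makes tails of disjoint unions uniformly small in [n]. Mixing uses this once
    in each argument. *)
Lemma dominated_cvg_measurable (G : set (set T)) (q : nat -> set T -> R) (c : R) :
  @measurable _ T = <<s G >> -> setI_closed G -> 0 <= c <= 1 ->
  (forall n A, measurable A -> 0 <= q n A <= prob A) ->
  (forall n A B, measurable A -> measurable B -> A `&` B = set0 ->
    q n (A `|` B) = q n A + q n B) ->
  let conv A := forall e : R, 0 < e -> exists N, forall n, (N <= n)%N ->
    `|q n A - c * prob A| <= e in
  conv setT -> (forall A, G A -> conv A) ->
  forall A, measurable A -> conv A.
Proof.
move=> GE GI /andP[c0 c1] qp qU conv convT convG A mA.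
have convB X Y : measurable X -> measurable Y -> X `<=` Y ->
    conv X -> conv Y -> conv (Y `\` X).
  move=> mX mY XY cX cY e e0; have e2 : 0 < e / 2 by rewrite divr_gt0.
  have [N1 H1] := cX _ e2; have [N2 H2] := cY _ e2.
  exists (maxn N1 N2) => n; rewrite geq_max => /andP[/H1 h1 /H2 h2].
  have mD := measurableD mY mX.
  have YE : Y = X `|` (Y `\` X) by rewrite setDUK.
  have XD : X `&` (Y `\` X) = set0 := setDIK _ _.
  move: h2; rewrite {1 2}YE qU// probU// => h2.
  by move: h1 h2; rewrite !ler_norml => /andP[? ?] /andP[? ?]; apply/andP; split; lra.
have convU X Y : measurable X -> measurable Y -> X `&` Y = set0 ->
    conv X -> conv Y -> conv (X `|` Y).
  move=> mX mY XY cX cY e e0; have e2 : 0 < e / 2 by rewrite divr_gt0.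
  have [N1 H1] := cX _ e2; have [N2 H2] := cY _ e2.
  exists (maxn N1 N2) => n; rewrite geq_max => /andP[/H1 h1 /H2 h2].
  rewrite qU// probU//.
  by move: h1 h2; rewrite !ler_norml => /andP[? ?] /andP[? ?]; apply/andP; split; lra.
rewrite GE in mA; apply: (dynkin_induction GE GI) mA => //.
  by move=> S mS cS; rewrite -setTD; exact: convB.
move=> F mF tF cF e e0; have e4 : 0 < e / 4 by rewrite divr_gt0.
(* The union minus its first [m] pieces has probability at most [e / 4]; [q n] and [c * prob] are
   then also at most [e / 4] on it. *)
have [m mP] := prob_bigcup_tail mF e4.
set S := \big[setU/set0]_(i < m) F i in mP; set U := \bigcup_k F k in mP *.
have mS : measurable S by apply: bigsetU_measurable.
have mU : measurable U by exact: bigcupT_measurable.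
have cS : conv S.
  rewrite /S; elim: m {S mP mS} => [|m IH].
    rewrite big_ord0 => e' e'0; exists 0%N => n _.
    have := qp n set0 measurable0; rewrite prob_set0 mulr0 subr0 => h.
    by rewrite ger0_norm; case/andP: h => // _ /le_trans; apply; exact: ltW.
  rewrite big_ord_recr /=; apply: convU => //; first exact: bigsetU_measurable.
  rewrite -subset0 => x []; rewrite -bigcup_mkord => -[k /= km Fk] Fm.
  by have := tF k m I I (ex_intro _ x (conj Fk Fm)) => kE; move: km; rewrite kE ltnn.
have SU : S `<=` U.
  by move=> x; rewrite /S -bigcup_mkord => -[k _ Fk]; exists k.
have [N NP] := cS _ e4; exists N => n nN; have {NP nN} := NP n nN.
have mD := measurableD mU mS.
have UE : U = S `|` (U `\` S) by rewrite setDUK.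
have SD : S `&` (U `\` S) = set0 := setDIK _ _.
move: mP; rewrite UE qU// probU//.
have /andP[h1 h2] := qp n _ mD; have h3 := prob_ge0 (U `\` S).
set u := prob _ in h2 h3 *; set v := prob _; set x := q n _; set y := q n _ in h1 h2 *.
move=> h4; rewrite !ler_norml => /andP[h5 h6].
have u4 : u <= e / 4 by lra.
have cu : 0 <= c * u <= u by rewrite mulr_ge0//= ler_piMl.
by case/andP: cu => ? ?; apply/andP; split; lra.
Qed.

End real_probability.

(** * Invariance and mixing of the shift of the rows *)

Section bernoulli_shift.
Context (R : realType).
Notation I := (int * nat)%type.
Notation Omega := (coins I).
Implicit Types (F : seq (I * bool)) (A B : set Omega) (n : nat).

Definition translate n (i : I) : I := (i.1 + n%:Z, i.2).

Lemma translate_inj n : injective (translate n).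
Proof. by move=> [k j] [k' j'] [/addIr -> ->]. Qed.

Definition coin_shift : Omega -> Omega := reindex (translate 1).

Lemma iter_coin_shift n : iter n coin_shift = reindex (translate n).
Proof.
apply/funext => x; apply/funext => -[k j].
elim: n k => [|n IH] k; first by rewrite /reindex /translate addr0.
rewrite iterS /coin_shift {1}/reindex IH /reindex /translate /=.
by congr (x (_, _)); rewrite -addrA -PoszD.
Qed.

Definition translate_cyl n F := map (fun ib : I * bool => (translate n ib.1, ib.2)) F.

Lemma keys_translate n F : keys (translate_cyl n F) = map (translate n) (keys F).
Proof. by rewrite /keys /translate_cyl -!map_comp. Qed.

Lemma uniq_translate n F : uniq (keys F) -> uniq (keys (translate_cyl n F)).
Proof. by move=> uF; rewrite keys_translate (map_inj_uniq (@translate_inj n)). Qed.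

(** If all row indices have absolute value below [M], a translation by at least [2 M] moves them
    past each other. *)
Lemma keys_disjoint F F' : exists N, forall n, (N <= n)%N ->
  ~~ has [in keys F] (keys (translate_cyl n F')).
Proof.
have [M MP] : exists M : nat, forall i, i \in keys F ++ keys F' -> (`|i.1| < M)%N.
  elim: (keys F ++ keys F') => [|k s [N IH]]; first by exists 0%N.
  exists (maxn N `|k.1|.+1) => i; rewrite inE leq_max.
  by move=> /orP[/eqP ->|/IH ->//]; rewrite ltnSn orbT.
exists (M + M)%N => n nM; apply/hasPn => i.
rewrite keys_translate => /mapP[[k j] kF' ->]; apply/negP => kF.
have := MP _ (_ : (k, j) \in _); rewrite mem_cat kF' orbT => /(_ isT) /= k1.
have := MP _ (_ : translate n (k, j) \in _).
by rewrite mem_cat kF /translate /= => /(_ isT) k2; lia.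
Qed.

Context (P : probability Omega R).
Hypothesis PF : forall F, uniq (keys F) -> P (cyl F) = ((2^-1) ^+ size F)%:E.

Lemma prob_cyl F : uniq (keys F) -> prob P (cyl F) = (2^-1) ^+ size F.
Proof. by move=> uF; rewrite /prob PF. Qed.

Lemma measurable_coin_shift n : measurable_fun setT (iter n coin_shift).
Proof. by rewrite iter_coin_shift; exact: measurable_reindex. Qed.

Lemma measurable_coin_shift_preimage n A : measurable A ->
  measurable (iter n coin_shift @^-1` A).
Proof.
by move=> mA; rewrite -[X in measurable X]setTI; exact: measurable_coin_shift.
Qed.

(** Both measures agree on cylinders, a class closed under intersection that generates the
    sigma-algebra. *)
Lemma coin_shift_invariant n A : measurable A ->
  P (iter n coin_shift @^-1` A) = P A.
Proof.
have [Q QP] := image_probability P (measurable_coin_shift n).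
move=> mA; rewrite -QP.
have Gg (k : nat) : @cylinders I setT by rewrite -cyl_nil; exact: cylinders_cyl.
have gT : \bigcup_(k : nat) setT = [set: Omega].
  by apply/seteqP; split => // x _; exists 0%N.
have PQ B : @cylinders I B -> Q B = P B.
  move=> [->|[F uF ->]]; first by rewrite !measure0.
  rewrite QP iter_coin_shift reindex_cyl !PF ?size_map//.
  exact: uniq_translate.
apply: (@measure_unique _ R Omega (@cylinders I) (fun=> setT) erefl
  (@cylinders_setI I) Gg gT Q P PQ) => // _.
by rewrite [X in (X < _)%E](probability_setT Q) ltry.
Qed.

Lemma prob_coin_shift n A : measurable A ->
  prob P (iter n coin_shift @^-1` A) = prob P A.
Proof. by move=> mA; rewrite /prob coin_shift_invariant. Qed.

Let mixing A B := forall e : R, 0 < e -> exists N, forall n, (N <= n)%N ->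
  `|prob P (A `&` iter n coin_shift @^-1` B) - prob P A * prob P B| <= e.

(** Once the keys are disjoint the events are independent and the difference is exactly 0. *)
Let prob_mixing1 F F' : mixing (cyl F) (cyl F').
Proof.
move=> e e0.
have [F0|[G uG ->]] := cylinders_cyl F.
  exists 0%N => n _; rewrite F0 set0I prob_set0 mul0r subrr normr0.
  exact: ltW.
have [F0|[G' uG' ->]] := cylinders_cyl F'.
  exists 0%N => n _; rewrite F0 preimage_set0 setI0 prob_set0 mulr0 subrr normr0.
  exact: ltW.
have [N NP] := keys_disjoint G G'; exists N => n /NP GG'.
rewrite iter_coin_shift reindex_cyl -cyl_cat !prob_cyl ?uniq_translate//.
  by rewrite size_cat exprD size_map subrr normr0 ltW.
by rewrite /keys map_cat cat_uniq uG GG' uniq_translate.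
Qed.

(** Extension in the first argument; domination is monotonicity of the probability. *)
Let prob_mixing2 A F : measurable A -> mixing A (cyl F).
Proof.
move=> mA; have mF n : measurable (iter n coin_shift @^-1` cyl F).
  by apply: measurable_coin_shift_preimage; exact: measurable_cyl.
have pF : 0 <= prob P (cyl F) <= 1.
  by rewrite prob_ge0 prob_le1//; exact: measurable_cyl.
have := @dominated_cvg_measurable _ Omega R P (@cylinders I)
  (fun n A => prob P (A `&` iter n coin_shift @^-1` cyl F))
  (prob P (cyl F)) erefl (@cylinders_setI _) pF.
move=> H e e0; have [||||N NP] := H _ _ _ _ A mA e e0.
- by move=> n B mB; rewrite prob_ge0 prob_le//; exact: measurableI.
- move=> n B C mB mC BC; rewrite setIUl probU//; [exact: measurableI|exact: measurableI|].
  by rewrite setIACA BC set0I.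
- by rewrite -cyl_nil => e1 e10; have [N NP] := prob_mixing1 [::] F e10;
    exists N => n; rewrite mulrC; exact: NP.
- move=> _ [->|[F' _ ->]] e1 e10; last first.
    by have [N NP] := prob_mixing1 F' F e10; exists N => n; rewrite mulrC; exact: NP.
  by exists 0%N => n _; rewrite set0I prob_set0 mulr0 subrr normr0 ltW.
by exists N => n /NP; rewrite mulrC.
Qed.

(** Extension in the second argument; here domination by [prob B] also uses invariance. *)
Let prob_mixing A B : measurable A -> measurable B -> mixing A B.
Proof.
move=> mA mB; have mF n S : measurable S -> measurable (iter n coin_shift @^-1` S).
  by move=> mS; exact: measurable_coin_shift_preimage.
have pA : 0 <= prob P A <= 1 by rewrite prob_ge0 prob_le1.
have := @dominated_cvg_measurable _ Omega R P (@cylinders I)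
  (fun n B => prob P (A `&` iter n coin_shift @^-1` B))
  (prob P A) erefl (@cylinders_setI _) pA.
move=> H e e0; have [||||N NP] := H _ _ _ _ B mB e e0.
- move=> n S mS; rewrite prob_ge0 -(prob_coin_shift n mS) prob_le//; last exact: mF.
  by apply: measurableI => //; exact: mF.
- move=> n S C mS mC SC; rewrite preimage_setU setIUr probU//.
  + by apply: measurableI => //; exact: mF.
  + by apply: measurableI => //; exact: mF.
  + rewrite -subset0 => x [[_ xS] [_ xC]].
    by have : (S `&` C) (iter n coin_shift x) := conj xS xC; rewrite SC.
- by rewrite -cyl_nil; exact: prob_mixing2.
- move=> _ [->|[F' _ ->]]; last exact: prob_mixing2.
  move=> e1 e10; exists 0%N => n _.
  by rewrite preimage_set0 setI0 prob_set0 mulr0 subrr normr0 ltW.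
by exists N.
Qed.

Lemma coin_shift_mixing A B : measurable A -> measurable B ->
  P (A `&` iter n coin_shift @^-1` B) @[n --> \oo] --> (P A * P B)%E.
Proof.
move=> mA mB.
have mAB n : measurable (A `&` iter n coin_shift @^-1` B).
  by apply: measurableI => //; exact: measurable_coin_shift_preimage.
rewrite (probE P mA) (probE P mB) -EFinM.
under eq_cvg do rewrite (probE P (mAB _)).
apply: cvg_EFin; first by near=> n.
apply/cvgrPdist_le => e e0; have [N NP] := prob_mixing mA mB e0.
by exists N => // n /NP; rewrite distrC.
Unshelve. all: by end_near. Qed.

End bernoulli_shift.

(** * Random entire functions *)

Section coin_events.
Context (R : realType).
Notation I := (int * nat)%type.
Notation Omega := (coins I).
Context (P : probability Omega R).
Hypothesis PF : forall F, uniq (keys F) -> P (cyl F) = ((2^-1) ^+ size F)%:E.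
Implicit Types (F : seq (I * bool)) (k : int) (x : Omega) (n l K : nat).

Lemma prob_cyl_indep F F' : uniq (keys F') -> ~~ has [in keys F] (keys F') ->
  prob P (cyl F `&` cyl F') = prob P (cyl F) * 2^-1 ^+ size F'.
Proof.
move=> uF' FF'; have [->|[G [uG -> GF]]] := cyl_normalize F.
  by rewrite set0I prob_set0 mul0r.
rewrite -cyl_cat !prob_cyl// ?size_cat ?exprD//.
rewrite /keys map_cat cat_uniq uG uF' andbT /=.
by apply: contra FF' => /hasP[i iF' iG]; apply/hasP; exists i => //; exact: GF.
Qed.

Lemma prob_cyl_gt0 F x : cyl F x -> 0 < prob P (cyl F).
Proof.
have [->//|[G [uG -> _]] _] := cyl_normalize F.
by rewrite prob_cyl// exprn_gt0.
Qed.

Definition column k n : seq (I * bool) :=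
  map (fun j => ((k, j), true)) (iota 0 n).

Lemma column_cyl k n x : cyl (column k n) x <-> forall j, (j < n)%N -> x (k, j).
Proof.
split=> [H j jn|H ib /mapP[j]].
  by apply: (H ((k, j), true)); apply/mapP; exists j => //; rewrite mem_iota.
by rewrite mem_iota add0n => /H xj ->.
Qed.

Lemma keys_column k n : keys (column k n) = map (pair k) (iota 0 n).
Proof. by rewrite /keys /column -map_comp. Qed.

Lemma uniq_column k n : uniq (keys (column k n)).
Proof. by rewrite keys_column map_inj_uniq ?iota_uniq// => i j []. Qed.

Lemma size_column k n : size (column k n) = n.
Proof. by rewrite size_map size_iota. Qed.

Definition first_tail x k l := (forall j, (j < l)%N -> x (k, j)) /\ x (k, l) = false.

Definition pattern k l := rcons (column k l) ((k, l), false).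

Lemma pattern_cyl k l x : cyl (pattern k l) x <-> first_tail x k l.
Proof.
rewrite /pattern -cats1 cyl_cat cyl_cons cyl_nil setIT; split=> [[]|[]].
  by move=> /column_cyl.
by move=> H1 H2; split=> //; exact/column_cyl.
Qed.

Lemma first_tail_uniq x k l l' : first_tail x k l -> first_tail x k l' -> l = l'.
Proof.
move=> [h1 h2] [h3 h4]; case: (ltngtP l l') => // [/h3|/h1].
  by rewrite h2.
by rewrite h4.
Qed.

(** The default 0 concerns only rows consisting of heads, which are excluded on [good K]. *)
Definition run x k : nat :=
  if pselect (exists l, first_tail x k l) is left ex then projT1 (cid ex) else 0%N.

Lemma runP x k l : first_tail x k l -> run x k = l.
Proof.
move=> xl; rewrite /run; case: pselect => [ex|[]]; last by exists l.
by case: cid => l' /= /first_tail_uniq; apply.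
Qed.

(** The event that the run of row [k] exceeds [|k| + K]; its probability is summable over [k] with a
    sum tending to 0 as [K] grows, a quantitative Borel-Cantelli argument. *)
Definition long K k := cyl (column k (`|k| + K).+1).

Lemma long_measurable K k : measurable (long K k : set Omega).
Proof. exact: measurable_cyl. Qed.

Lemma prob_long F K k : (forall j, (k, j) \notin keys F) ->
  prob P (cyl F `&` long K k) = prob P (cyl F) * (2^-1 ^+ (`|k| + K).+1).
Proof.
move=> kF; rewrite prob_cyl_indep ?size_column//; first exact: uniq_column.
by apply/hasPn => i; rewrite keys_column => /mapP[j _ ->]; exact: kF.
Qed.

Lemma short_first_tail x K k : ~ long K k x ->
  exists2 l, (l <= `|k| + K)%N & first_tail x k l.
Proof.
move=> xl; have ex : exists j, (j < (`|k| + K).+1)%N && ~~ x (k, j).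
  apply: contrapT => no; apply: xl; apply/column_cyl => j jk.
  by apply: contrapT => /negP xj; apply: no; exists j; rewrite jk.
case: (ex_minnP ex) => l /andP[lk xl'] lmin; exists l => //; split; last exact/negbTE.
move=> j jl; apply: contrapT => /negP xj.
have := lmin j; rewrite xj andbT (ltn_trans jl lk) => /(_ isT).
by rewrite leqNgt jl.
Qed.

(** The rows [i] and [-(i + 1)] together enumerate all integers by naturals, as [pair_term] does for
    the series. *)
Definition long_pair K (i : nat) : set Omega := long K i%:Z `|` long K (- i.+1%:Z).

Lemma long_pair_measurable K i : measurable (long_pair K i).
Proof. by apply: measurableU; exact: long_measurable. Qed.

(** The rows concerned are free in [F], so the events are independent of [cyl F]. The pair at [i]
    costs [2^-(i+K+1) + 2^-(i+K+2)], that is [3/4 2^-(i+K)], and summing over [i >= N] doubles the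
    first term. *)
Lemma prob_long_tail F K N :
  (forall i j, (N <= i)%N -> (i%:Z, j) \notin keys F) ->
  (forall i j, (N <= i)%N -> (- i.+1%:Z, j) \notin keys F) ->
  prob P (\bigcup_i (cyl F `&` long_pair K (i + N)%N)) <=
  prob P (cyl F) * (3 / 2 * 2^-1 ^+ (N + K)).
Proof.
move=> F1 F2; have h01 : 0 <= (2^-1 : R) < 1 by rewrite invr_ge0 ler0n invf_lt1// ltr1n.
have -> : prob P (cyl F) * (3 / 2 * 2^-1 ^+ (N + K)) =
   prob P (cyl F) * (3 / 4 * 2^-1 ^+ (N + K)) / (1 - 2^-1) by field.
apply: prob_bigcup_geometric => // n.
  by apply: measurableI; [exact: measurable_cyl|exact: long_pair_measurable].
rewrite setIUr -(setDUK (@subsetUl _ _ (cyl F `&` long K (- (n + N)%N.+1%:Z)))).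
have m1 : measurable (cyl F `&` long K (n + N)%N%:Z : set Omega).
  by apply: measurableI; exact: measurable_cyl.
have m2 : measurable (cyl F `&` long K (- (n + N)%N.+1%:Z) : set Omega).
  by apply: measurableI; exact: measurable_cyl.
rewrite probU//; last 2 first.
  by apply: measurableD => //; exact: measurableU.
  exact: setDIK.
have := prob_long K (F1 (n + N)%N ^~ (leq_addl _ _)).
have := prob_long K (F2 (n + N)%N ^~ (leq_addl _ _)).
rewrite abszN !absz_nat => E2 E1; rewrite E1.
have : prob P ((cyl F `&` long K (n + N)%N `|` cyl F `&` long K (- (n + N)%N.+1%:Z)) `\`
    cyl F `&` long K (n + N)%N) <= prob P (cyl F `&` long K (- (n + N)%N.+1%:Z)).
  apply: prob_le => //; first by apply: measurableD => //; exact: measurableU.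
  by move=> x [[]].
rewrite E2 => H; rewrite (le_trans (lerD (lexx _) H))// -mulrDr.
rewrite -[leRHS]mulrA ler_wpM2l ?prob_ge0//.
rewrite !addSn !exprS -!addnA !exprD; lra.
Qed.

Definition good K : set Omega := ~` \bigcup_i (long_pair K i).

Lemma good_measurable K : measurable (good K).
Proof.
apply: measurableC; apply: bigcupT_measurable => i.
exact: long_pair_measurable.
Qed.

Lemma goodP K x : good K x <-> forall k, ~ long K k x.
Proof.
split=> [gx k kx|H [i _ []]]; [|exact: H|exact: H].
apply: gx; case: k kx => n nx; first by exists n => //; left.
by exists n => //; right; rewrite -NegzE.
Qed.

Lemma good_run K x k : good K x -> (run x k <= `|k| + K)%N.
Proof.
move=> /goodP/(_ k)/short_first_tail[l lK]; by move=> /runP ->.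
Qed.

Lemma good_first_tail K x k : good K x -> first_tail x k (run x k).
Proof.
by move=> /goodP/(_ k)/short_first_tail[l _ xl]; rewrite (runP xl).
Qed.

Definition Good : set Omega := \bigcup_K good K.

Lemma Good_measurable : measurable Good.
Proof. by apply: bigcupT_measurable => K; exact: good_measurable. Qed.

Lemma prob_Good : prob P Good = 1.
Proof.
apply/le_anti; rewrite prob_le1/=; last exact: Good_measurable.
apply/ler_addgt0Pl => e e0.
have h01 : 0 <= (2^-1 : R) < 1 by rewrite invr_ge0 ler0n invf_lt1// ltr1n.
have [K KP] := ge0_expr_lt (3 / 2) h01 e0.
have := @prob_long_tail [::] K 0; rewrite cyl_nil prob_setT mul1r add0n.
move=> /(_ (fun _ _ _ => isT) (fun _ _ _ => isT)).
have -> : \bigcup_i (setT `&` long_pair K (i + 0)%N) = ~` good K.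
  by rewrite /good setCK; apply: eq_bigcupr => i _; rewrite setTI addn0.
move=> /le_trans/(_ KP) H.
have mK := good_measurable K.
have : prob P (good K) + prob P (~` good K) = 1.
  rewrite -probU//; [|exact: measurableC|exact: setICr].
  by rewrite setUv prob_setT.
have : prob P (good K) <= prob P Good.
  by rewrite prob_le//; [exact: Good_measurable|move=> x gx; exists K].
lra.
Qed.

(** Identities for the random series hold on [Good] only; this turns them into equalities of
    probabilities. *)
Lemma prob_eq_Good A B : measurable A -> measurable B ->
  A `&` Good = B `&` Good -> P A = P B.
Proof.
suff H A' : measurable A' -> prob P A' = prob P (A' `&` Good).
  by move=> mA mB AB; rewrite (probE P mA) (probE P mB) H// AB -H.
move=> mA; have mG := Good_measurable.
have mI : measurable (A' `&` Good) by exact: measurableI.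
have mD : measurable (A' `\` Good) by exact: measurableD.
have z : prob P (A' `\` Good) = 0.
  apply/le_anti; rewrite prob_ge0 andbT.
  have : prob P Good + prob P (~` Good) = 1.
    rewrite -probU//; [|exact: measurableC|exact: setICr].
    by rewrite setUv prob_setT.
  rewrite prob_Good.
  have : prob P (A' `\` Good) <= prob P (~` Good).
    by apply: prob_le; [by []|exact: measurableC|move=> x []].
  lra.
rewrite -{1}(setUIDK A' Good) probU ?z ?addr0//.
by rewrite -subset0 => x [[_ g] [_]].
Qed.

Lemma run_shift x k : run (coin_shift x) k = run x (k + 1).
Proof. by []. Qed.

(** Row [k] becomes row [k + 1] and [|k + 1| <= |k| + 1], so the allowance grows by one. *)
Lemma good_shift K x : good K x -> good K.+1 (coin_shift x).
Proof.
move=> /goodP gx; apply/goodP => k /column_cyl H; apply: (gx (k + 1)).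
apply/column_cyl => j jK; apply: (H j); rewrite (leq_trans jK)// ltnS.
by lia.
Qed.

Lemma Good_iter n x : Good x -> Good (iter n coin_shift x).
Proof.
elim: n => // n IH /IH[K _ gx]; exists K.+1 => //=.
exact: good_shift.
Qed.

End coin_events.

(** * The random series of bi-orbits and its law *)

Section random_entire.
Context (R : realType).
Notation E := (entire R[i]).
Notation Omega := (coins (int * nat)%type).
Context (T : {linear E -> E}) (Z : nat -> int -> E).
Hypothesis T_bounded : forall r : R, exists s, forall (f : E) M,
  bounded_disc f s M -> bounded_disc (T f) r M.
Hypothesis Z_T : forall l k, T (Z l k) = Z l (k - 1).
Hypothesis Z_0 : forall k, Z 0 k = 0.
Hypothesis Z_bounded : forall r : R, exists D, forall l k,
  bounded_disc (Z l k) r (D * (3 / 2) ^+ l * 2^-1 ^+ `|k|).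
Hypothesis Z_dense : forall (f : E) (r e : R), 0 < e ->
  exists l, bounded_disc (f - Z l 0) r e.
Implicit Types (x : Omega) (r C D e : R) (n K : nat) (f g : E).

(* [run x k <= `|k| + K] on [good K], so the terms are at most a constant times
   [(3 / 2 * 2^-1) ^+ `|k|]. *)
Let q : R := 3 / 4.

Let q01 : 0 <= q < 1.
Proof. by rewrite /q; apply/andP; split; lra. Qed.

Let term x (k : int) : E := Z (run x k) k.

Let pair_term x n : E := term x n%:Z + term x (- n.+1%:Z).

Let pow_le K n m : (m <= n + K)%N ->
  (3 / 2) ^+ m * 2^-1 ^+ n <= (3 / 2) ^+ K * q ^+ n :> R.
Proof.
move=> mnK; rewrite (@le_trans _ _ ((3 / 2) ^+ (n + K) * 2^-1 ^+ n))//.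
  rewrite ler_wpM2r ?exprn_ge0 ?invr_ge0// ler_weXn2l//; lra.
rewrite exprD mulrAC mulrC -exprMn.
by rewrite (_ : 3 / 2 * 2^-1 = q)// /q; field.
Qed.

Let bounded_disc_nonneg_const r D : (forall l k,
    bounded_disc (Z l k) r (D * (3 / 2) ^+ l * 2^-1 ^+ `|k|)) -> forall l k,
  bounded_disc (Z l k) r (`|D| * ((3 / 2) ^+ l * 2^-1 ^+ `|k|)).
Proof.
move=> ZD l k; apply: bounded_discW (ZD l k) => //.
by rewrite -mulrA ler_wpM2r ?ler_norm.
Qed.

Let term_bound r : exists2 D, 0 <= D & forall K x k, good K x ->
  bounded_disc (term x k) r (D * (3 / 2) ^+ K * q ^+ `|k|).
Proof.
have [D /bounded_disc_nonneg_const DP] := Z_bounded r; exists `|D| => // K x k gx.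
apply: bounded_discW (DP _ _) => //.
by rewrite -mulrA ler_wpM2l// pow_le// good_run.
Qed.

Let pair_term_bound r : exists2 D, 0 <= D & forall K x n, good K x ->
  bounded_disc (pair_term x n) r (D * (3 / 2) ^+ K * q ^+ n).
Proof.
have [D D0 DP] := term_bound r; exists (2 * D); first by rewrite mulr_ge0.
move=> K x n gx.
apply: bounded_discW (bounded_discD (DP K x n%:Z gx) (DP K x (- n.+1%:Z) gx)) => //.
rewrite abszN !absz_nat exprS.
have : 0 <= D * (3 / 2) ^+ K * q ^+ n.
  rewrite mulr_ge0 ?mulr_ge0 ?exprn_ge0//.
  by case/andP: q01.
rewrite -[2 * D * _]mulrA; set y := D * _; set w := q ^+ n => h.
by rewrite /q; lra.
Qed.

Let geometric_pair_term x : Good x -> geometric (pair_term x) q.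
Proof.
move=> [K _ gx] r; have [D _ DP] := pair_term_bound r.
by exists (D * (3 / 2) ^+ K) => n; exact: DP.
Qed.

(** The value 0 off [Good] keeps the map total and measurable; [Good] has full probability. *)
Definition random_entire x : E :=
  if pselect (Good x) is left gx then
    projT1 (cid (geometric_series_entire q01 (geometric_pair_term gx))) else 0.

Let Phi := random_entire.

Let partial x n : E := \sum_(0 <= i < n) pair_term x i.

(** The factor 8 is [2 / (1 - q)]. *)
Let PhiP x r C : Good x ->
  (forall n, bounded_disc (pair_term x n) r (C * q ^+ n)) ->
  forall n, bounded_disc (Phi x - partial x n) r (8 * C * q ^+ n).
Proof.
move=> gx HC n; rewrite /Phi /random_entire; case: pselect => // gx'.
case: cid => F /= FP; apply: bounded_discW (FP r C HC n) => //.
by rewrite (_ : 2 * C / (1 - q) = 8 * C)// /q; field.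
Qed.

Let term_shift x k : term (coin_shift x) k = T (term x (k + 1)).
Proof. by rewrite /term Z_T addrK run_shift. Qed.

(** [partial x n] runs over [-n <= k < n]. The shift moves this window by one, adding the term [n]
    and dropping the term [-n]. *)
Let partial_shift x n : partial (coin_shift x) n =
  T (partial x n + term x n%:Z - term x (- n%:Z)).
Proof.
elim: n => [|n IH].
  by rewrite /partial !big_geq// oppr0 add0r subrr linear0.
rewrite /partial big_nat_recr//= [X in T (X + _ - _)]big_nat_recr//=.
rewrite -!/(partial _ _) IH /pair_term !term_shift -!linearD; congr (T _).
have -> : n%:Z + 1 = n.+1%:Z by rewrite -PoszD addn1.
have -> : - n.+1%:Z + 1 = - n%:Z by rewrite -addn1 PoszD; ring.
set a := partial x n; set b := term x n%:Z; set c := term x (- n%:Z).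
set d := term x n.+1%:Z; set e := term x (- n.+1%:Z).
rewrite addrA -addrA [d + c]addrC addrA subrK.
by rewrite addrA [a + b + e + d]addrAC addrK.
Qed.

Let eq_entire f g : (forall r e, 0 < e -> bounded_disc (f - g) r e) -> f = g.
Proof.
move=> fg; apply: entire_eq => z; apply/eqP; rewrite -subr_eq0; apply/eqP.
apply/cabs_eq0/le_anti; rewrite cabs_ge0 andbT; apply/ler_addgt0Pl => e e0.
by rewrite addr0; exact: fg (lexx (cabs z)).
Qed.

Let Phi_shift x : Good x -> Phi (coin_shift x) = T (Phi x).
Proof.
move=> gx; have gsx : Good (coin_shift x) := Good_iter 1 gx.
have [K _ gK] := gx; have gK1 := good_shift gK.
apply: eq_entire => r e e0.
have [s sP] := T_bounded r.
have [D1 D10 D1P] := pair_term_bound r.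
have [D2 D20 D2P] := pair_term_bound s.
have [D3 D30 D3P] := term_bound s.
pose A := D1 * (3 / 2) ^+ K.+1; pose B := D2 * (3 / 2) ^+ K.
pose C := D3 * (3 / 2) ^+ K.
have [n nP] := ge0_expr_lt (8 * A + (8 * B + (C + C))) q01 e0.
have -> : Phi (coin_shift x) - T (Phi x) =
    (Phi (coin_shift x) - partial (coin_shift x) n) -
    (T (Phi x - partial x n) - (T (term x n%:Z) - T (term x (- n%:Z)))).
  rewrite partial_shift !(linearB T) (linearD T); apply: entire_eq => z.
  by rewrite !(entire_subE, entire_addE); ring.
have E : (8 * A + (8 * B + (C + C))) * q ^+ n =
    8 * A * q ^+ n + (8 * B * q ^+ n + (C * q ^+ n + C * q ^+ n)) by ring.
rewrite E in nP; apply: bounded_discW (lexx r) nP _.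
apply: bounded_discB; first exact: (@PhiP _ r A gsx (fun m => D1P _ _ m gK1) n).
apply: bounded_discB.
  by apply: sP; exact: (@PhiP _ s B gx (fun m => D2P _ _ m gK) n).
have := D3P _ _ (- n%:Z) gK; have := D3P _ _ n%:Z gK.
by rewrite abszN !absz_nat => H1 H2; apply: bounded_discB; exact: sP.
Qed.

Let Phi_iter n x : Good x -> Phi (iter n coin_shift x) = iter n T (Phi x).
Proof.
move=> gx; elim: n => // n IH.
by rewrite iterS Phi_shift ?IH//; exact: Good_iter.
Qed.

Let first_tail_event (p : seq (nat * nat)) : set Omega :=
  \bigcap_(i in `I_(size p))
    (cyl (pattern i%:Z (nth (0, 0)%N p i).1) `&`
     cyl (pattern (- i.+1%:Z) (nth (0, 0)%N p i).2)).

Let first_tail_event_measurable p : measurable (first_tail_event p).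
Proof.
apply: bigcap_measurableType => i _.
by apply: measurableI; exact: measurable_cyl.
Qed.

Let first_tail_event_runs x n : Good x ->
  first_tail_event (mkseq (fun i => (run x i%:Z, run x (- i.+1%:Z))) n) x.
Proof.
move=> [K _ gx] i; rewrite /= size_mkseq => ni; rewrite nth_mkseq//=.
by split; apply/pattern_cyl; exact: good_first_tail gx.
Qed.

Let partial_first_tail_event p x y : first_tail_event p x ->
  first_tail_event p y -> partial x (size p) = partial y (size p).
Proof.
move=> xp yp; rewrite /partial; apply: eq_big_nat => i /andP[_ ip].
have [/pattern_cyl/runP x1 /pattern_cyl/runP x2] := xp i ip.
have [/pattern_cyl/runP y1 /pattern_cyl/runP y2] := yp i ip.
by rewrite /pair_term /term x1 x2 y1 y2.
Qed.

Let Phi_open K (U : set E) : open U -> exists Q : set (seq (nat * nat)),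
  Phi @^-1` U `&` good K = (\bigcup_(p in Q) first_tail_event p) `&` good K.
Proof.
move=> oU; exists [set p | first_tail_event p `&` good K `<=` Phi @^-1` U].
apply/seteqP; split => x [xU gx]; split=> //; last first.
  by case: xU => p pQ xp; exact: pQ.
have [r [e e0 eU]] := (entire_nbhsP (Phi x) U).1 (open_nbhs_nbhs (conj oU xU)).
have [D D0 DP] := pair_term_bound r; pose C := D * (3 / 2) ^+ K.
have [n nP] := ge0_expr_lt (8 * C + 8 * C) q01 e0.
have Gx : Good x by exists K.
have xp := @first_tail_event_runs x n Gx; set p := mkseq _ _ in xp.
exists p => // y [yp gy]; apply: eU; have Gy : Good y by exists K.
have sp : size p = n by rewrite size_mkseq.
have pxy := partial_first_tail_event xp yp; rewrite sp in pxy.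
have -> : Phi x - Phi y = (Phi x - partial x n) - (Phi y - partial y n).
  by rewrite pxy; apply: entire_eq => z; rewrite !entire_subE; ring.
rewrite mulrDl in nP; apply: bounded_discW (lexx r) nP _; apply: bounded_discB.
  exact: (@PhiP _ r C Gx (fun m => DP _ _ m gx) n).
exact: (@PhiP _ r C Gy (fun m => DP _ _ m gy) n).
Qed.

Lemma measurable_random_entire :
  measurable_fun setT (random_entire : Omega -> borel E).
Proof.
refine (@measurability _ _ _ (borel E) _ _ (@open E) _ _) => //.
move=> _ [U oU <-]; rewrite setTI.
have -> : random_entire @^-1` U = (\bigcup_K (Phi @^-1` U `&` good K)) `|`
    (Phi @^-1` U `&` ~` Good).
  by rewrite -setI_bigcupr -setIUr -/Good setUv setIT.
apply: measurableU.
  apply: bigcupT_measurable => K; have [Q ->] := Phi_open K oU.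
  apply: measurableI; last exact: good_measurable.
  rewrite bigcup_mkcond; apply: countable_bigcupT_measurable; first exact: countableP.
  move=> p.
  by case: ifP => // _.
(* Off [Good] the value is constantly 0, so that part of the preimage is everything or nothing. *)
have [U0|U0] := pselect (U 0).
  rewrite setIidr; first by apply: measurableC; exact: Good_measurable.
  by move=> x gx; rewrite /= /Phi /random_entire; case: pselect.
rewrite (_ : _ `&` _ = set0) // -subset0 => x [+ gx].
by rewrite /= /Phi /random_entire; case: pselect.
Qed.

Let T_measurable n : measurable_fun setT (iter n T : borel E -> borel E).
Proof.
have T1 : measurable_fun setT (T : borel E -> borel E).
  refine (@measurability _ _ _ (borel E) _ _ (@open E) _ _) => //.
  move=> _ [U oU <-]; rewrite setTI; apply: sub_sigma_algebra.
  suff /continuousP : continuous T by exact.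
  move=> f V /entire_nbhsP[r [e e0 eV]]; have [s sP] := T_bounded r.
  apply: ((entire_nbhsP f (T @^-1` V)).2); exists s, e => // g fg; apply: eV.
  by rewrite -(linearB T); exact: sP.
elim: n => [|n IH]; first exact: measurable_id.
exact: measurableT_comp T1 IH.
Qed.

Context (P : probability Omega R).
Hypothesis PF : forall F, uniq (keys F) -> P (cyl F) = ((2^-1) ^+ size F)%:E.
Context (mu : probability (borel E) R).
Hypothesis muE : forall A, mu A = P (random_entire @^-1` A).

Let mPhi A : measurable (A : set (borel E)) -> measurable (Phi @^-1` A).
Proof.
by move=> mA; rewrite -[X in measurable X]setTI; exact: measurable_random_entire.
Qed.

Let mT n A : measurable (A : set (borel E)) ->
  measurable (iter n T @^-1` A : set (borel E)).
Proof.
by move=> mA; rewrite -[X in measurable X]setTI; exact: T_measurable.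
Qed.

Let Phi_preimage n A : Phi @^-1` (iter n T @^-1` A) `&` Good =
  iter n coin_shift @^-1` (Phi @^-1` A) `&` Good.
Proof. by apply/seteqP; split=> x [/= + gx]; rewrite Phi_iter. Qed.

Lemma random_entire_strongly_mixing : strongly_mixing T mu.
Proof.
split=> [A mA|A B mA mB].
  rewrite !muE -[RHS](coin_shift_invariant PF 1 (mPhi mA)).
  apply: (prob_eq_Good PF); [exact: mPhi (mT 1 mA)| |exact: (Phi_preimage 1)].
  exact: measurable_coin_shift_preimage (mPhi mA).
rewrite !muE; have := coin_shift_mixing PF (mPhi mA) (mPhi mB).
apply: cvg_trans; apply: near_eq_cvg; near=> n.
rewrite muE; apply: (prob_eq_Good PF).
- apply: measurableI; [exact: mPhi|].
  exact: measurable_coin_shift_preimage (mPhi mB).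
- by apply: mPhi; apply: measurableI => //; exact: mT.
by rewrite preimage_setI -!setIA Phi_preimage.
Unshelve. all: by end_near. Qed.

(** In the rows [-N] to [N - 1] all runs are 0 except the one of row 0, which is [l]. As [Z 0 = 0],
    the partial sum is then exactly [Z l 0]. *)
Fixpoint prescribed l N : seq ((int * nat) * bool) :=
  if N is i.+1 then
    prescribed l i ++
    (pattern i%:Z (if i == 0%N then l else 0%N) ++ pattern (- i.+1%:Z) 0)
  else [::].

Let prescribedP l N x : cyl (prescribed l N) x <->
  forall i, (i < N)%N -> first_tail x i%:Z (if i == 0%N then l else 0%N) /\
                         first_tail x (- i.+1%:Z) 0.
Proof.
elim: N => [|N IH]; first by rewrite cyl_nil.
rewrite /= !cyl_cat; split=> [[/IH H [/pattern_cyl h1 /pattern_cyl h2]] i|H].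
  by rewrite ltnS leq_eqVlt => /orP[/eqP ->//|]; exact: H.
split; first by apply/IH => i iN; apply: H; exact: ltnW.
by have [h1 h2] := H N (ltnSn N); split; exact/pattern_cyl.
Qed.

Let keys_pattern k l k' j : (k', j) \in keys (pattern k l) -> k' = k.
Proof.
rewrite /keys /pattern map_rcons mem_rcons inE => /orP[/eqP[->]//|].
by rewrite -/(keys _) keys_column => /mapP[j' _ [->]].
Qed.

Let prescribed_keys l N k j : (k, j) \in keys (prescribed l N) ->
  exists2 i, (i < N)%N & k = i%:Z \/ k = - i.+1%:Z.
Proof.
elim: N => [//|N IH]; rewrite /= /keys !map_cat !mem_cat => /or3P[/IH[i iN kE]|h|h].
- by exists i => //; exact: ltnW.
- by exists N => //; left; exact: keys_pattern h.
- by exists N => //; right; exact: keys_pattern h.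
Qed.

Let prescribed_point l N : exists x, cyl (prescribed l N) x.
Proof.
exists (fun i => (i.1 == 0) && (i.2 < l)%N); apply/prescribedP => i _.
split; last by split.
by case: i => [|i]; split => //=; rewrite ltnn.
Qed.

Section prescribed_start.
Context (l N : nat) (x : Omega).
Hypothesis xF : cyl (prescribed l N) x.
Hypothesis xN : forall i, (N <= i)%N -> ~ long_pair 0 i x.

Let run_pos i : (i < N)%N -> run x i%:Z = if i == 0%N then l else 0%N.
Proof. by move=> iN; have [/runP] := (prescribedP l N x).1 xF i iN. Qed.

Let run_neg i : (i < N)%N -> run x (- i.+1%:Z) = 0%N.
Proof. by move=> iN; have [_ /runP] := (prescribedP l N x).1 xF i iN. Qed.

(** The allowance [l] is forced by row 0; the other rows would need no allowance. *)
Let prescribed_good : good l x.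
Proof.
move=> [i _]; have [iN|Ni] := ltnP i N.
  have [[_ h1] [_ h2]] := (prescribedP l N x).1 xF i iN.
  case=> /column_cyl H.
    by have := H (if i == 0%N then l else 0%N); rewrite h1 ltnS; case: ifP => _;
      rewrite ?leq_addl// => /(_ isT).
  by have := H 0%N; rewrite h2 => /(_ isT).
have := xN Ni; rewrite /long_pair => xi [] /column_cyl H; apply: xi; [left|right];
  apply/column_cyl => j; rewrite addn0 => ji; apply: H;
  by rewrite (leq_trans ji)// ltnS leq_addr.
Qed.

Let run_short i : (N <= i)%N ->
  (run x i%:Z <= i)%N /\ (run x (- i.+1%:Z) <= i.+1)%N.
Proof.
move=> Ni; have xi := xN Ni.
have [l1 h1 /runP ->] : exists2 l, (l <= `|i%:Z| + 0)%N & first_tail x i%:Z l.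
  by apply: short_first_tail => xl; apply: xi; left.
have [l2 h2 /runP ->] : exists2 l, (l <= `|(- i.+1%:Z)%R| + 0)%N &
    first_tail x (- i.+1%:Z) l.
  by apply: short_first_tail => xl; apply: xi; right.
by move: h1 h2; rewrite abszN !absz_nat !addn0.
Qed.

Let partial_prescribed : (0 < N)%N -> partial x N = Z l 0.
Proof.
move=> N0; rewrite /partial big_ltn// big_nat_cond big1 ?addr0; last first.
  move=> i /andP[/andP[i0 iN] _]; rewrite /pair_term /term run_pos// run_neg//.
  by rewrite gt_eqF// !Z_0 addr0.
by rewrite /pair_term /term run_pos// run_neg// Z_0 addr0.
Qed.

(** Half of [e] pays for approximating [f] by the prescribed partial sum, half for the tail of the
    series. In the constant, [(3 / 2) ^+ l] covers row 0 and 2 covers the two rows of a pair beyond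
    [N]. *)
Lemma random_entire_prescribed f r e D : (0 < N)%N ->
  bounded_disc (f - Z l 0) r (e / 2) ->
  (forall l' k, bounded_disc (Z l' k) r (`|D| * ((3 / 2) ^+ l' * 2^-1 ^+ `|k|))) ->
  8 * (`|D| * (2 + (3 / 2) ^+ l)) * q ^+ N <= e / 2 ->
  bounded_disc (f - random_entire x) r e.
Proof.
move=> N0 fZ DP Ne; set C := `|D| * (2 + (3 / 2) ^+ l) in Ne.
have [/andP[q0 _] l0] := (q01, exprn_ge0 l (divr_ge0 (ler0n R 3) (ler0n R 2))).
have C0 : 0 <= C by rewrite mulr_ge0// addr_ge0.
have HC n : bounded_disc (pair_term x n) r (C * q ^+ n).
  have [nN|Nn] := ltnP n N.
    rewrite /pair_term /term run_pos// run_neg// Z_0 addr0.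
    case: ifP => [/eqP ->|_].
      apply: bounded_discW (DP l 0) => //.
      by rewrite absz0 !expr0 !mulr1 ler_wpM2l// lerDr.
    rewrite Z_0 => z _; rewrite entire_zeroE cabs0.
    by rewrite mulr_ge0// exprn_ge0.
  have [h1 h2] := run_short Nn.
  apply: bounded_discW (bounded_discD (DP (run x n%:Z) n%:Z)
    (DP (run x (- n.+1%:Z)) (- n.+1%:Z))) => //.
  rewrite abszN !absz_nat -mulrDr -mulrA ler_wpM2l//.
  have := @pow_le 0 n (run x n%:Z); rewrite addn0 expr0 mul1r => /(_ h1) H1.
  have := @pow_le 0 n.+1 (run x (- n.+1%:Z)).
  rewrite addn0 expr0 mul1r => /(_ h2) H2.
  rewrite (le_trans (lerD H1 H2))// exprS mulrDl.
  have qn : 0 <= q ^+ n by rewrite exprn_ge0.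
  have : 0 <= (3 / 2) ^+ l * q ^+ n by rewrite mulr_ge0.
  by move: qn; set w := q ^+ n; rewrite /q; lra.
have gx : Good x by exists l => //; exact: prescribed_good.
have -> : f - random_entire x = (f - Z l 0) - (Phi x - partial x N).
  by rewrite partial_prescribed//; apply: entire_eq => z; rewrite !entire_subE; ring.
rewrite [e]splitr; apply: bounded_discB => //.
exact: bounded_discW (lexx r) Ne (@PhiP _ r C gx HC N).
Qed.

End prescribed_start.

Lemma random_entire_full_support : full_support mu.
Proof.
move=> U oU [f Uf].
have [r [e e0 eU]] := (entire_nbhsP f U).1 (open_nbhs_nbhs (conj oU Uf)).
have e2 : 0 < e / 2 by rewrite divr_gt0.
have [l fZ] := Z_dense f r e2.
have [D /bounded_disc_nonneg_const DP] := Z_bounded r.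
have [n nP] := ge0_expr_lt (8 * (`|D| * (2 + (3 / 2) ^+ l)) * q) q01 e2.
pose F := prescribed l n.+1.
have [x0 x0F] := prescribed_point l n.+1.
have p0 := prob_cyl_gt0 PF x0F; rewrite -/F in p0.
pose B : set Omega := \bigcup_i (cyl F `&` long_pair 0 (i + n.+1)%N).
have mF : measurable (cyl F : set Omega) := measurable_cyl F.
have mB : measurable B.
  apply: bigcupT_measurable => i; apply: measurableI => //.
  exact: long_pair_measurable.
have BF : B `<=` cyl F by move=> x [i _ []].
have PB : prob P B <= prob P (cyl F) * (3 / 2 * 2^-1 ^+ (n.+1 + 0)).
  apply: (prob_long_tail PF) => i j ni; apply/negP => /prescribed_keys[k kn].
    by case=> [/eqP|/eqP]; lia.
  by case=> [/eqP|/eqP]; lia.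
(* On [V] the prescribed rows are as required and no later run is long. Discarding [B] removes at
   most 3/4 of the probability of [cyl F], because the exponent is at least 1. *)
pose V : set Omega := cyl F `\` B.
have mFB : measurable V by exact: measurableD.
have FB0 : 0 < prob P V.
  have : prob P (cyl F) = prob P B + prob P V.
    by rewrite -probU// ?setDUK//; exact: setDIK.
  have : (3 / 2 * 2^-1 ^+ (n.+1 + 0)) <= 3 / 4 :> R.
    rewrite addn0 exprS mulrA (_ : 3 / 2 / 2 = 3 / 4); last by field.
    by rewrite ler_piMr// exprn_ile1 ?invr_ge0 ?invf_le1 ?ler1n.
  move=> h1 h2; have h3 : prob P B <= prob P (cyl F) * (3 / 4).
    by apply: le_trans PB _; exact: ler_wpM2l (ltW p0) _ _ h1.
  by move: p0 h2 h3; lra.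
have mU : measurable (U : set (borel E)) by exact: sub_sigma_algebra.
rewrite muE (probE P (mPhi mU)) lte_fin (lt_le_trans FB0)// prob_le//; first exact: mPhi.
move=> x [xF xB]; apply: eU.
apply: (@random_entire_prescribed l n.+1 x xF _ f r e D) => //.
  move=> i ni xi; apply: xB; exists (i - n.+1)%N => //; split=> //.
  by rewrite subnK.
by apply: le_trans nP; rewrite le_eqVlt exprS; apply/orP; left; apply/eqP; ring.
Qed.

Lemma random_entire_hypercyclic : hypercyclic T.
Proof.
(* [mixT] is the invariance and [invT] the limit relation. *)
have [mixT invT] := random_entire_strongly_mixing.
pose V l n : set E := (([set g | bounded_disc (Z l 0 - g) n%:R (n.+1%:R^-1)])^°)%classic.
have VZ l n : V l n (Z l 0).
  by apply/entire_nbhsP; exists n%:R, n.+1%:R^-1; rewrite ?invr_gt0.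
have mV l n : measurable (V l n : set (borel E)).
  by apply: sub_sigma_algebra; exact: open_interior.
(* Functions whose orbit avoids [V l n]. The set is disjoint from every preimage of [V l n], so the
   limit [mu A * mu V] is 0, while [mu V] is positive by full support. *)
pose A l n : set (borel E) := \bigcap_k (iter k T @^-1` (~` V l n)).
have mA l n : measurable (A l n).
  by apply: bigcapT_measurable => k; apply: mT; exact: measurableC.
have A0 l n : prob mu (A l n) = 0.
  have := invT _ _ (mA l n) (mV l n).
  have -> : (fun k => mu (A l n `&` iter k T @^-1` V l n)) = fun=> 0%E.
    apply/funext => k; rewrite (_ : _ `&` _ = set0) ?measure0//.
    by rewrite -subset0 => g [/(_ k I)].
  move=> cv; have /eqP : (mu (A l n) * mu (V l n))%E = 0%E.
    exact: (@cvg_unique _ (@ereal_hausdorff R) _ _ _ _ cv (cvg_cst _)).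
  have := random_entire_full_support (open_interior _) (ex_intro _ _ (VZ l n)).
  rewrite mule_eq0 => /gt_eqF ->; rewrite orbF => /eqP.
  by rewrite /prob => ->.
(* The pairs [(l, n)] are enumerated through [unpickle]; the union is null by the geometric bound
   with constant and ratio 0. *)
pose B m : set (borel E) := if @unpickle (nat * nat)%type m is Some ln
  then A ln.1 ln.2 else set0.
have mB m : measurable (B m) by rewrite /B; case: unpickle.
have B0 : prob mu (\bigcup_m B m) <= 0.
  have q00 : 0 <= (0 : R) < 1 by rewrite lexx ltr01.
  rewrite -(mul0r (1 - 0)^-1); apply: prob_bigcup_geometric => // m.
  by rewrite mul0r /B; case: unpickle => [ln|]; rewrite ?A0 ?prob_set0.
have [f Bf] : exists f : E, ~ (\bigcup_m B m) f.
  apply: contrapT => no; move: B0; rewrite (_ : \bigcup_m B m = setT).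
    by rewrite prob_setT ler10.
  apply/seteqP; split=> // g _; apply: contrapT => Bg.
  by apply: no; exists g.
have hit l n : exists k, V l n (iter k T f).
  apply: contrapT => no; apply: Bf; exists (pickle (l, n)) => //.
  by rewrite /B pickleK => k _ /= Vk; apply: no; exists k.
exists f => U [g Ug] oU.
have [r [e e0 eU]] := (entire_nbhsP g U).1 (open_nbhs_nbhs (conj oU Ug)).
have [N1 _ N1P] : \forall n \near \oo, r < n%:R by exact: nbhs_infty_gtr.
have [N2 _ N2P] : \forall n \near \oo, 2 / e < n%:R by exact: nbhs_infty_gtr.
pose n := maxn N1 N2; have nr := N1P n (leq_maxl _ _).
have ne : 2 / n.+1%:R <= e.
  rewrite ler_pdivrMr// mulrC -ler_pdivrMr// ltW//.
  by apply: lt_trans (N2P n (leq_maxr _ _)) _; rewrite ltr_nat.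
have n0 : 0 < n.+1%:R^-1 :> R by rewrite invr_gt0.
have [l gl] := Z_dense g n%:R n0.
have [k /interior_subset /= Vk] := hit l n.
exists (iter k T f); split; last by exists k.
apply: eU; have -> : g - iter k T f = (g - Z l 0) + (Z l 0 - iter k T f).
  by rewrite addrA subrK.
apply: bounded_discW (ltW nr) ne _; rewrite mulr_natl mulr2n.
exact: bounded_discD.
Qed.

End random_entire.

(** * From a spanning family of bi-orbits to a dense sequence *)

Section countable_family.
Context (R : realType).
Notation E := (entire R[i]).
Context (T : {linear E -> E}) (X : nat -> int -> E).
Hypothesis X_T : forall i k, T (X i k) = X i (k - 1).
Hypothesis X_bounded : forall i (r : R), exists D, forall k,
  bounded_disc (X i k) r (D * 2^-1 ^+ `|k|).
Hypothesis X_dense : forall (f : E) (r e : R), 0 < e ->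
  exists n (a : nat -> R[i]), bounded_disc (f - \sum_(0 <= i < n) a i *: X i 0) r e.
Implicit Types (m : seq (rat * rat)) (k : int) (r e D : R) (l n : nat).

Let coef (c : rat * rat) : R[i] := (ratr c.1 +i* ratr c.2)%C.

Let comb m k : E := \sum_(0 <= i < size m) coef (nth (0, 0) m i) *: X i k.

Let comb_nil k : comb [::] k = 0.
Proof. by rewrite /comb big_geq. Qed.

Let comb_rcons m c k : comb (rcons m c) k = comb m k + coef c *: X (size m) k.
Proof.
rewrite /comb size_rcons big_nat_recr//= nth_rcons ltnn eqxx; congr (_ + _).
by apply: eq_big_nat => i /andP[_ im]; rewrite nth_rcons im.
Qed.

Let comb_T m k : T (comb m k) = comb m (k - 1).
Proof.
elim/last_ind: m => [|m c IH]; first by rewrite !comb_nil linear0.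
by rewrite !comb_rcons linearD linearZ /= IH X_T.
Qed.

Let comb_bounded m r : exists2 D, 0 <= D & forall k,
  bounded_disc (comb m k) r (D * 2^-1 ^+ `|k|).
Proof.
elim/last_ind: m => [|m c [D D0 DP]].
  exists 0 => // k z _; rewrite comb_nil entire_zeroE cabs0 mul0r//.
have [B BP] := X_bounded (size m) r.
exists (D + cabs (coef c) * `|B|); first by rewrite addr_ge0// mulr_ge0// cabs_ge0.
move=> k; rewrite comb_rcons mulrDl; apply: bounded_discD => //.
rewrite -mulrA; apply: bounded_discZ; apply: bounded_discW (BP k) => //.
by rewrite ler_wpM2r ?ler_norm// exprn_ge0 ?invr_ge0.
Qed.

Let coef_dense (a : R[i]) e : 0 < e -> exists c, cabs (a - coef c) <= e.
Proof.
move=> e0; have e2 : 0 < e / 2 by rewrite divr_gt0.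
have rd (x : R) : exists p : rat, `|x - ratr p| <= e / 2.
  have [p] := @rat_in_itvoo R (x - e / 2) (x + e / 2) ltac:(lra).
  by rewrite in_itv/= => /andP[h1 h2]; exists p; rewrite ler_norml; lra.
have [p pP] := rd (complex.Re a); have [s sP] := rd (complex.Im a).
exists (p, s); rewrite (le_trans (cabs_le_ReIm _))// cReB cImB /=.
by rewrite [leRHS]splitr lerD.
Qed.

Let xcomb (a : nat -> R[i]) n : E := \sum_(0 <= i < n) a i *: X i 0.

Let comb_approx (a : nat -> R[i]) n r e : 0 < e -> exists2 m, size m = n &
  bounded_disc (xcomb a n - comb m 0) r e.
Proof.
elim: n e => [|n IH] e e0.
  exists [::] => // z _; rewrite comb_nil /xcomb big_geq// subrr entire_zeroE cabs0.
  exact: ltW.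
have e2 : 0 < e / 2 by rewrite divr_gt0.
have [m mn mP] := IH _ e2.
have [B B0 BP] := entire_bounded (X n 0) r.
have B1 : 0 < B + 1 by rewrite ltr_wpDl.
have [c cP] := coef_dense (a n) (divr_gt0 e2 B1).
exists (rcons m c); first by rewrite size_rcons mn.
rewrite /xcomb big_nat_recr// comb_rcons mn opprD addrACA -scalerBl [e]splitr.
apply: (bounded_discD mP); apply: bounded_discW (bounded_discZ _ BP) => //.
rewrite (le_trans (ler_wpM2r B0 cP))// mulrAC ler_pdivrMr// ler_pM2l//.
by rewrite lerDl.
Qed.

Let comb_dense (f : E) r e : 0 < e -> exists m, bounded_disc (f - comb m 0) r e.
Proof.
move=> e0; have e2 : 0 < e / 2 by rewrite divr_gt0.
have [n [a aP]] := X_dense f r e2; have [m _ mP] := comb_approx a n r e2.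
exists m; rewrite [e]splitr.
have -> : f - comb m 0 = (f - xcomb a n) + (xcomb a n - comb m 0) by rewrite addrA subrK.
exact: (bounded_discD aP mP).
Qed.

Let cst m n : R := projT1 (cid2 (comb_bounded m n%:R)).

Let cst_ge0 m n : 0 <= cst m n.
Proof. by rewrite /cst; case: cid2. Qed.

Let cstP m n k : bounded_disc (comb m k) n%:R (cst m n * 2^-1 ^+ `|k|).
Proof. by rewrite /cst; case: cid2. Qed.

(** Every combination has its own constants, whereas one [D] must serve all [l] at a given radius.
    Delaying a combination to large indices lets [(3 / 2) ^+ l] absorb them. *)
Lemma ex_atoms : exists Z : nat -> int -> E,
  [/\ forall l k, T (Z l k) = Z l (k - 1),
      forall k, Z 0%N k = 0,
      forall r : R, exists D, forall l k,
        bounded_disc (Z l k) r (D * (3 / 2) ^+ l * 2^-1 ^+ `|k|)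
    & forall (f : E) (r e : R), 0 < e ->
        exists l, bounded_disc (f - Z l 0) r e].
Proof.
have [code [decode codeK]] : exists (code : seq (rat * rat) -> nat) decode,
    pcancel code decode by exists pickle, unpickle; exact: pickleK.
(* Only radii up to [code m] are required to be controlled, finitely many for each [m]. At a fixed
   radius [n] the exceptions are the finitely many [m] with [code m < n]. *)
pose slow m l := forall n, (n <= code m)%N -> cst m n <= (3 / 2) ^+ l.
(* [logn 2] takes every value at arbitrarily large arguments, so every [comb m]
   occurs at an index [l] at which its bounds are at most [(3 / 2) ^+ l]. *)
pose atom l k : E :=
  if l == 0%N then 0 else
  if decode (logn 2 l) is Some m then
    if `[< slow m l >] then comb m k else 0
  else 0.
exists atom; split => //.
- move=> l k; rewrite /atom; case: ifP => [_|_]; first by rewrite linear0.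
  case: (decode _) => [m|]; last by rewrite linear0.
  by case: asboolP => sl; [exact: comb_T|rewrite linear0].
- move=> r; have [n _ /(_ n (leqnn n)) /= rn] : \forall n \near \oo, r < n%:R.
    exact: nbhs_infty_gtr.
  (* [S] absorbs the combinations with code below [n], for which [slow] gives nothing at radius
     [n]. *)
  pose S := \sum_(0 <= j < n) if decode j is Some m
    then cst m n else 0.
  have S0 : 0 <= S by apply: sumr_ge0 => j _; case: (decode _).
  exists (S + 1) => l k.
  have l1 : 1 <= (3 / 2) ^+ l :> R by rewrite exprn_ege1//; lra.
  have zero_bound : bounded_disc (0 : E) r ((S + 1) * (3 / 2) ^+ l * 2^-1 ^+ `|k|).
    move=> z _; rewrite entire_zeroE cabs0 mulr_ge0 ?exprn_ge0 ?invr_ge0//.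
    by rewrite mulr_ge0 ?addr_ge0// (le_trans ler01).
  rewrite /atom; case: ifP => // _; case: (decode _) => // m.
  case: asboolP => // sl.
  apply: (bounded_discW (ltW rn) _ (@cstP m n k)).
  rewrite ler_wpM2r ?exprn_ge0 ?invr_ge0//.
  have [mn|nm] := ltnP (code m) n; last first.
    by rewrite (le_trans (sl n nm))// ler_peMl ?(le_trans ler01)// lerDr.
  have cS : cst m n <= S.
    rewrite /S big_mkord (bigD1 (Ordinal mn))//= codeK lerDl.
    by apply: sumr_ge0 => j _; case: (decode _).
  by rewrite (le_trans cS)// (@le_trans _ _ (S + 1)) ?lerDl// ler_peMr// addr_ge0.
- move=> f r e e0; have [m mP] := comb_dense f r e0.
  pose S := \sum_(0 <= n < (code m).+1) cst m n.
  have h01 : 0 <= (2 / 3 : R) < 1 by apply/andP; split; lra.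
  have [L LP] := ge0_expr_lt S h01 ltr01.
  (* The odd factor leaves the 2-adic valuation equal to [code m] while making [l] at least [L]. *)
  pose l := (2 ^ code m * (L.*2.+1))%N.
  have Ll : (L <= l)%N.
    rewrite /l (@leq_trans L.*2.+1)// ?leq_pmull ?expn_gt0//.
    by rewrite -addnn -addnS leq_addr.
  have l0 : (0 < l)%N by rewrite /l muln_gt0 expn_gt0.
  have lm : logn 2 l = code m.
    rewrite /l lognM ?expn_gt0// pfactorK// lognE /= dvdn2 /= odd_double.
    by rewrite addn0.
  exists l; rewrite /atom (gtn_eqF l0) lm codeK; rewrite asboolT// => n nm.
  have cS : cst m n <= S.
    rewrite /S big_mkord (bigD1 (Ordinal (nm : (n < (code m).+1)%N)))//= lerDl.
    exact: sumr_ge0.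
  have SL : S <= (3 / 2) ^+ L.
    rewrite -(@ler_pM2r _ ((2 / 3) ^+ L)) ?exprn_gt0//.
    by rewrite (le_trans LP)// -exprMn (_ : 3 / 2 * (2 / 3) = 1 :> R) ?expr1n//; field.
  rewrite (le_trans cS)// (le_trans SL)// ler_weXn2l//; lra.
Qed.

End countable_family.

(** The criterion shared by both cases: bi-orbits decaying geometrically in both directions, whose
    values at time 0 span a dense subspace. *)
Lemma biorbit_family_mixing (R : realType)
    (T : {linear entire R[i] -> entire R[i]}) (X : nat -> int -> entire R[i]) :
  (forall r : R, exists s, forall (f : entire R[i]) M,
     bounded_disc f s M -> bounded_disc (T f) r M) ->
  (forall i k, T (X i k) = X i (k - 1)) ->
  (forall i (r : R), exists D, forall k,
     bounded_disc (X i k) r (D * 2^-1 ^+ `|k|)) ->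
  (forall (f : entire R[i]) (r e : R), 0 < e ->
     exists n (a : nat -> R[i]),
     bounded_disc (f - \sum_(0 <= i < n) a i *: X i 0) r e) ->
  hypercyclic T /\ exists2 mu : probability (borel (entire R[i])) R,
    strongly_mixing T mu & full_support mu.
Proof.
move=> TB XT XB XD; have [Z [ZT Z0 ZB ZD]] := ex_atoms XT XB XD.
have [P PF] := ex_fair_coins R (int * nat)%type.
have [mu muE] := image_probability P (measurable_random_entire ZB).
split; first exact: (random_entire_hypercyclic TB ZT Z0 ZD PF muE).
exists mu; first exact: (random_entire_strongly_mixing TB ZT PF muE).
exact: (random_entire_full_support Z0 ZD PF muE).
Qed.

(** * Bi-orbits at a fixed point *)

Section weighted_shift.
Context (R : realType) (lambda b z0 : R[i]).
Notation E := (entire R[i]).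
Notation T := (compderiv lambda b).
Hypothesis lambda1 : 1 <= cabs lambda.
Hypothesis z0_fixed : lambda * z0 + b = z0.
Implicit Types (z : R[i]) (r e : R) (n : nat) (k : int).

Let lambda_neq0 : lambda != 0.
Proof. by rewrite -cabs_gt0 (lt_le_trans ltr01). Qed.

(** In closed form [1 / (n! lambda^(n (n - 1) / 2))], the normalisation for which [T] sends
    [monomial n.+1] to [monomial n]. *)
Fixpoint shift_coef n : R[i] :=
  if n is m.+1 then shift_coef m / (m.+1%:R * lambda ^+ m) else 1.

Let shift_coef_neq0 n : shift_coef n != 0.
Proof.
elim: n => [|n IH] /=; first exact: oner_neq0.
by rewrite mulf_neq0// invr_eq0 mulf_neq0 ?pnatr_eq0// expf_neq0.
Qed.

Let shift_coef_le n : cabs (shift_coef n) <= n`!%:R^-1.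
Proof.
elim: n => [|n IH]; first by rewrite fact0 invr1 [cabs _](cabs1 R).
rewrite [shift_coef _]/=.
rewrite cabsM cabsV cabsM cabs_nat cabsX factS mulnC natrM [leRHS]invfM.
rewrite ler_pM ?cabs_ge0 ?invr_ge0 ?mulr_ge0 ?exprn_ge0 ?cabs_ge0//.
rewrite lef_pV2 ?posrE ?mulr_gt0 ?exprn_gt0 ?cabs_gt0 ?ltr0n//.
by rewrite ler_peMr// exprn_ege1.
Qed.

Let hderiv_monomial n :
  hderiv (fun z => shift_coef n * (z - z0) ^+ n)
         (fun z => shift_coef n * (n%:R * (z - z0) ^+ n.-1)).
Proof.
move=> z; apply: fderivZ.
have := fderiv_comp (g := fun v => v - z0) (fderivX (z - z0) n)
  (fderivB (fderiv_id z) (fderiv_cst z0 z)).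
by rewrite subr0 mulr1.
Qed.

Definition monomial n : E := projT1 (cid (hderiv_entire (hderiv_monomial n))).

Let monomialE n z : monomial n z = shift_coef n * (z - z0) ^+ n.
Proof. by rewrite /monomial; case: cid. Qed.

Let fderiv_monomial n z :
  fderiv (monomial n) z (shift_coef n * (n%:R * (z - z0) ^+ n.-1)).
Proof.
have -> : entire_val (monomial n) = fun z => shift_coef n * (z - z0) ^+ n.
  by apply/funext => w; exact: monomialE.
exact: hderiv_monomial.
Qed.

Let T_monomialS n : T (monomial n.+1) = monomial n.
Proof.
apply: entire_eq => z; rewrite (compderivE (fderiv_monomial _ _)) monomialE /=.
have -> : lambda * z + b - z0 = lambda * (z - z0).
  by rewrite -{1}z0_fixed; ring.
have n0 : n.+1%:R != 0 :> R[i] by rewrite pnatr_eq0.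
have l0 : lambda ^+ n != 0 by rewrite expf_neq0.
rewrite exprMn; move: n0 l0; move: (n.+1%:R) (lambda ^+ n) => u v u0 v0.
by field; rewrite u0 v0.
Qed.

Let T_monomial0 : T (monomial 0) = 0.
Proof.
apply: entire_eq => z; rewrite (compderivE (fderiv_monomial _ _)).
by rewrite mul0r mulr0.
Qed.

(** The bi-orbit through [monomial i]: going forward it reaches 0 after [i + 1] steps, whence the
    value 0 for negative [i + k]. *)
Let X (i : nat) k : E := if i%:Z + k is Posz n then monomial n else 0.

(** [s^n / n!] is [2^-n] times [(2 s)^n / n!], a term of the series of [expR (2 * s)]. *)
Let monomial_bound n r : 0 <= r ->
  bounded_disc (monomial n) r (expR (2 * (r + cabs z0)) * 2^-1 ^+ n).
Proof.
move=> r0 z zr; set s := r + cabs z0.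
have s0 : 0 <= s by rewrite addr_ge0// cabs_ge0.
have zs : cabs (z - z0) <= s by rewrite (le_trans (cabsB _ _))// lerD2r.
rewrite monomialE cabsM cabsX.
have zn : cabs (z - z0) ^+ n <= s ^+ n by rewrite lerXn2r ?nnegrE ?cabs_ge0.
rewrite (le_trans (ler_pM (cabs_ge0 _) _ (shift_coef_le n) zn)) ?exprn_ge0 ?cabs_ge0//.
have s2 : 0 <= 2 * s by rewrite mulr_ge0.
have : (2 * s) ^+ n / n`!%:R <= expR (2 * s).
  case: n {zn} => [|n]; first by rewrite expr0 fact0 divr1 (le_trans _ (expR_ge1Dx _))// lerDl.
  by rewrite (le_trans _ (expR_ge1Dxn n s2))// lerDr.
have h2 : 0 <= (2^-1 : R) ^+ n by rewrite exprn_ge0// invr_ge0.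
move=> /(ler_wpM2r h2); apply: le_trans.
rewrite le_eqVlt; apply/orP; left; apply/eqP; rewrite exprMn exprVn.
have t0 : (2 : R) ^+ n != 0 by rewrite expf_neq0.
have f0 : n`!%:R != 0 :> R by rewrite pnatr_eq0 -lt0n fact_gt0.
move: t0 f0; move: ((2 : R) ^+ n) (n`!%:R) (s ^+ n) => u v w u0 v0.
by field; rewrite u0 v0.
Qed.

Lemma weighted_shift_mixing : hypercyclic T /\
  exists2 mu : probability (borel E) R, strongly_mixing T mu & full_support mu.
Proof.
apply: (@biorbit_family_mixing R T X).
- move=> r; exists (cabs lambda * r + cabs b + 1) => f M fM.
  by rewrite -[M]divr1; exact: compderiv_bounded_disc.
- move=> i k; rewrite /X addrA; case: (i%:Z + k) => [[|n]|n].
  + exact: T_monomial0.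
  + by rewrite -addn1 PoszD addrK addn1; exact: T_monomialS.
  + by rewrite linear0.
(* The factor [2 ^+ i] converts decay in [n = i + k] into decay in [|k|], since [|k| <= n + i]. *)
- move=> i r; pose D := expR (2 * (`|r| + cabs z0)) * 2 ^+ i.
  have D0 : 0 <= D by rewrite mulr_ge0 ?expR_ge0 ?exprn_ge0.
  exists D => k; rewrite /X; case E1 : (i%:Z + k) => [n|n]; last first.
    by move=> z _; rewrite entire_zeroE cabs0 mulr_ge0// exprn_ge0// invr_ge0.
  apply: bounded_discW (monomial_bound n (normr_ge0 r)); first exact: ler_norm.
  rewrite -mulrA ler_wpM2l ?expR_ge0// exprVn exprVn ler_pdivlMr ?exprn_gt0//.
  rewrite ler_pdivrMl ?exprn_gt0// -exprD ler_weXn2l ?ler1n//.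
  by move: E1; lia.
- move=> f r e e0.
  have [n [a aP]] := entire_poly_approx (`|r| + cabs z0)
    (hderiv_shift z0 (entire_hderiv f)) e0.
  exists n, (fun j => a j / shift_coef j) => z zr.
  have zz : cabs (z - z0) <= `|r| + cabs z0.
    by rewrite (le_trans (cabsB _ _))// lerD2r (le_trans zr)// ler_norm.
  have := aP _ zz; rewrite subrK entire_subE entire_sumE.
  congr (cabs (_ - _) <= _); apply: eq_bigr => i _.
  by rewrite entire_scaleE /X addr0 monomialE mulrA divfK// shift_coef_neq0.
Qed.

End weighted_shift.

(** * Bi-orbits of a translation *)

Section left_primitive.
Context (R : realType).
Notation E := (entire R[i]).
Implicit Types (f h : E) (z : R[i]) (r C a e : R) (n : nat).

(** Exponential decay towards -oo on a half-strip, which is stable under left translations and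
    contains the disc of radius [r]. *)
Definition left_decay f a r C := forall z, complex.Re z <= r ->
  `|complex.Im z| <= r -> cabs (f z) <= C * expR (a * complex.Re z).

Lemma left_decay_ge0 f a r C z : left_decay f a r C -> complex.Re z <= r ->
  `|complex.Im z| <= r -> 0 <= C.
Proof.
move=> fC h1 h2; rewrite -(pmulr_lge0 _ (expR_gt0 (a * complex.Re z))).
by rewrite (le_trans (cabs_ge0 _) (fC z h1 h2)).
Qed.

(* [h z] is the integral of [f] over the segment from [z - 1] to [z]; the sum of
   the [h (z - n)] is the primitive of [f] that vanishes at -oo. *)
Lemma window_primitive f : exists2 h : E,
  (forall z, fderiv h z (f z - f (z - 1))) &
  (forall a r C, 0 <= a -> left_decay f a r C -> left_decay h a r C).
Proof.
have fdf := entire_hderiv f.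
pose g z t := f (z - 1 + (t%:C)%C * 1).
pose dg z t := ((f : (R[i])^o -> (R[i])^o)^`())%classic (z - 1 + (t%:C)%C * 1).
have rg z : rcont (g z).
  by apply: (@rcont_rderiv _ _ (fun t => dg z t * 1)) => t; exact: rderiv_line.
have [ddf dfddf] := hderiv_hderiv fdf.
have rdg z : rcont (dg z).
  by apply: (@rcont_rderiv _ _ (fun t => ddf (z - 1 + (t%:C)%C * 1) * 1)) => t;
    exact: rderiv_line.
pose H z := pint 0 1 (g z).
have dH : hderiv H (fun z => f z - f (z - 1)).
  move=> z; have dgE : pint 0 1 (dg z) = f z - f (z - 1).
    rewrite (pint_primitive (P := g z))//.
      by rewrite /g mul0r addr0 mulr1 subrK.
    by move=> t _; rewrite -[dg z t]mulr1; exact: rderiv_line.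
  apply/cderivP => e e0; pose r := cabs z + 2.
  have [M M0 fM] := entire_bounded f (r + 3).
  have M1 : 0 < M + 1 by rewrite ltr_wpDl.
  exists (Num.min 1 (e / (M + 1))); first by rewrite lt_min ltr01 divr_gt0.
  move=> h; rewrite lt_min => /andP[/ltW h1 h2].
  rewrite -dgE [_ * h]mulrC -pintZ// -!pintB//; last 2 first.
  - exact: rcontB.
  - exact: rcontZ.
  have : cabs (pint 0 1 (fun t => g (z + h) t - g z t - h * dg z t)) <=
      M * cabs h ^+ 2 * (1 - 0).
    apply: pint_le => //; first by apply: rcontB; [exact: rcontB|exact: rcontZ].
    move=> t /andP[t0 t1]; rewrite /g /dg [h * _]mulrC.
    have -> : z + h - 1 + (t%:C)%C * 1 = z - 1 + (t%:C)%C * 1 + h by ring.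
    apply: (taylor1 fdf M0 fM) => //.
    rewrite (le_trans (cabsD _ _))// (le_trans (lerD (cabsB _ _) (lexx _)))//.
    by rewrite cabs1 mulr1 cabs_real ger0_norm// /r; lra.
  move=> /le_trans; apply; rewrite subr0 mulr1 expr2 mulrA ler_wpM2r ?cabs_ge0//.
  rewrite (@le_trans _ _ ((M + 1) * cabs h))//.
    by rewrite ler_wpM2r ?cabs_ge0// lerDl.
  by rewrite mulrC -ler_pdivlMr ?ltW.
have [h hH] := hderiv_entire dH; exists h.
  move=> z; have -> : entire_val h = H by apply/funext => w; exact: hH.
  exact: dH.
move=> a r C a0 fC z zr1 zr2; rewrite hH.
have C0 := left_decay_ge0 fC zr1 zr2.
rewrite -[leRHS]mulr1 -[X in _ * X](subr0 1).
apply: pint_le => // t /andP[t0 t1]; rewrite /g.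
have re : complex.Re (z - 1 + (t%:C)%C * 1) = complex.Re z - 1 + t.
  by rewrite mulr1 cReD cReB.
have im : complex.Im (z - 1 + (t%:C)%C * 1) = complex.Im z.
  by rewrite mulr1 cImD cImB/=; ring.
apply: le_trans (fC _ _ _) _; rewrite ?im ?re//; first lra.
by rewrite ler_wpM2l// ler_expR ler_wpM2l//; lra.
Qed.

Lemma hderiv_affine_comp (f df : R[i] -> R[i]) (s c : R[i]) : hderiv f df ->
  hderiv (fun z => f (s * z + c)) (fun z => df (s * z + c) * s).
Proof.
move=> fdf z; apply: (fderiv_comp (g := fun v => s * v + c) (fdf _)).
have := fderivD (fderivZ s (fderiv_id z)) (fderiv_cst c z).
by move/fderiv_eq; apply; rewrite addr0 mulr1.
Qed.

(** [F z] is the sum of [h (z - j - 1)] over [j >= 0]. The shift by 1 makes [F] a preimage of [f]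
    under [compderiv 1 1]; as [a >= 1], the ratio [q] is at most 1/2 and the sum of [q^(j+1)] is at
    most [2 q]. *)
Lemma left_primitive f a : 1 <= a -> (forall r, exists C, left_decay f a r C) ->
  exists2 F : E, forall z, fderiv F (z + 1) (f z) &
    forall r C, left_decay f a r C -> left_decay F a r (2 * expR (- a) * C).
Proof.
move=> a1 fa; have a0 : 0 <= a by rewrite (le_trans ler01).
have [h dh hC] := window_primitive f.
pose q := expR (- a).
have q2 : q <= 2^-1.
  rewrite /q expRN lef_pV2 ?posrE ?expR_gt0//.
  by rewrite (le_trans _ (expR_ge1Dx a))//; lra.
have q0 : 0 <= q := expR_ge0 _.
have q01 : 0 <= q < 1 by rewrite q0; lra.
have ex_u j : exists u : E, forall z, u z = h (z - j.+1%:R).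
  exact: (hderiv_entire (hderiv_shift (- j.+1%:R) (entire_hderiv h))).
pose u j := projT1 (cid (ex_u j)).
have uE j z : u j z = h (z - j.+1%:R) by rewrite /u; case: cid.
have Re_nat n z : complex.Re (z - n%:R) = complex.Re z - n%:R.
  by rewrite cReB -(rmorph_nat (@real_complex R)).
have Im_nat n z : complex.Im (z - n%:R) = complex.Im z.
  by rewrite cImB -(rmorph_nat (@real_complex R)) subr0.
have shift_le n x : expR (a * (x - n%:R)) = expR (a * x) * q ^+ n.
  by rewrite /q -expRM_natl -expRD; congr expR; ring.
have decay_shift f' r C n z : left_decay f' a r C -> complex.Re z <= r ->
    `|complex.Im z| <= r ->
    cabs (f' (z - n%:R)) <= C * expR (a * complex.Re z) * q ^+ n.
  move=> fC h1 h2; rewrite -mulrA -shift_le -Re_nat; apply: fC.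
    by rewrite Re_nat (le_trans _ h1)// lerBlDr lerDl.
  by rewrite Im_nat.
have ReIm r z : cabs z <= r -> complex.Re z <= r /\ `|complex.Im z| <= r.
  move=> zr; split; last exact: le_trans (Im_le_cabs _) zr.
  by rewrite (le_trans (ler_norm _))// (le_trans (Re_le_cabs _) zr).
have gu : geometric u q.
  move=> r; have [C fC] := fa r; exists (C * expR (a * r)) => n z zr.
  have [h1 h2] := ReIm r z zr; have C0 := left_decay_ge0 fC h1 h2.
  rewrite uE; apply: le_trans (decay_shift _ _ _ n.+1 _ (hC _ _ _ a0 fC) h1 h2) _.
  have qn : 0 <= q ^+ n by rewrite exprn_ge0.
  have qS : q ^+ n.+1 <= q ^+ n by rewrite exprS ler_piMl//; lra.
  rewrite (le_trans (ler_wpM2l _ qS))//; first by rewrite mulr_ge0 ?expR_ge0.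
  by rewrite ler_wpM2r// ler_wpM2l// ler_expR ler_wpM2l.
have [F FP] := geometric_series_entire q01 gu.
pose S n : E := \sum_(0 <= j < n) u j.
(* The derivatives [f (z - j - 1) - f (z - j - 2)] telescope; the last term vanishes in the
   limit. *)
have dS n z : fderiv (S n) z (f (z - 1) - f (z - n.+1%:R)).
  have -> : entire_val (S n) = fun v => \sum_(0 <= j < n) h (1 * v - j.+1%:R).
    by apply/funext => v; rewrite /S entire_sumE; apply: eq_bigr => j _;
      rewrite uE mul1r.
  pose dhj j v := (f (1 * v - j.+1%:R) - f (1 * v - j.+1%:R - 1)) * 1.
  apply: fderiv_eq (@fderiv_sum _ _ _ (fun j v => h (1 * v - j.+1%:R)) dhj z _) _.
    by move=> j; exact: (hderiv_affine_comp 1 (- j.+1%:R) dh).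
  elim: n => [|n IH]; first by rewrite big_geq// subrr.
  have E : z - n.+2%:R = z - n.+1%:R - 1 by rewrite -[n.+2%:R]natr1; ring.
  by rewrite big_nat_recr//= IH /dhj !mul1r mulr1 E; ring.
exists F.
- move=> z; pose w := z + 1.
  pose d : R[i] := ((F : (R[i])^o -> (R[i])^o)^`())%classic w.
  suff dE : d = f z by rewrite -dE; exact: entire_hderiv.
  apply/eqP; rewrite -subr_eq0; apply/eqP/cabs_eq0/le_anti.
  rewrite cabs_ge0 andbT; apply/ler_addgt0Pl => e e0; rewrite addr0.
  have [B BP] := gu (cabs w + 1).
  have [C fC] := fa (cabs w).
  have [w1 w2] := ReIm (cabs w) w (lexx _).
  pose K := 2 * B / (1 - q); pose L := C * expR (a * complex.Re w) * q.
  have [n nP] := ge0_expr_lt (K + L) q01 e0.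
  (* Cauchy's estimate with margin 1 transfers the tail bound from [F - S n] to its derivative. *)
  have H1 : cabs (d - (f (w - 1) - f (w - n.+1%:R))) <= K * q ^+ n.
    have dFS := fderivB (entire_hderiv F w) (dS n w).
    rewrite /d -(fderiv_uniq (entire_hderiv (F - S n) w) dFS) -[leRHS]divr1.
    apply: (cauchy_disc (entire_hderiv (F - S n)) ltr01 (r := cabs w)) => //.
    exact: FP BP n.
  have H2 : cabs (f (w - n.+1%:R)) <= L * q ^+ n.
    have := decay_shift f _ _ n.+1 w fC w1 w2.
    by rewrite exprS mulrA.
  have wz : w - 1 = z by rewrite /w addrK.
  rewrite -wz; have -> : d - f (w - 1) =
      (d - (f (w - 1) - f (w - n.+1%:R))) - f (w - n.+1%:R) by ring.
  by rewrite (le_trans (cabsB _ _))// (le_trans _ nP)// mulrDl lerD.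
- move=> r C fC z z1 z2; have C0 := left_decay_ge0 fC z1 z2.
  apply/ler_addgt0Pl => e e0.
  have [B BP] := gu (cabs z).
  have [n nP] := ge0_expr_lt (2 * B / (1 - q)) q01 e0.
  have H1 := FP _ _ BP n z (lexx _).
  have -> : F z = (F - S n) z + S n z by rewrite entire_subE subrK.
  rewrite (le_trans (cabsD _ _))// lerD//; first exact: le_trans H1 nP.
  rewrite /S entire_sumE (le_trans (cabs_sum _ _ _))//.
  pose D := C * expR (a * complex.Re z).
  have D0 : 0 <= D by rewrite mulr_ge0 ?expR_ge0.
  rewrite (@le_trans _ _ (\sum_(0 <= j < n) D * q * q ^+ j))//.
    apply: ler_sum => j _; rewrite uE -mulrA -exprS.
    exact: decay_shift (hC _ _ _ a0 fC) z1 z2.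
  rewrite -mulr_sumr.
  have : \sum_(0 <= j < n) q ^+ j <= 2.
    apply: le_trans (sum_expr_le n q01) _; rewrite ler_pdivrMr; lra.
  have -> : 2 * expR (- a) * C * expR (a * complex.Re z) = D * q * 2.
    by rewrite /D /q; ring.
  by move=> s2; rewrite ler_wpM2l// mulr_ge0.
Qed.

End left_primitive.

(** * Forward and backward orbits of the Gaussian monomials *)

Section gaussian.
Context (R : realType).
Notation E := (entire R[i]).
Implicit Types (f : E) (z w : R[i]) (r C a L : R) (i n : nat).

Lemma fderiv_gauss z :
  fderiv (fun v : R[i] => cexp (- (v * v))) z (cexp (- (z * z)) * - (2 * z)).
Proof.
have := fderiv_comp (g := fun v => - (v * v)) (fderiv_cexp (- (z * z)))
  (fderivN (fderivM (fderiv_id z) (fderiv_id z))).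
by move/fderiv_eq; apply; congr (_ * - _); rewrite mul1r mulr1; ring.
Qed.

Lemma hderiv_monomial_gauss i : hderiv (fun z : R[i] => z ^+ i * cexp (- (z * z)))
  (fun z => i%:R * z ^+ i.-1 * cexp (- (z * z)) +
            z ^+ i * (cexp (- (z * z)) * - (2 * z))).
Proof. by move=> z; apply: fderivM (fderiv_gauss z); exact: fderivX. Qed.

Definition gauss i : E := projT1 (cid (hderiv_entire (hderiv_monomial_gauss i))).

Lemma gaussE i z : gauss i z = z ^+ i * cexp (- (z * z)).
Proof. by rewrite /gauss; case: cid. Qed.

(** The exponential factor has modulus [exp(y^2 - x^2)], and [|z|^i <= i! exp |z|]. *)
Lemma cabs_gauss i z : cabs (gauss i z) <=
  i`!%:R * expR (cabs z + (complex.Im z ^+ 2 - complex.Re z ^+ 2)).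
Proof.
rewrite gaussE cabsM cabsX cabs_cexp cReN cReM -!expr2 opprB expRD mulrA.
rewrite ler_wpM2r ?expR_ge0// mulrC -ler_pdivrMr ?ltr0n ?fact_gt0//.
case: i => [|i]; first by rewrite expr0 fact0 divr1 (le_trans _ (expR_ge1Dx _))// lerDl cabs_ge0.
by rewrite (le_trans _ (expR_ge1Dxn i (cabs_ge0 z)))// lerDr.
Qed.

Lemma gauss_left_decay i a r : 0 <= a -> exists C, left_decay (gauss i) a r C.
Proof.
(* [(1 + a)^2 / 4] is the maximum of [(1 + a) u - u^2] over [u = |Re z|]; the imaginary part
   contributes [r + r^2]. *)
move=> a0; exists (i`!%:R * expR (r + r ^+ 2 + (1 + a) ^+ 2 / 4)) => z zr1 zr2.
apply: (le_trans (cabs_gauss i z)); rewrite -mulrA ler_wpM2l// -expRD ler_expR.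
have := cabs_le_ReIm z; set x := complex.Re z; set y := complex.Im z in zr2 *.
move=> zxy; have r0 : 0 <= r := le_trans (normr_ge0 _) zr2.
have y2 : y ^+ 2 <= r ^+ 2 by rewrite -real_normK ?num_real// lerXn2r ?nnegrE.
have ax : - (a * `|x|) <= a * x.
  by rewrite -mulrN ler_wpM2l// lerNl -normrN ler_norm.
have x2 : x ^+ 2 = `|x| ^+ 2 by rewrite real_normK ?num_real.
have : 0 <= (`|x| - (1 + a) / 2) ^+ 2 by exact: sqr_ge0.
by rewrite x2; move: `|x| `|y| zxy zr2 ax => u v; nra.
Qed.

Notation D := (compderiv (1 : R[i]) 1).

Lemma compderiv11 f z : fderiv f (z + 1) (D f z).
Proof. by rewrite /= mul1r; exact: entire_hderiv. Qed.

Lemma iter_compderiv11 f (F : nat -> R[i] -> R[i]) n z : derivatives F ->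
  F 0%N = f -> iter n D f z = F n (z + n%:R).
Proof.
move=> dF F0; elim: n z => [|n IH] z; first by rewrite addr0 F0.
rewrite iterS; apply: compderivE.
have -> : entire_val (iter n D f) = fun v => F n (v + n%:R).
  by apply/funext => v; exact: IH.
have := hderiv_shift n%:R (dF n) (1 * z + 1).
by rewrite mul1r -addrA -[n.+1%:R]natr1 [1 + _]addrC.
Qed.

(** On the disc of radius [r + n / 4] about [n] the quadratic part of the exponent is
    [(-1 + 1/2 + 1/16) n^2], that is [-7/16 n^2]. *)
Lemma gauss_far i n r z : 0 <= r -> cabs z <= r + n%:R / 4 ->
  cabs (gauss i (z + n%:R)) <=
  i`!%:R * expR (n%:R + r + n%:R / 4 + (2 * n%:R * (r + n%:R / 4)
    + (r + n%:R / 4) ^+ 2 - n%:R ^+ 2)).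
Proof.
set s := r + n%:R / 4 => r0 zs.
apply: (le_trans (cabs_gauss i _)); rewrite ler_wpM2l// ler_expR.
have s0 : 0 <= s by rewrite addr_ge0// divr_ge0.
have nC : (n%:R : R[i]) = ((n%:R)%:C)%C by rewrite rmorph_nat.
have zn : cabs (z + n%:R) <= s + n%:R.
  by rewrite (le_trans (cabsD _ _))// cabs_nat lerD2r.
have re : complex.Re (z + n%:R) = complex.Re z + n%:R by rewrite nC cReD.
have im : complex.Im (z + n%:R) = complex.Im z by rewrite nC cImD/= addr0.
have hx := le_trans (Re_le_cabs z) zs; have hy := le_trans (Im_le_cabs z) zs.
have y2 : complex.Im z ^+ 2 <= s ^+ 2.
  by rewrite -real_normK ?num_real// lerXn2r ?nnegrE.
rewrite re im; move: hx; rewrite ler_norml => /andP[hx _].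
have hn : - (n%:R * s) <= n%:R * complex.Re z by rewrite -mulrN ler_wpM2l.
have sE : s = r + n%:R / 4 by [].
have := sqr_ge0 (complex.Re z).
clearbody s; move: zn y2 hn sE.
move: (cabs (z + n%:R)) (complex.Re z) (complex.Im z) (n%:R : R) => u x y m.
by move=> *; lra.
Qed.

(** The [n]-th iterate is the [n]-th derivative near [n]. Cauchy steps of length 1/4 cost
    [4^n <= e^(2 n)], negligible against [exp(-7/16 n^2)], so any rate [L] can be reached. *)
Lemma gauss_forward i r L : 0 <= r -> exists2 C, 0 <= C & forall n,
  bounded_disc (iter n D (gauss i)) r (C * expR (- L) ^+ n).
Proof.
(* [s] is the coefficient of [n] in the exponent once [2 n] from the Cauchy steps and [L n] from the
   target rate are added; [4 / 7 * s ^+ 2] is the maximum of [s n - 7/16 n^2]. *)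
move=> r0; pose s := 5 / 4 + 5 * r / 2 + 2 + L.
exists (i`!%:R * expR (r + r ^+ 2 + 4 / 7 * s ^+ 2)).
  by rewrite mulr_ge0 ?expR_ge0.
have [F dF F0] := ex_derivatives (entire_hderiv (gauss i)).
move=> n z zr; rewrite (iter_compderiv11 n z dF F0).
pose M := i`!%:R * expR (n%:R + r + n%:R / 4 + (2 * n%:R * (r + n%:R / 4)
    + (r + n%:R / 4) ^+ 2 - n%:R ^+ 2)) : R.
have dG : derivatives (fun k z => F k (z + n%:R)).
  by move=> k; exact: hderiv_shift.
have q0 : 0 < 4^-1 :> R by rewrite invr_gt0.
have H := @cauchy_iter R _ r 4^-1 M n dG q0.
apply: le_trans (H _ z zr) _.
  by move=> v vr; rewrite F0; exact: gauss_far.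
rewrite exprVn invrK /M -mulrA -[leRHS]mulrA ler_wpM2l//.
have e4 : (4 : R) ^+ n <= expR (n%:R * 2).
  rewrite expRM_natl lerXn2r ?nnegrE ?expR_ge0//.
  have -> : (2 : R) = 1 + 1 by ring.
  rewrite expRD; have : 2 <= expR (1 : R) by rewrite (le_trans _ (expR_ge1Dx _)).
  by move=> h; nra.
rewrite (le_trans (ler_wpM2l (expR_ge0 _) e4))// -expRM_natl -!expRD ler_expR.
have : 0 <= (n%:R - 8 / 7 * s) ^+ 2 by exact: sqr_ge0.
by rewrite /s; move: (n%:R : R) => u; lra.
Qed.

Lemma gauss_backward i a : 1 <= a -> exists2 B : nat -> E, B 0%N = gauss i &
  (forall n z, fderiv (B n.+1) (z + 1) (B n z)) /\
  (forall r, exists C, forall n,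
     left_decay (B n) a r ((2 * expR (- a)) ^+ n * C)).
Proof.
move=> a1; have a0 : 0 <= a by rewrite (le_trans ler01).
(* Decay on all half-strips is carried in the type, so that [left_primitive] can be iterated. *)
pose S := {f : E | forall r, exists C, left_decay f a r C}.
have nxt (f : S) : exists g : S, (forall z, fderiv (sval g) (z + 1) (sval f z)) /\
    forall r C, left_decay (sval f) a r C ->
      left_decay (sval g) a r (2 * expR (- a) * C).
  case: f => f fS /=; have [F dF FC] := left_primitive a1 fS.
  have FS r : exists C, left_decay F a r C.
    by have [C fC] := fS r; exists (2 * expR (- a) * C); exact: FC.
  by exists (exist _ F FS).
pose next (f : S) := projT1 (cid (nxt f)).
have nextP (f : S) : (forall z, fderiv (sval (next f)) (z + 1) (sval f z)) /\
    forall r C, left_decay (sval f) a r C ->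
      left_decay (sval (next f)) a r (2 * expR (- a) * C).
  by rewrite /next; case: cid.
pose start : S := exist (fun f : E => forall r, exists C, left_decay f a r C)
  (gauss i) (fun r => gauss_left_decay i r a0).
pose B n := iter n next start.
exists (fun n => sval (B n)) => //; split=> [n z|r].
  exact: (nextP (B n)).1.
have [C gC] := gauss_left_decay i r a0; exists C; elim=> [|n IH].
  by rewrite expr0 mul1r.
by rewrite exprS -mulrA; exact: (nextP (B n)).2.
Qed.

End gaussian.

(** * The translation case, by rescaling *)

Section translation.
Context (R : realType) (b : R[i]).
Notation E := (entire R[i]).
Hypothesis b0 : b != 0.
Implicit Types (z w : R[i]) (r e : R) (i n : nat) (k : int).

(* [a] and [L] make the ratios [cabs b * (2 * expR (- a))] of the backward orbit
   and [cabs b^-1 * expR (- L)] of the forward orbit at most [2^-1]. *)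
Let a : R := 1 + 4 * cabs b.

Let L : R := 2 / cabs b.

Let cb0 : 0 < cabs b. Proof. by rewrite cabs_gt0. Qed.

Let a1 : 1 <= a. Proof. by rewrite lerDl mulr_ge0// ltW. Qed.

Let back i : nat -> E := projT1 (cid2 (gauss_backward i a1)).

Let backP i : [/\ back i 0%N = gauss R i,
  forall n z, fderiv (back i n.+1) (z + 1) (back i n z) &
  forall r, exists C, forall n,
     left_decay (back i n) a r ((2 * expR (- a)) ^+ n * C)].
Proof. by rewrite /back; case: cid2 => B B0 []. Qed.

Let orbit i k : E := match k with
  | Posz n => back i n
  | Negz n => iter n.+1 (compderiv 1 1) (gauss R i)
  end.

Let orbit_deriv i k z : fderiv (orbit i k) (z + 1) (orbit i (k - 1) z).
Proof.
have [B0 Bd _] := backP i; case: k => [[|n]|n].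
- by rewrite /= B0; exact: compderiv11.
- by rewrite (_ : Posz n.+1 - 1 = n); [exact: Bd|rewrite -addn1 PoszD addrK].
- have -> : Negz n - 1 = Negz n.+1 by rewrite !NegzE -[in RHS]addn1 PoszD; ring.
  exact: compderiv11.
Qed.

(** The substitution [z = b w] turns differentiation followed by translation by [b] into [b^-1]
    times the same with translation by 1; the weight [b^k] absorbs this factor. *)
Let weight k : R[i] := match k with
  | Posz n => b ^+ n
  | Negz n => b^-1 ^+ n.+1
  end.

Let weight_pred k : weight k * b^-1 = weight (k - 1).
Proof.
case: k => [[|n]|n].
- by rewrite /= expr0 mul1r expr1.
- rewrite (_ : Posz n.+1 - 1 = n) /= ?exprSr ?mulfK//.
  by rewrite -addn1 PoszD addrK.
- have -> : Negz n - 1 = Negz n.+1 by rewrite !NegzE -[in RHS]addn1 PoszD; ring.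
  by rewrite /= [in RHS]exprSr.
Qed.

Let ex_family i k : exists g : E,
  forall z, g z = weight k * orbit i k (b^-1 * z + 0).
Proof.
have H := hderiv_affine_comp b^-1 0 (entire_hderiv (orbit i k)).
exact: (hderiv_entire (fun z => fderivZ (weight k) (H z))).
Qed.

Let X i k : E := projT1 (cid (ex_family i k)).

Let XE i k z : X i k z = weight k * orbit i k (b^-1 * z).
Proof. by rewrite /X; case: cid => g /= ->; rewrite addr0. Qed.

Let X_T i k : compderiv 1 b (X i k) = X i (k - 1).
Proof.
apply: entire_eq => z; apply: compderivE; rewrite XE -weight_pred -mulrA.
have -> : entire_val (X i k) = fun v => weight k * orbit i k (b^-1 * v + 0).
  by apply/funext => v; rewrite XE addr0.
apply: fderivZ; rewrite mul1r [b^-1 * orbit _ _ _]mulrC.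
apply: (fderiv_comp (g := fun v => b^-1 * v + 0)).
  by rewrite mulrDr mulVf// addr0; exact: orbit_deriv.
have := fderivD (fderivZ b^-1 (fderiv_id (z + b))) (fderiv_cst 0 (z + b)).
by move/fderiv_eq; apply; rewrite addr0 mulr1.
Qed.

Let scaled_disc r z : cabs z <= r -> cabs (b^-1 * z) <= `|r| / cabs b.
Proof.
move=> zr; rewrite cabsM cabsV mulrC ler_wpM2r ?invr_ge0 ?cabs_ge0//.
exact: le_trans zr (ler_norm _).
Qed.

Let X_bounded i r : exists C, forall k, bounded_disc (X i k) r (C * 2^-1 ^+ `|k|).
Proof.
pose s := `|r| / cabs b; have s0 : 0 <= s by rewrite divr_ge0// cabs_ge0.
have [_ _ /(_ s)[C1 C1P]] := backP i.
have [C2 C20 C2P] := gauss_forward i L s0.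
have a0 : 0 <= a := le_trans ler01 a1.
(* From [1 + a <= expR a] and [1 + a = 2 + 4 |b|], the ratio is at most [2 |b| / (2 + 4 |b|)]. *)
have q1 : cabs b * (2 * expR (- a)) <= 2^-1.
  have : (1 + a) * expR (- a) <= 1.
    by rewrite expRN ler_pdivrMr ?expR_gt0// mul1r expR_ge1Dx.
  have := expR_gt0 (- a); rewrite /a; move: (expR _) => u u0; nra.
have q2 : cabs b^-1 * expR (- L) <= 2^-1.
  rewrite cabsV expRN -invfM lef_pV2 ?posrE ?mulr_gt0 ?expR_gt0//.
  rewrite mulrC -ler_pdivrMr// (le_trans _ (expR_ge1Dx L))// /L.
  by rewrite lerDr.
exists (`|C1| * expR (a * s) + C2) => k z zr.
have zs : cabs (b^-1 * z) <= s := scaled_disc zr.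
clearbody s; have h2 n : 0 <= (2^-1 : R) ^+ n by rewrite exprn_ge0// invr_ge0.
rewrite XE cabsM; case: k => n.
- have zs1 : complex.Re (b^-1 * z) <= s.
    by rewrite (le_trans (ler_norm _))// (le_trans (Re_le_cabs _)).
  have zs2 : `|complex.Im (b^-1 * z)| <= s by rewrite (le_trans (Im_le_cabs _)).
  have H := C1P n _ zs1 zs2.
  have C10 : 0 <= C1.
    by have := left_decay_ge0 (C1P 0%N) zs1 zs2; rewrite expr0 mul1r.
  rewrite /= cabsX (le_trans (ler_wpM2l _ H)) ?exprn_ge0 ?cabs_ge0//.
  rewrite !mulrA -exprMn (@le_trans _ _ (2^-1 ^+ n * (`|C1| * expR (a * s))))//.
    rewrite -!mulrA ler_pM//.
    + by rewrite exprn_ge0// mulr_ge0 ?cabs_ge0// mulr_ge0 ?expR_ge0.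
    + by rewrite mulr_ge0 ?expR_ge0.
    + by rewrite lerXn2r ?nnegrE ?invr_ge0// mulr_ge0 ?cabs_ge0// mulr_ge0 ?expR_ge0.
    + by rewrite ler_pM ?expR_ge0 ?ler_norm// ler_expR ler_wpM2l.
  by rewrite mulrC ler_wpM2r// lerDl.
- have H := C2P n.+1 _ zs.
  rewrite [weight _]/= cabsX (le_trans (ler_wpM2l _ H)) ?exprn_ge0 ?cabs_ge0//.
  rewrite mulrCA -exprMn (@le_trans _ _ (C2 * 2^-1 ^+ n.+1))//.
    by rewrite ler_wpM2l// lerXn2r ?nnegrE ?invr_ge0// mulr_ge0 ?cabs_ge0 ?expR_ge0.
  by rewrite ler_wpM2r// lerDr mulr_ge0 ?expR_ge0.
Qed.

(** Polynomials approximate [f (b w) exp(w^2)]; multiplication by [exp(-w^2)] gives the claim, at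
    the price of its bound [expR (s ^+ 2)] on the disc of radius [s]. *)
Let X_dense (f : E) r e : 0 < e -> exists n (c : nat -> R[i]),
  bounded_disc (f - \sum_(0 <= i < n) c i *: X i 0) r e.
Proof.
move=> e0; pose s := `|r| / cabs b.
have H := hderiv_affine_comp b 0 (entire_hderiv f).
have gz z : fderiv (fun v : R[i] => cexp (v * v)) z (cexp (z * z) * (2 * z)).
  have := fderiv_comp (g := fun v => v * v) (fderiv_cexp (z * z))
    (fderivM (fderiv_id z) (fderiv_id z)).
  by move/fderiv_eq; apply; congr (_ * _); rewrite mul1r mulr1; ring.
have d0 : 0 < e / expR (s ^+ 2) by rewrite divr_gt0 ?expR_gt0.
have [n [c cP]] := entire_poly_approx s (fun z => fderivM (H z) (gz z)) d0.
exists n, c => z zr; have zs := scaled_disc zr; have {cP} := cP _ zs.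
rewrite entire_subE entire_sumE; set w := b^-1 * z in zs *.
have bw : b * w + 0 = z by rewrite addr0 /w mulrA mulfV// mul1r.
rewrite bw ler_pdivlMr ?expR_gt0// => cP; apply: le_trans cP.
have -> : f z - \sum_(0 <= j < n) (c j *: X j 0) z =
    (f z * cexp (w * w) - \sum_(0 <= j < n) c j * w ^+ j) * cexp (- (w * w)).
  rewrite mulrBl -mulrA [cexp (w * w) * _]mulrC cexpNM mulr1; congr (_ - _).
  rewrite mulr_suml; apply: eq_bigr => j _.
  have [B0 _ _] := backP j.
  by rewrite entire_scaleE XE /= expr0 mul1r B0 gaussE mulrA.
rewrite cabsM ler_wpM2l ?cabs_ge0// cabs_cexp ler_expR cReN cReM -!expr2 opprB.
have y2 : complex.Im w ^+ 2 <= s ^+ 2.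
  rewrite -real_normK ?num_real// lerXn2r ?nnegrE//.
    by rewrite divr_ge0// cabs_ge0.
  exact: le_trans (Im_le_cabs _) zs.
have := sqr_ge0 (complex.Re w); lra.
Qed.

Lemma translation_mixing : hypercyclic (compderiv 1 b) /\
  exists2 mu : probability (borel E) R,
    strongly_mixing (compderiv 1 b) mu & full_support mu.
Proof.
apply: (@biorbit_family_mixing R (compderiv 1 b) X) => //.
move=> r; exists (cabs (1 : R[i]) * r + cabs b + 1) => f M fM.
by rewrite -[M]divr1; exact: compderiv_bounded_disc.
Qed.

End translation.

(** * The theorem, by cases on the fixed points of the affine map *)

Unset Implicit Arguments.
Set Strict Implicit.
Set Printing Implicit Defensive.

Theorem proposition2p3 (R : realType) (lambda b : R[i]) :
  exists T : {linear entire R[i] -> entire R[i]},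
    [/\ continuous T,
        forall (f : entire R[i]) (z : R[i]), T f z = (f^`())%classic (lambda * z + b),
        hypercyclic T <-> 1 <= `|lambda|
      & 1 <= `|lambda| ->
        exists2 mu : probability (borel (entire R[i])) R,
          strongly_mixing T mu & full_support mu].
Proof.
have mixing : 1 <= cabs lambda -> hypercyclic (compderiv lambda b) /\
    exists2 mu : probability (borel (entire R[i])) R,
      strongly_mixing (compderiv lambda b) mu & full_support mu.
  move=> lambda1; have [lambdaE|lambda_neq1] := eqVneq lambda 1.
    have [->|b0] := eqVneq b 0; last by rewrite lambdaE; exact: translation_mixing.
    (* For [lambda = 1] and [b = 0] every point is fixed, so 0 will do. *)
    by apply: (weighted_shift_mixing (z0 := 0)) => //; rewrite mulr0 addr0.
  apply: (weighted_shift_mixing (z0 := b / (1 - lambda))) => //.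
  have l0 : 1 - lambda != 0 by rewrite subr_eq0 eq_sym.
  by field.
have absE : (1 <= `|lambda|) = (1 <= cabs lambda) by rewrite normr_cabs lecR.
exists (compderiv lambda b); rewrite absE; split.
- exact: compderiv_continuous.
- by [].
- split=> [hyp|/mixing[]//]; rewrite leNgt; apply/negP => lambda1.
  exact: compderiv_not_hypercyclic lambda1 hyp.
- by move/mixing => [].
Qed.
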